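(* Let $K\ge 1$, $t>1$, $\lambda_0^1,\dots,\lambda_0^K>0$ with $\sum_k\lambda_0^k=1$, and $\nu_1,\nu_0^1,\dots,\nu_0^K\in\mathcal P_2(\mathbb R^d)$. Fix $Y\in L^2$ with $Y\sim\nu_1$. Consider the problems (and their values) $$(\mathcal Q)\quad\inf\Big\{\tfrac12\Big\|tY-(t-1)\sum_k\lambda_0^kZ^k\Big\|_{L^2}^2\ :\ Z^k\in L^2,\ Z^k_\#P\preceq_C\nu_0^k\ \ \forall k\Big\},$$ $$(\mathcal Q')\quad\inf\Big\{\tfrac12\int\Big|ty-(t-1)\sum_k\lambda_0^k\int z\,\mathrm d\pi^k_y(z)\Big|^2\mathrm d\nu_1(y)\ :\ \pi^k\in\Gamma(\nu_1,\nu_0^k)\ \ \forall k\Big\}.$$ Then $(\mathcal Q)=(\mathcal Q')$. Moreover, if $(\pi^k)_k$ solves $(\mathcal Q')$, then the maps $Z^k\in L^2$ defined for all $k$ by $$Z^k(\omega):=\int y\,\mathrm d\pi^k_{Y(\omega)}(y)\quad\text{for }P\text{-a.e. }\omega\in\Omega$$ solve $(\mathcal Q)$. Conversely, for any solution $(Z^k)_k$ of $(\mathcal Q)$, if $\gamma^k\in\Gamma(P,\nu_0^k)$ are couplings with $Z^k(\omega)=\int z\,\mathrm d\gamma^k_\omega(z)$ for $P$-a.e. $\omega$, then the couplings $\pi^k\in\Gamma(\nu_1,\nu_0^k)$ defined by $$\int f(y,z)\,\mathrm d\pi^k(y,z)=\iiint f(y,z)\,\mathrm d\gamma^k_\omega(z)\,\mathrm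 d\eta_y(\omega)\,\mathrm d\nu_1(y)\qquad\forall f\in C_b(\mathbb R^d\times\mathbb R^d),$$ solve $(\mathcal Q')$.
   Context: $(\Omega,\mathcal F,P)$ is a fixed atomless, separable probability space, $L^2=L^2(\Omega,\mathcal F,P;\mathbb R^d)$, $Y\sim\nu_1$ means $Y_\#P=\nu_1$. $\mathcal P_2(\mathbb R^d)$ is the set of probability measures with finite second moment; $\mu\preceq_C\nu$ means $\int\varphi\,\mathrm d\mu\le\int\varphi\,\mathrm d\nu$ for all convex $\varphi:\mathbb R^d\to\mathbb R$. $\Gamma(\alpha,\beta)$ is the set of couplings with first marginal $\alpha$ and second marginal $\beta$. For $\pi\in\Gamma(\nu_1,\nu_0^k)$, $\pi_y$ denotes the disintegration with respect to the first marginal $\nu_1$; for $\gamma\in\Gamma(P,\nu_0^k)$, $\gamma_\omega$ denotes the disintegration with respect to $P$. By Strassen's theorem, $Z_\#P\preceq_C\nu$ iff there is $\gamma\in\Gamma(P,\nu)$ with $Z(\omega)=\int z\,\mathrm d\gamma_\omega(z)$ for $P$-a.e. $\omega$. $\eta:=(\mathrm{Id},Y)_\#P$, and $\eta_y$ is the disintegration of $\eta$ with respect to its second marginal $\nu_1$ (so $\mathrm dP(\omega)=\int\mathrm d\eta_y(\omega)\,\mathrm d\nu_1(y)$); thus $\pi^k$ in the last formula is the push-forward of $\gamma^k$ under $(\omega,z)\mapsto(Y(\omega),z)$. *)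

(* Defs.v *)
From HB Require Import structures.
From mathcomp Require Import all_boot all_order all_algebra.
From mathcomp Require Import all_classical all_reals all_analysis.

Set Implicit Arguments.
Unset Strict Implicit.
Unset Printing Implicit Defensive.

Import Order.TTheory GRing.Theory Num.Theory.
Import numFieldNormedType.Exports.

Local Open Scope classical_set_scope.
Local Open Scope ring_scope.

(* R^d is 'rV[R]_d with its Borel sigma-algebra, i.e. the one generated by the
   open sets of the library's topology on matrices. *)
Definition borel_matrix_display : measure_display.
Proof. exact. Qed.

HB.instance Definition _ (R : realType) (m n : nat) :=
  @isMeasurable.Build borel_matrix_display 'M[R]_(m, n)
    <<s [set U : set 'M[R]_(m, n) | open U] >>
    (@sigma_algebra0 _ setT _) (@sigma_algebraC _ _)
    (@sigma_algebra_bigcup _ setT _).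

(* The library's norm on 'rV[R]_d is the sup norm, hence this definition. *)
Definition enorm (R : realType) (d : nat) (x : 'rV[R]_d) : R :=
  Num.sqrt (\sum_(i < d) (x ord0 i) ^+ 2).

Definition barycenter (R : realType) (d : nat)
    (m : {measure set 'rV[R]_d -> \bar R}) : 'rV[R]_d :=
  \row_(i < d) \int[m]_z (z ord0 i).

Definition atomless (dO : measure_display) (O : measurableType dO)
    (R : realType) (P : probability O R) : Prop :=
  forall A, measurable A -> (0 < P A)%E ->
    exists B, [/\ measurable B, B `<=` A, (0 < P B)%E & (P B < P A)%E].

(* Separability of the measure algebra of P for the distance P (A `+` B);
   equivalently, L^2(P) is a separable Hilbert space. *)
Definition separable_probability (dO : measure_display) (O : measurableType dO)
    (R : realType) (P : probability O R) : Prop :=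
  exists C : nat -> set O, (forall n, measurable (C n)) /\
    forall A, measurable A -> forall e : R, 0 < e ->
      exists n, (P (A `+` C n) < e%:E)%E.

Definition finite_second_moment (R : realType) (d : nat)
    (mu : probability 'rV[R]_d R) : Prop :=
  (\int[mu]_x ((enorm x) ^+ 2)%:E < +oo)%E.

Definition L2norm (dO : measure_display) (O : measurableType dO)
    (R : realType) (d : nat) (P : probability O R) (X : O -> 'rV[R]_d) :
    \bar R :=
  ('N[P]_2%:E [EFin \o (@enorm R d \o X)])%E.

Definition in_L2 (dO : measure_display) (O : measurableType dO)
    (R : realType) (d : nat) (P : probability O R)
    (X : {mfun O >-> 'rV[R]_d}) : Prop :=
  (L2norm P X < +oo)%E.

Definition same_law (dT : measure_display) (T : measurableType dT)
    (R : realType) (mu nu : probability T R) : Prop :=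
  forall A, measurable A -> mu A = nu A.

(* A real-valued convex function on R^d has an affine minorant, so for mu and
   nu with finite second moment both integrals are well defined in
   ]-oo, +oo]. *)
Definition convex_order (R : realType) (d : nat)
    (mu nu : probability 'rV[R]_d R) : Prop :=
  forall phi : 'rV[R]_d -> R^o, convex_function setT phi ->
    (\int[mu]_x (phi x)%:E <= \int[nu]_x (phi x)%:E)%E.

Definition coupling (d1 d2 : measure_display) (T1 : measurableType d1)
    (T2 : measurableType d2) (R : realType) (alpha : probability T1 R)
    (beta : probability T2 R) (pi : probability (T1 * T2)%type R) : Prop :=
  (forall A, measurable A -> pushforward pi fst A = alpha A) /\
  (forall B, measurable B -> pushforward pi snd B = beta B).

Definition disintegration_fst (d1 d2 : measure_display)
    (T1 : measurableType d1) (T2 : measurableType d2) (R : realType)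
    (alpha : probability T1 R) (pi : probability (T1 * T2)%type R)
    (k : R.-pker T1 ~> T2) : Prop :=
  forall A B, measurable A -> measurable B ->
    pi (A `*` B) = (\int[alpha]_(x in A) k x B)%E.

Definition disintegration_snd (d1 d2 : measure_display)
    (T1 : measurableType d1) (T2 : measurableType d2) (R : realType)
    (beta : probability T2 R) (pi : probability (T1 * T2)%type R)
    (k : R.-pker T2 ~> T1) : Prop :=
  forall A B, measurable A -> measurable B ->
    pi (A `*` B) = (\int[beta]_(y in B) k y A)%E.

Definition id_pair (d1 d2 : measure_display) (T1 : measurableType d1)
    (T2 : measurableType d2) (f : T1 -> T2) (x : T1) : T1 * T2 := (x, f x).

Lemma measurable_id_pair (d1 d2 : measure_display) (T1 : measurableType d1)
    (T2 : measurableType d2) (f : {mfun T1 >-> T2}) :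
  measurable_fun setT (id_pair f).
Proof. exact: measurable_fun_pair. Qed.

HB.instance Definition _ (d1 d2 : measure_display) (T1 : measurableType d1)
    (T2 : measurableType d2) (f : {mfun T1 >-> T2}) :=
  isMeasurableFun.Build _ _ _ _ (id_pair f) (measurable_id_pair f).

Definition map_fst (d1 d2 d3 : measure_display) (T1 : measurableType d1)
    (T2 : measurableType d2) (T3 : measurableType d3) (f : T1 -> T2)
    (x : T1 * T3) : T2 * T3 := (f x.1, x.2).

Lemma measurable_map_fst (d1 d2 d3 : measure_display) (T1 : measurableType d1)
    (T2 : measurableType d2) (T3 : measurableType d3)
    (f : {mfun T1 >-> T2}) :
  measurable_fun setT (@map_fst _ _ _ T1 T2 T3 f).
Proof.
apply: measurable_fun_pair; last exact: measurable_snd.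
exact: (measurableT_comp (measurable_funPT f) measurable_fst).
Qed.

HB.instance Definition _ (d1 d2 d3 : measure_display)
    (T1 : measurableType d1) (T2 : measurableType d2) (T3 : measurableType d3)
    (f : {mfun T1 >-> T2}) :=
  isMeasurableFun.Build _ _ _ _ (@map_fst _ _ _ T1 T2 T3 f)
    (measurable_map_fst f).

Definition Q_cost (dO : measure_display) (O : measurableType dO)
    (R : realType) (d K : nat) (P : probability O R) (t : R)
    (lambda : 'I_K -> R) (Y : {mfun O >-> 'rV[R]_d})
    (Z : 'I_K -> {mfun O >-> 'rV[R]_d}) : \bar R :=
  ((2^-1)%:E * L2norm P (fun w =>
    (t *: Y w - (t - 1) *: \sum_(k < K) lambda k *: Z k w)%R) ^+ 2)%E.

Definition Q_admissible (dO : measure_display) (O : measurableType dO)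
    (R : realType) (d K : nat) (P : probability O R)
    (nu0 : 'I_K -> probability 'rV[R]_d R)
    (Z : 'I_K -> {mfun O >-> 'rV[R]_d}) : Prop :=
  forall k, in_L2 P (Z k) /\ convex_order (distribution P (Z k)) (nu0 k).

Definition Q_value (dO : measure_display) (O : measurableType dO)
    (R : realType) (d K : nat) (P : probability O R) (t : R)
    (lambda : 'I_K -> R) (nu0 : 'I_K -> probability 'rV[R]_d R)
    (Y : {mfun O >-> 'rV[R]_d}) : \bar R :=
  ereal_inf [set Q_cost P t lambda Y Z | Z in Q_admissible P nu0].

Definition Q_solution (dO : measure_display) (O : measurableType dO)
    (R : realType) (d K : nat) (P : probability O R) (t : R)
    (lambda : 'I_K -> R) (nu0 : 'I_K -> probability 'rV[R]_d R)
    (Y : {mfun O >-> 'rV[R]_d}) (Z : 'I_K -> {mfun O >-> 'rV[R]_d}) : Prop :=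
  Q_admissible P nu0 Z /\ Q_cost P t lambda Y Z = Q_value P t lambda nu0 Y.

Definition Q'_admissible (R : realType) (d K : nat)
    (nu1 : probability 'rV[R]_d R) (nu0 : 'I_K -> probability 'rV[R]_d R)
    (pi : 'I_K -> probability ('rV[R]_d * 'rV[R]_d)%type R) : Prop :=
  forall k, coupling nu1 (nu0 k) (pi k).

(* v is the cost of the family pi. A disintegration with respect to the first
   marginal exists on R^d and is unique up to a nu1-null set, so every
   admissible pi has exactly one cost. *)
Definition Q'_cost (R : realType) (d K : nat) (t : R) (lambda : 'I_K -> R)
    (nu1 : probability 'rV[R]_d R)
    (pi : 'I_K -> probability ('rV[R]_d * 'rV[R]_d)%type R) (v : \bar R) :
    Prop :=
  exists p : 'I_K -> R.-pker 'rV[R]_d ~> 'rV[R]_d,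
    (forall k, disintegration_fst nu1 (pi k) (p k)) /\
    v = ((2^-1)%:E * \int[nu1]_y ((enorm (t *: y -
          (t - 1) *: \sum_(k < K) lambda k *: barycenter (p k y))) ^+ 2)%:E)%E.

Definition Q'_value (R : realType) (d K : nat) (t : R) (lambda : 'I_K -> R)
    (nu1 : probability 'rV[R]_d R) (nu0 : 'I_K -> probability 'rV[R]_d R) :
    \bar R :=
  ereal_inf [set v | exists pi,
    Q'_admissible nu1 nu0 pi /\ Q'_cost t lambda nu1 pi v].

Definition Q'_solution (R : realType) (d K : nat) (t : R) (lambda : 'I_K -> R)
    (nu1 : probability 'rV[R]_d R) (nu0 : 'I_K -> probability 'rV[R]_d R)
    (pi : 'I_K -> probability ('rV[R]_d * 'rV[R]_d)%type R) : Prop :=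
  Q'_admissible nu1 nu0 pi /\
  Q'_cost t lambda nu1 pi (Q'_value t lambda nu1 nu0).

Definition glued_coupling (dO : measure_display) (O : measurableType dO)
    (R : realType) (d : nat) (nu1 : probability 'rV[R]_d R)
    (e : R.-pker 'rV[R]_d ~> O) (g : R.-pker O ~> 'rV[R]_d)
    (pi : probability ('rV[R]_d * 'rV[R]_d)%type R) : Prop :=
  forall f : 'rV[R]_d * 'rV[R]_d -> R, continuous f -> bounded_fun f ->
    (\int[pi]_x (f x)%:E =
     \int[nu1]_y \int[e y]_w \int[g w]_z (f (y, z))%:E)%E.

(* Main.v *)
(* The two problems are compared through conditional expectation given [Y].

   From couplings to maps: if [p] disintegrates a coupling of [nu1] and [nu0 k],
   then by Jensen's inequality [Z := barycenter (p (Y _))] has a law dominated by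
   [nu0 k] in the convex order, and it has the same cost. Disintegrations exist
   because [R^d] is coded measurably into [R], where the conditional law is the
   image of uniform noise under the conditional quantile function.

   From maps to couplings: an arbitrary admissible [Z] need not be constant on
   the fibres of [Y]. Replacing [Z] by its mean over the cells of a finite
   partition of [R^d] (small cells and one cell of small second moment, pulled
   back by [Y]) preserves the convex order
   and, by Pythagoras, almost does not increase the cost. For the resulting step
   functions Strassen's theorem is needed only up to an error: the dual problem,
   with the maximum of affine functions smoothed into a log-sum-exp, is bounded
   below by the convex order, and at a near minimizer the softmax weights are
   the densities of a coupling with almost the right barycenters.

   The same orthogonality argument, applied to the coupling of [Y] and the
   second coordinate of [gamma], shows that it costs at most as much as the map
   [Z] from which [gamma] comes; a solution thus yields a solution. *)
Require Import Defs.
From HB Require Import structures.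
From mathcomp Require Import all_boot all_order all_algebra.
From mathcomp Require Import all_classical all_reals all_analysis.
From mathcomp Require Import measurable_realfun ring lra.

Set Implicit Arguments.
Unset Strict Implicit.
Unset Printing Implicit Defensive.

Import Order.TTheory GRing.Theory Num.Theory.
Import numFieldNormedType.Exports.

Local Open Scope classical_set_scope.
Local Open Scope ring_scope.

(** * Borel sets of row vectors *)

(** A coupling built from an admissible [Z] must have [nu0 k] as its exact second marginal, whereas
    only its barycenters enter the cost. Exact barycenters would require a minimizer of the smoothed
    dual, and there may be none: if [nu0 k] is carried by two points and these are the means of the
    two cells, each density must vanish at the other point, while softmax weights are positive
    everywhere. Since only infima are compared, an error in the barycenters is harmless; an error in
    the masses of the cells is not, because it would spoil the marginals, so it is removed exactly.
    Finitely many cells leave finitely many dual parameters, and a quadratic remainder then turns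
    closeness to the infimum into a small gradient without any compactness.

    The cost of couplings is a relation, witnessed by some disintegration. Statements about
    solutions therefore also need the cost to be independent of that witness; this is the same
    projection inequality as the one that compares couplings with maps, used once in each
    direction. *)

Lemma open_measurable_mx (R : realType) (m n : nat) (U : set 'M[R]_(m, n)) :
  open U -> measurable U.
Proof. by move=> oU; exact: sub_sigma_algebra. Qed.

(** Lower semicontinuity suffices; this is the form in which convex functions are shown to be
    Borel. *)
Lemma lower_measurable_mx (R : realType) (m n : nat) (f : 'M[R]_(m, n) -> R) :
  (forall a, open [set x | a < f x]) -> measurable_fun setT f.
Proof.
move=> fo; apply: (measurability _ (RGenOInfty.measurableE R)).
move=> _ [_ [a ->] <-]; rewrite setTI; apply: open_measurable_mx.
rewrite [X in open X](_ : _ = [set x | a < f x])//.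
by apply/seteqP; split => x /=; rewrite in_itv/= andbT.
Qed.

Lemma continuous_measurable_mx (R : realType) (m n : nat)
    (f : 'M[R]_(m, n) -> R) : continuous f -> measurable_fun setT f.
Proof.
move=> cf; apply: lower_measurable_mx => a.
by apply: (@open_comp _ _ f [set x | a < x]) => // x _; exact: cf.
Qed.

Lemma measurable_coord (R : realType) (d : nat) (i : 'I_d) :
  measurable_fun setT (fun x : 'rV[R]_d => x ord0 i).
Proof. by apply: continuous_measurable_mx; exact: coord_continuous. Qed.

(** A countable base of the topology, which turns arbitrary unions of open sets into countable
    ones. *)
Definition rat_ball (R : realType) (d n : nat) : set 'rV[R]_d :=
  if unpickle n is Some (q, k) then
    ball (map_mx (@ratr R) (q : 'rV[rat]_d)) (k.+1%:R^-1 : R)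
  else set0.

Lemma rat_ball_near (R : realType) (d : nat) (x : 'rV[R]_d) (e : R) : 0 < e ->
  exists q : 'rV[rat]_d, ball (map_mx (@ratr R) q) e x.
Proof.
move=> e0.
have /choice[q qP] (i : 'I_d) : exists q : rat, `|ratr q - x ord0 i| < e.
  have /rat_in_itvoo[q] : x ord0 i - e < x ord0 i + e by lra.
  rewrite in_itv/= => /andP[q1 q2]; exists q.
  by rewrite ltr_norml; apply/andP; split; lra.
exists (\row_i q i); split => // i j /=; rewrite !mxE (ord1 i) //=.
exact: qP.
Qed.

Lemma open_rat_ballE (R : realType) (d : nat) (U : set 'rV[R]_d) : open U ->
  U = \bigcup_(n in [set n | @rat_ball R d n `<=` U]) @rat_ball R d n.
Proof.
move=> oU; apply/seteqP; split => [x Ux|x [n /= nU]]; last exact: nU.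
have : nbhs x U by exact: open_nbhs_nbhs.
move=> /nbhs_ballP[e /= e0 eU].
(* With a radius below [e / 2], a ball that contains [x] stays inside the ball of radius [e] about
   [x]. *)
have [k ke] : exists k, k.+1%:R^-1 < e / 2.
  have := @near_infty_natSinv_lt R (PosNum (divr_gt0 e0 (ltr0Sn R 1))).
  by move=> [k _ kP]; exists k; exact: (kP k (leqnn k)).
have [q qx] := @rat_ball_near _ _ x (k.+1%:R^-1) (ltac:(by [])).
exists (pickle (q, k)); rewrite /rat_ball/= pickleK//.
move=> y qy; apply: eU; rewrite (splitr e).
apply: (@ball_triangle _ _ (map_mx (@ratr R) q)).
  by apply: ball_sym; apply: le_ball qx; exact: ltW.
by apply: le_ball qy; exact: ltW.
Qed.

(** Balls of the sup norm are products of intervals, so the preimage of a basic ball is a finite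
    intersection of events about single coordinates. *)
Lemma measurable_fun_row (R : realType) (d : nat) (dT : measure_display)
    (T : measurableType dT) (f : T -> 'rV[R]_d) :
  (forall i, measurable_fun setT (fun x => f x ord0 i)) ->
  measurable_fun setT f.
Proof.
move=> mf.
apply: (@measurability _ _ _ _ _ _ [set U : set 'rV[R]_d | open U]) => //.
move=> _ [U oU <-]; rewrite setTI (open_rat_ballE oU) preimage_bigcup.
apply: bigcup_measurable => n _; rewrite /rat_ball.
case: unpickle => [[q k]|]; last by rewrite preimage_set0.
rewrite [X in measurable X](_ : _ = \bigcap_(i in [set: 'I_d])
  ((fun x => f x ord0 i) @^-1` ball (ratr (q ord0 i) : R) k.+1%:R^-1)).
  apply: fin_bigcap_measurable => // i _.
  by rewrite -[X in measurable X]setTI; apply: mf => //; exact: measurable_ball.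
apply/seteqP; split => x /=.
  by move=> [_ h] i _ /=; have := h ord0 i; rewrite mxE.
move=> h; split => // i j.
by have := h j Logic.I; rewrite /= (ord1 i) mxE.
Qed.

Lemma measurable_rowP (R : realType) (d : nat) (dT : measure_display)
    (T : measurableType dT) (f : T -> 'rV[R]_d) (i : 'I_d) :
  measurable_fun setT f -> measurable_fun setT (fun x => f x ord0 i).
Proof. by move=> mf; exact: (measurableT_comp (measurable_coord i) mf). Qed.

Lemma enorm2E (R : realType) (d : nat) (x : 'rV[R]_d) :
  enorm x ^+ 2 = \sum_i x ord0 i ^+ 2.
Proof. by rewrite sqr_sqrtr// sumr_ge0// => i _; exact: sqr_ge0. Qed.

Lemma measurable_enorm2 (R : realType) (d : nat) (dT : measure_display)
    (T : measurableType dT) (f : T -> 'rV[R]_d) : measurable_fun setT f ->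
  measurable_fun setT (fun x => enorm (f x) ^+ 2).
Proof.
move=> mf; under eq_fun do rewrite enorm2E.
by apply: measurable_sum => i; apply: measurable_funX; exact: measurable_rowP.
Qed.

(** * Disintegration *)

Lemma probability_integral_cst {R : realType} {dT : measure_display}
    {T : measurableType dT} (P : probability T R) (c : R) :
  (\int[P]__ c%:E = c%:E)%E.
Proof.
rewrite integral_cst//= [X in (_ * X)%E](_ : _ = 1%E) ?mule1//.
exact: probability_setT.
Qed.

Section disintegration_theory.
Context {R : realType} {d1 d2 : measure_display}.
Context {T1 : measurableType d1} {T2 : measurableType d2}.
Variables (alpha : probability T1 R) (k : R.-pker T1 ~> T2).

Local Open Scope ereal_scope.

(** The composition product of [alpha] and [k], the only measure of which [k] can be the
    disintegration. *)
Definition disintegrated (C : set (T1 * T2)) : \bar R :=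
  \int[alpha]_x k x (xsection C x).

Let measurable_xk (C : set (T1 * T2)) : measurable C ->
  measurable_fun setT (fun x => k x (xsection C x)).
Proof.
by move=> mC; apply: measurable_fun_xsection_finite_kernel; rewrite inE.
Qed.

Let disintegrated0 : disintegrated set0 = 0.
Proof.
rewrite /disintegrated; apply: integral0_eq => x _.
by rewrite xsection0 measure0.
Qed.

Let disintegrated_ge0 C : 0 <= disintegrated C.
Proof. by apply: integral_ge0 => x _; exact: measure_ge0. Qed.

Let disintegrated_sigma_additive : semi_sigma_additive disintegrated.
Proof.
move=> F mF tF mUF.
rewrite [X in _ --> X](_ : _ = \sum_(n <oo) disintegrated (F n)).
  exact: is_cvg_ereal_nneg_natsum_cond.
rewrite -integral_nneseries//; last by move=> n; exact: measurable_xk.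
apply: eq_integral => x _; rewrite xsection_bigcup.
rewrite measure_bigcup//; last exact: trivIset_xsection.
  by apply/congr_lim/funext => n; apply: eq_bigl => i; rewrite in_setT.
by move=> n _; exact: measurable_xsection.
Qed.

HB.instance Definition _ := isMeasure.Build _ _ _ disintegrated
  disintegrated0 disintegrated_ge0 disintegrated_sigma_additive.

Lemma disintegratedX A B : measurable A -> measurable B ->
  disintegrated (A `*` B) = \int[alpha]_(x in A) k x B.
Proof.
move=> mA mB; rewrite [RHS]integral_mkcond/=.
apply: eq_integral => x _; rewrite patchE.
by case: ifPn => xA; [rewrite in_xsectionX|rewrite notin_xsectionX// measure0].
Qed.

Let disintegrated_setT : disintegrated setT = 1.
Proof.
rewrite -setXTT disintegratedX//.
under eq_integral do rewrite prob_kernel.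
exact: probability_integral_cst.
Qed.

HB.instance Definition _ := Measure_isProbability.Build _ _ _ disintegrated
  disintegrated_setT.

Import HBNNSimple.

(** Tonelli's theorem for a kernel: on indicators it is the definition of [disintegrated], simple
    functions follow by linearity, and monotone convergence is applied to the outer and to the inner
    integral. *)
Lemma ge0_integral_disintegrated (f : T1 * T2 -> \bar R) :
  (forall z, 0 <= f z) -> measurable_fun setT f ->
  \int[disintegrated]_z f z = \int[alpha]_x \int[k x]_y f (x, y).
Proof.
move=> f0 mf.
pose f_ := nnsfun_approx measurableT mf.
have mk (g : T1 * T2 -> \bar R) : (forall z, 0 <= g z) ->
    measurable_fun setT g -> measurable_fun setT (fun x => \int[k x]_y g (x, y)).
  by move=> g0 mg; exact: (measurable_fun_integral_finite_kernel g k).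
have mpair (h : T1 * T2 -> \bar R) x : measurable_fun setT h ->
    measurable_fun setT (fun y => h (x, y)).
  by move=> mh; exact: (measurableT_comp mh (pair1_measurable x)).
have sfE (g : {nnsfun T1 * T2 >-> R}) :
    \int[disintegrated]_z (g z)%:E = \int[alpha]_x \int[k x]_y (g (x, y))%:E.
  have mg r : measurable (g @^-1` [set r]) by exact: measurable_funPTI.
  under [in LHS]eq_integral do rewrite fimfunE -fsumEFin//.
  rewrite ge0_integral_fsum//; last 2 first.
    - by move=> r; exact/measurable_EFinP/measurableT_comp.
    - by move=> r z _; rewrite EFinM nnfun_muleindic_ge0.
  under [in RHS]eq_integral.
    move=> x _.
    under eq_integral.
      by move=> z _; rewrite fimfunE -fsumEFin//; over.
    rewrite /= ge0_integral_fsum//; last 2 first.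
      - move=> r; apply: (mpair (fun z => (r * \1_(g @^-1` [set r]) z)%:E)).
        exact/measurable_EFinP/measurableT_comp.
      - by move=> r z _; rewrite EFinM nnfun_muleindic_ge0.
    over.
  rewrite ge0_integral_fsum//; last 2 first.
    (* A negative [r] is not a value of [g], so its level set is empty and the function vanishes. *)
    - move=> r; case: (leP 0%R r) => r0.
        apply: (mk (fun z => (r * \1_(g @^-1` [set r]) z)%:E)).
          by move=> z; rewrite lee_fin mulr_ge0.
        exact/measurable_EFinP/measurableT_comp.
      rewrite (_ : (fun _ => _) = cst 0)//; apply/funext => x/=.
      by rewrite integral0_eq// => y _; rewrite preimage_nnfun0// indic0 mulr0.
    - move=> r x _; apply: integral_ge0 => y _.
      by rewrite EFinM nnfun_muleindic_ge0.
  apply: eq_fsbigr => r _.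
  have [r0|r0] := leP 0%R r; last first.
    rewrite !integral0_eq//.
      by move=> x _; rewrite integral0_eq// => y _; rewrite preimage_nnfun0// indic0 mulr0.
    by move=> x _; rewrite preimage_nnfun0// indic0 mulr0.
  under eq_integral do rewrite EFinM.
  rewrite ge0_integralZl//; last exact/measurable_EFinP.
  rewrite integral_indic// setIT.
  under [in RHS]eq_integral => x _.
    under eq_integral do rewrite EFinM.
    rewrite ge0_integralZl//; last first.
      by apply: (mpair (fun z => (\1_(g @^-1` [set r]) z)%:E)); exact/measurable_EFinP.
    over.
  rewrite ge0_integralZl//; last 2 first.
    - by apply: (mk (fun z => (\1_(g @^-1` [set r]) z)%:E)) => //; exact/measurable_EFinP.
    - by move=> x _; exact: integral_ge0.
  congr (_ * _); apply: eq_integral => x _.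
  exact/esym/(congr1 (@^~ x) (kfcompkindic k (mg r))).
transitivity (\int[disintegrated]_z limn (fun n => (f_ n z)%:E)).
  by apply/eq_integral => z _; apply/esym/cvg_lim => //=; exact: cvg_nnsfun_approx.
rewrite monotone_convergence//; last 3 first.
  by move=> n; exact/measurable_EFinP.
  by move=> n z _; rewrite lee_fin.
  by move=> z _ a b ab; rewrite lee_fin; exact/lefP/nd_nnsfun_approx.
under eq_fun do rewrite sfE.
rewrite -monotone_convergence//; last 3 first.
- move=> n; apply: (mk (fun z => (f_ n z)%:E)) => [z|]; first by rewrite lee_fin.
  exact/measurable_EFinP.
- by move=> n y _; apply: integral_ge0 => // z _; rewrite lee_fin.
- move=> x _ a b ab; apply: ge0_le_integral => //.
  + by move=> z _; rewrite lee_fin.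
  + by apply: (mpair (fun z => (f_ a z)%:E)); exact/measurable_EFinP.
  + by apply: (mpair (fun z => (f_ b z)%:E)); exact/measurable_EFinP.
  + by move=> z _; rewrite lee_fin; exact/lefP/nd_nnsfun_approx.
apply: eq_integral => x _; rewrite -monotone_convergence//; last 3 first.
- by move=> n; apply: (mpair (fun z => (f_ n z)%:E)); exact/measurable_EFinP.
- by move=> n z _; rewrite lee_fin.
- by move=> z _ a b ab; rewrite lee_fin; exact/lefP/nd_nnsfun_approx.
by apply: eq_integral => y _; apply/cvg_lim => //; exact: cvg_nnsfun_approx.
Qed.

End disintegration_theory.

Lemma probability_prod_unique {R : realType} {d1 d2 : measure_display}
  {T1 : measurableType d1} {T2 : measurableType d2}
  (m1 m2 : {measure set (T1 * T2) -> \bar R}) :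
  (m1 setT < +oo)%E ->
  (forall A B, measurable A -> measurable B -> m1 (A `*` B) = m2 (A `*` B)) ->
  forall C, measurable C -> m1 C = m2 C.
Proof.
move=> m1T m12 C mC.
apply: (measure_unique [set A `*` B | A in measurable & B in measurable]
  (fun=> setT)) => //.
- exact: measurable_prod_measurableType.
- move=> _ _ [X1 mX1 [X2 mX2 <-]] [Y1 mY1 [Y2 mY2 <-]].
  exists (X1 `&` Y1); first exact: measurableI.
  by exists (X2 `&` Y2); [exact: measurableI|rewrite setXI].
- by move=> _; exists setT => //; exists setT => //; rewrite setXTT.
- by rewrite bigcup_const.
- by move=> _ [A mA [B mB <-]]; exact: m12.
Qed.

Section disintegration_fubini.
Context {R : realType} {d1 d2 : measure_display}.
Context {T1 : measurableType d1} {T2 : measurableType d2}.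
Variables (alpha : probability T1 R) (pi : probability (T1 * T2)%type R).
Variable k : R.-pker T1 ~> T2.
Hypothesis pik : disintegration_fst alpha pi k.

Local Open Scope ereal_scope.

Lemma disintegrationE C : measurable C -> pi C = disintegrated alpha k C.
Proof.
apply: probability_prod_unique; first exact: le_lt_trans (probability_le1 pi measurableT) (ltry _).
by move=> A B mA mB; rewrite /= disintegratedX// pik.
Qed.

Lemma ge0_integral_disintegration (f : T1 * T2 -> \bar R) :
  (forall z, 0 <= f z) -> measurable_fun setT f ->
  \int[pi]_z f z = \int[alpha]_x \int[k x]_y f (x, y).
Proof.
move=> f0 mf; rewrite -ge0_integral_disintegrated//.
by apply: eq_measure_integral => C mC _; exact: disintegrationE.
Qed.

Lemma measurable_disintegration (f : T1 * T2 -> \bar R) :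
  measurable_fun setT f -> measurable_fun setT (fun x => \int[k x]_y f (x, y)).
Proof.
move=> mf; under eq_fun do rewrite integralE.
apply: emeasurable_funB.
- under eq_fun => x do rewrite (funepos_comp f (pair x)).
  by apply: (measurable_fun_integral_finite_kernel (f^\+) k) => //; exact: measurable_funepos.
- under eq_fun => x do rewrite (funeneg_comp f (pair x)).
  by apply: (measurable_fun_integral_finite_kernel (f^\-) k) => //; exact: measurable_funeneg.
Qed.

Lemma integrable_disintegration (f : T1 * T2 -> \bar R) :
  pi.-integrable setT f ->
  alpha.-integrable setT (fun x => \int[k x]_y f (x, y)).
Proof.
move=> /integrableP[mf fi]; apply/integrableP; split.
  exact: measurable_disintegration.
apply: le_lt_trans fi; rewrite ge0_integral_disintegration//; last first.
  exact: measurableT_comp.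
apply: ge0_le_integral => //.
- by apply: measurableT_comp => //; exact: measurable_disintegration.
- apply: (measurable_disintegration (f := fun z => `|f z|)).
  exact: measurableT_comp.
- move=> x _; apply: le_abse_integral => //.
  exact: (measurableT_comp mf (pair1_measurable x)).
Qed.

Lemma integral_disintegration (f : T1 * T2 -> \bar R) :
  pi.-integrable setT f ->
  \int[pi]_z f z = \int[alpha]_x \int[k x]_y f (x, y).
Proof.
move=> fi; have mf := measurable_int _ fi.
rewrite integralE ge0_integral_disintegration//; last exact: measurable_funepos.
rewrite ge0_integral_disintegration//; last exact: measurable_funeneg.
rewrite -integralB//; last 2 first.
- exact: (integrable_disintegration (integrable_funepos measurableT fi)).
- exact: (integrable_disintegration (integrable_funeneg measurableT fi)).
apply: eq_integral => x _; rewrite [RHS]integralE.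
by rewrite (funepos_comp f (pair x)) (funeneg_comp f (pair x)).
Qed.

Lemma ae_integrable_disintegration (f : T1 * T2 -> \bar R) :
  pi.-integrable setT f ->
  {ae alpha, forall x, (k x).-integrable setT (fun y => f (x, y))}.
Proof.
move=> fi; have mf := measurable_int _ fi.
have /integrable_ae : alpha.-integrable setT (fun x => \int[k x]_y `|f (x, y)|).
  exact: (integrable_disintegration (integrable_abse fi)).
move=> /(_ measurableT); apply: filterS => x /(_ Logic.I) fx.
apply/integrableP; split.
  exact: (measurableT_comp mf (pair1_measurable x)).
by rewrite ltey_eq fx.
Qed.

End disintegration_fubini.

(** * Square integrable functions *)

(** Scalar L2. Random vectors are treated one coordinate at a time, so that products and
    orthogonality only concern real functions. *)
Definition sqint {R : realType} {dT : measure_display} {T : measurableType dT}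
    (P : probability T R) (f : T -> R) : Prop :=
  measurable_fun setT f /\ P.-integrable setT (fun x => (f x ^+ 2)%:E).

Section square_integrable.
Context {R : realType} {dT : measure_display} {T : measurableType dT}.
Variable P : probability T R.
Implicit Types f g : T -> R.

Lemma measurable_sqr_lty_sqint f : measurable_fun setT f ->
  (\int[P]_x (f x ^+ 2)%:E < +oo)%E -> sqint P f.
Proof.
move=> mf fi; split => //; apply/integrableP; split.
  by apply/measurable_EFinP; exact: measurable_funX.
by under eq_integral do rewrite gee0_abs ?lee_fin ?sqr_ge0//.
Qed.

Lemma le_sqint f g : measurable_fun setT g -> (forall x, g x ^+ 2 <= f x ^+ 2) ->
  sqint P f -> sqint P g.
Proof.
move=> mg gf [mf fi]; split => //.
apply: le_integrable fi => //.
  by apply/measurable_EFinP; exact: measurable_funX.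
by move=> x _; rewrite !abse_EFin lee_fin !ger0_norm// ?sqr_ge0.
Qed.

Lemma sqint_lty f : sqint P f -> (\int[P]_x (f x ^+ 2)%:E < +oo)%E.
Proof.
move=> [_ /integrableP[_]].
by under eq_integral do rewrite gee0_abs ?lee_fin ?sqr_ge0//.
Qed.

Lemma sqintM_integrable f g : sqint P f -> sqint P g ->
  P.-integrable setT (fun x => (f x * g x)%:E).
Proof.
move=> [mf fi] [mg gi].
apply: (le_integrable _ _ _ (integrableD measurableT fi gi)) => //.
  by apply/measurable_EFinP; exact: measurable_funM.
move=> x _ /=; rewrite lee_fin [leRHS]ger0_norm ?addr_ge0 ?sqr_ge0//.
have := sqr_ge0 (f x - g x); have := sqr_ge0 (f x + g x).
by rewrite ler_norml => *; apply/andP; split; nra.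
Qed.

Lemma sqint_cst (c : R) : sqint P (cst c).
Proof.
split; first exact: measurable_cst.
exact: (finite_measure_integrable_cst P (c ^+ 2) measurableT).
Qed.

Lemma sqint_integrable f : sqint P f -> P.-integrable setT (EFin \o f).
Proof.
move=> sf; have := sqintM_integrable sf (sqint_cst 1).
by under eq_fun do rewrite mulr1.
Qed.

Lemma sqintZ (c : R) f : sqint P f -> sqint P (fun x => c * f x).
Proof.
move=> [mf fi]; split; first exact: measurable_funM.
under eq_fun do rewrite exprMn EFinM.
exact: integrableZl.
Qed.

Lemma sqintD f g : sqint P f -> sqint P g -> sqint P (fun x => f x + g x).
Proof.
move=> sf sg; have [[mf fi] [mg gi]] := (sf, sg).
split; first exact: measurable_funD.
have /(integrableZl measurableT 2) fg := sqintM_integrable sf sg.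
have := integrableD measurableT (integrableD measurableT fi gi) fg.
by apply: eq_integrable => // x _ /=; congr EFin; ring.
Qed.

Lemma sqintN f : sqint P f -> sqint P (fun x => - f x).
Proof.
by move=> sf; under eq_fun do rewrite -mulN1r; exact: sqintZ.
Qed.

Lemma sqintB f g : sqint P f -> sqint P g -> sqint P (fun x => f x - g x).
Proof. by move=> sf sg; apply: sqintD => //; exact: sqintN. Qed.

Lemma sqint_sum (I : Type) (s : seq I) (F : I -> T -> R) :
  (forall i, sqint P (F i)) -> sqint P (fun x => \sum_(i <- s) F i x).
Proof.
move=> sF; elim: s => [|i s ih].
  by under eq_fun do rewrite big_nil; exact: sqint_cst.
by under eq_fun do rewrite big_cons; exact: sqintD.
Qed.

Lemma sqint_norm f : sqint P f -> sqint P (fun x => `|f x|).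
Proof.
move=> sf; apply: (le_sqint _ _ sf).
  by apply: measurableT_comp => //; case: sf.
by move=> x; rewrite real_normK// num_real.
Qed.

Lemma ae_eq_sqint f g : measurable_fun setT g ->
  {ae P, forall x, f x = g x} -> sqint P f -> sqint P g.
Proof.
move=> mg fg sf; have [mf fi] := sf; apply: measurable_sqr_lty_sqint => //.
rewrite (@ae_eq_integral _ _ _ P setT (fun x => (f x ^+ 2)%:E)) //.
- exact: sqint_lty.
- by apply/measurable_EFinP; exact: measurable_funX.
- by apply/measurable_EFinP; exact: measurable_funX.
- by apply: filterS fg => x -> _.
Qed.

End square_integrable.

Lemma sqint_comp {R : realType} {d1 d2 : measure_display}
    {T1 : measurableType d1} {T2 : measurableType d2}
    (P : probability T1 R) (Q : probability T2 R) (X : T1 -> T2) (f : T2 -> R) :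
  measurable_fun setT X ->
  (forall A, measurable A -> Q A = P (X @^-1` A)) ->
  sqint Q f -> sqint P (f \o X).
Proof.
move=> mX QX sf; have [mf fi] := sf; apply: measurable_sqr_lty_sqint.
  exact: measurableT_comp.
have -> : (\int[P]_x ((f \o X) x ^+ 2)%:E = \int[Q]_y (f y ^+ 2)%:E)%E.
  rewrite (eq_measure_integral (pushforward P X)) => [|A mA _]; last exact: QX.
  rewrite ge0_integral_pushforward//.
  - by apply/measurable_EFinP; exact: measurable_funX.
  - by move=> y _; rewrite lee_fin sqr_ge0.
exact: sqint_lty.
Qed.

Section second_moments.
Context {R : realType} {dT : measure_display} {T : measurableType dT}.
Variable P : probability T R.
Variable d : nat.

Lemma sqr_poweR2 (x : \bar R) : (0 <= x)%E -> (x ^+ 2 = x `^ 2)%E.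
Proof.
case: x => [r||]// r0; rewrite expe2; last by rewrite poweRyr.
by rewrite poweR_EFin (powR_mulrn 2)// expr2 EFinM.
Qed.

Lemma L2norm_sqrE (X : T -> 'rV[R]_d) :
  (L2norm P X ^+ 2 = \int[P]_x (enorm (X x) ^+ 2)%:E)%E.
Proof.
rewrite /L2norm sqr_poweR2; last exact: Lnorm_ge0.
rewrite poweR_Lnorm//; apply: eq_integral => x _ /=.
by rewrite (powR_mulrn 2)// real_normK// num_real.
Qed.

Lemma integral_enorm2E (X : T -> 'rV[R]_d) : measurable_fun setT X ->
  (\int[P]_x (enorm (X x) ^+ 2)%:E = \sum_i \int[P]_x (X x ord0 i ^+ 2)%:E)%E.
Proof.
move=> mX; under eq_integral do rewrite enorm2E -sumEFin.
rewrite ge0_integral_sum//.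
  move=> i; apply/measurable_EFinP/measurable_funX; exact: measurable_rowP.
by move=> i x _; rewrite lee_fin sqr_ge0.
Qed.

Lemma enorm2_lty_sqint (X : T -> 'rV[R]_d) : measurable_fun setT X ->
  (\int[P]_x (enorm (X x) ^+ 2)%:E < +oo)%E <->
  (forall i, sqint P (fun x => X x ord0 i)).
Proof.
move=> mX; rewrite integral_enorm2E//; split => [Xoo i|Xi].
  apply: measurable_sqr_lty_sqint; first exact: measurable_rowP.
  apply: le_lt_trans Xoo; rewrite (bigD1 i)//= leeDl//.
  by apply: sume_ge0 => j _; apply: integral_ge0 => x _; rewrite lee_fin sqr_ge0.
by apply: lte_sum_pinfty => i _; exact: sqint_lty.
Qed.

Lemma in_L2P (X : {mfun T >-> 'rV[R]_d}) :
  in_L2 P X <-> forall i, sqint P (fun x => X x ord0 i).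
Proof.
rewrite -enorm2_lty_sqint// -L2norm_sqrE /in_L2.
have : (0 <= L2norm P X)%E by exact: Lnorm_ge0.
case: (L2norm P X) => [r||] r0 //.
by rewrite expe2 -EFinM !ltry.
Qed.

End second_moments.

Lemma finite_second_momentP {R : realType} (d : nat)
    (nu : probability 'rV[R]_d R) : finite_second_moment nu <->
  forall i, sqint nu (fun z => z ord0 i).
Proof. by rewrite -(enorm2_lty_sqint nu (X := id)). Qed.

Lemma integrable_sumR {R : realType} {dT : measure_display}
    {T : measurableType dT} (P : {measure set T -> \bar R}) (I : Type) (s : seq I)
    (F : I -> T -> R) :
  (forall i, P.-integrable setT (fun x => (F i x)%:E)) ->
  P.-integrable setT (fun x => (\sum_(i <- s) F i x)%:E).
Proof.
move=> Fi; under eq_fun do rewrite -sumEFin.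
by apply: integrable_sum => // i _; exact: Fi.
Qed.

Lemma integral_sumR {R : realType} {dT : measure_display}
    {T : measurableType dT} (P : {measure set T -> \bar R}) (I : Type) (s : seq I)
    (F : I -> T -> R) :
  (forall i, P.-integrable setT (fun x => (F i x)%:E)) ->
  (\int[P]_x (\sum_(i <- s) F i x)%:E = \sum_(i <- s) \int[P]_x (F i x)%:E)%E.
Proof.
move=> Fi; under eq_integral do rewrite -sumEFin.
by rewrite integral_sum// => i; exact: Fi.
Qed.

(** * Existence of disintegrations *)

Section slice_density.
Context {R : realType} {d1 d2 : measure_display}.
Context {T1 : measurableType d1} {T2 : measurableType d2}.
Variables (alpha : probability T1 R) (pi : probability (T1 * T2)%type R).
Hypothesis pi1 : forall A, measurable A -> pi (A `*` setT) = alpha A.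

Local Open Scope ereal_scope.

(** The proof [mB] is an argument so that the measure structure can be attached to the term. *)
Definition slice (B : set T2) (mB : measurable B) (A : set T1) : \bar R :=
  pi (A `*` B).

Section slice_measure.
Variables (B : set T2) (mB : measurable B).

Let slice0 : slice mB set0 = 0.
Proof. by rewrite /slice set0X measure0. Qed.

Let slice_ge0 A : 0 <= slice mB A. Proof. exact: measure_ge0. Qed.

Let slice_sigma_additive : semi_sigma_additive (slice mB).
Proof.
move=> F mF tF mUF; rewrite /slice.
rewrite [X in _ --> pi X](_ : _ = \bigcup_n (F n `*` B)); last first.
  by rewrite -setX_bigcupl.
apply: measure_semi_sigma_additive.
- by move=> n; exact: measurableX.
- apply/trivIsetP => i j _ _ ij; rewrite -setXI.
  by move/trivIsetP : tF => /(_ i j Logic.I Logic.I ij) ->; rewrite set0X.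
- by apply: bigcup_measurable => n _; exact: measurableX.
Qed.

HB.instance Definition _ := isMeasure.Build _ _ _ (slice mB)
  slice0 slice_ge0 slice_sigma_additive.

Let slice_fin : fin_num_fun (slice mB).
Proof. by move=> A mA; apply: fin_num_measure; exact: measurableX. Qed.

HB.instance Definition _ := @Measure_isFinite.Build _ _ _ (slice mB) slice_fin.

End slice_measure.

(** Radon-Nikodym: the slice at [B] is dominated by the slice at the whole space, which is
    [alpha]. *)
Lemma slice_density (B : set T2) : measurable B ->
  exists f : T1 -> \bar R, [/\ forall x, 0 <= f x,
    alpha.-integrable setT f &
    forall A, measurable A -> pi (A `*` B) = \int[alpha]_(x in A) f x].
Proof.
move=> mB; have : slice mB `<< alpha.
  move=> N N0 A mA AN; rewrite /= /slice.
  apply/eqP; rewrite eq_le measure_ge0 andbT -[leRHS](N0 _ mA AN) -pi1//.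
  by apply: le_measure; rewrite ?inE//; [exact: measurableX|exact: measurableX|move=> z []].
by move/radon_nikodym_finite => [f [f0 fi fE]]; exists f; split.
Qed.

(** The slice over the difference of [C] and [B] has a nonnegative density [h], and [g = f + h]
    almost everywhere by uniqueness of densities. *)
Lemma slice_density_le (B C : set T2) (f g : T1 -> \bar R) :
  measurable B -> measurable C -> B `<=` C ->
  (forall x, 0 <= f x) -> alpha.-integrable setT f ->
  alpha.-integrable setT g ->
  (forall A, measurable A -> pi (A `*` B) = \int[alpha]_(x in A) f x) ->
  (forall A, measurable A -> pi (A `*` C) = \int[alpha]_(x in A) g x) ->
  {ae alpha, forall x, f x <= g x}.
Proof.
move=> mB mC BC f0 fi gi fB gC.
have [h [h0 hi hE]] := slice_density (measurableD mC mB).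
have mf := measurable_int _ fi; have mh := measurable_int _ hi.
have : ae_eq alpha setT g (fun x => f x + h x).
  apply: integral_ae_eq => //; first exact: emeasurable_funD.
  move=> A _ mA; rewrite ge0_integralD//; [|exact: measurable_funTS..].
  rewrite -gC// -fB// -hE// -measureU.
  - congr (pi _); apply/seteqP; split => [[x y]/= [Ax Cy]|[x y]/=].
      by have [By|nBy] := pselect (B y); [left|right].
    by move=> [[Ax /BC]//|[Ax []]].
  - exact: measurableX.
  - by apply: measurableX => //; exact: measurableD.
  - by rewrite -setXI setDIK setX0.
by apply: filterS => x /(_ Logic.I) ->; rewrite leeDl.
Qed.

End slice_density.

Lemma uniform01E {R : realType} (A : set R) : measurable A ->
  uniform_prob (@ltr01 R) A = lebesgue_measure (A `&` `[0, 1]%classic).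
Proof.
move=> mA; have := @integral_uniform R 0 1 ltr01 (EFin \o \1_A).
rewrite /= !integral_indic// ?setIT subr0 invr1 mul1e; apply.
- exact/measurable_EFinP.
- by move=> x; rewrite lee_fin.
Qed.

(** In the application [c] is a conditional probability known only up to a null set, so it may
    exceed 1; the inequality survives there, the equality does not. *)
Lemma uniform01_le {R : realType} (c : \bar R) : (0 <= c)%E ->
  (uniform_prob (@ltr01 R) [set s | s%:E <= c]%E <= c)%E /\
  ((c <= 1)%E -> uniform_prob (@ltr01 R) [set s | s%:E <= c]%E = c).
Proof.
case: c => [c||]// c0; last by rewrite leey.
rewrite lee_fin in c0.
have E : [set s | s%:E <= c%:E]%E = `]-oo, c]%classic.
  by apply/seteqP; split => x /=; rewrite lee_fin in_itv.
rewrite E uniform01E//.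
have cE : c <= 1 -> `]-oo, c] `&` `[0, 1] = `[0, c]%classic :> set R.
  by move=> c1; apply/seteqP; split => x /=; rewrite !in_itv/=; lra.
have lcE : c <= 1 -> lebesgue_measure (`]-oo, c] `&` `[0, 1] : set R) = c%:E.
  move=> c1; rewrite cE// lebesgue_measure_itv/= lte_fin.
  by case: ltgtP c0 => // [_|<-] _; rewrite ?sube0 ?oppr0.
split; last by rewrite lee_fin.
have [/lcE->//|c1] := leP c 1.
apply: (@le_trans _ _ (lebesgue_measure (`[0, 1]%classic : set R))).
  by apply: le_measure; rewrite ?inE//; exact: measurableI.
by rewrite lebesgue_measure_itv/= lte_fin ltr01 sube0 lee_fin ltW.
Qed.

(** The rays together with the whole line form a pi-system. The line is added because it serves as
    the exhausting sequence, which is why the total masses are compared separately. *)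
Lemma finite_measure_rays {R : realType} (m1 m2 : {measure set R -> \bar R}) :
  (m1 setT < +oo)%E -> m1 setT = m2 setT ->
  (forall x, m1 `]-oo, x[%classic = m2 `]-oo, x[%classic) ->
  forall B, measurable B -> m1 B = m2 B.
Proof.
move=> m1T m12T m12 B mB.
apply: (measure_unique (fun A => A = setT \/ RGenInftyO.G A) (fun=> setT)) => //.
- rewrite [LHS](RGenInftyO.measurableE R); apply/seteqP; split.
    by apply: sub_sigma_algebra2 => A; right.
  apply: smallest_sub; first exact: smallest_sigma_algebra.
  move=> A [->|GA]; last exact: sub_sigma_algebra.
  exact: (@measurableT _ (g_sigma_algebraType (@RGenInftyO.G R))).
- move=> _ _ [->|[x ->]] [->|[y ->]].
  + by left; rewrite setTI.
  + by right; exists y; rewrite setTI.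
  + by right; exists x; rewrite setIT.
  + right; exists (Num.min x y); apply/seteqP.
    by split => z /=; rewrite !in_itv/= lt_min => /andP.
- by move=> _; left.
- by rewrite bigcup_const.
- by move=> _ [->|[x ->]].
Qed.

Lemma measure_eq_on_conull {R : realType} {dT : measure_display}
    {T : measurableType dT} (mu : {measure set T -> \bar R}) (A B G : set T) :
  measurable A -> measurable B -> measurable G -> mu (~` G) = 0%E ->
  A `&` G = B `&` G -> mu A = mu B.
Proof.
move=> mA mB mG G0 AB.
have E C : measurable C -> mu C = mu (C `&` G).
  move=> mC; rewrite (measureDI mu mC mG) setDE.
  rewrite [X in (X + _)%E](_ : _ = 0%E) ?add0e//.
  apply/eqP; rewrite eq_le measure_ge0 andbT -G0.
  by apply: le_measure; rewrite ?inE//; [apply: measurableI => //|]; exact: measurableC.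
by rewrite E// AB -E.
Qed.

(** * Conditional quantile functions *)

Section quantile.
Context {R : realType} {d1 : measure_display} {T1 : measurableType d1}.
Variables (alpha : probability T1 R) (pi : probability (T1 * R)%type R).
Hypothesis pi1 : forall A, measurable A -> pi (A `*` setT) = alpha A.

Local Open Scope ereal_scope.

Variable F : R -> T1 -> \bar R.
Hypothesis F0 : forall q x, 0 <= F q x.
Hypothesis Fi : forall q, alpha.-integrable setT (F q).
Hypothesis FE : forall q A, measurable A ->
  pi (A `*` `]-oo, q[%classic) = \int[alpha]_(x in A) F q x.

(* [F q x] is a version of the conditional probability of ]-oo, q[ given [x];
   since it is monotone in [q] only almost surely, the infimum ranges over the
   rationals. *)
Definition quantile (z : T1 * measurableTypeR R) : \bar R :=
  ereal_inf [set (ratr q : R)%:E | q in [set q : rat | z.2%:E <= F (ratr q : R) z.1]].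

Let lam : probability (measurableTypeR R) R := uniform_prob (@ltr01 R).
Let mu : probability (T1 * measurableTypeR R)%type R := alpha \x lam.
Let E x : set (T1 * measurableTypeR R) := [set z | quantile z < x%:E].

(** An infimum lies below [x] exactly when one of its members does; over the rationals this is a
    countable union, hence measurable. *)
Let EE x : E x = \bigcup_(q in [set q : rat | ((ratr q : R) < x)%R])
  [set z : T1 * measurableTypeR R | z.2%:E <= F (ratr q : R) z.1].
Proof.
apply/seteqP; split => [z /ereal_inf_lt[_ [q /= zq <-]]|z [q /= qx zq]].
  by rewrite lte_fin => qx; exists q.
rewrite /E /=; apply: le_lt_trans (_ : (ratr q : R)%:E < _); last by rewrite lte_fin.
by apply: ereal_inf_lbound; exists q.
Qed.

Let mF q : measurable_fun setT (F q). Proof. exact: measurable_int (Fi q). Qed.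

Let measurable_below q : measurable [set z : T1 * measurableTypeR R | z.2%:E <= F q z.1].
Proof.
rewrite -[X in measurable X]setTI; apply: emeasurable_fun_le => //.
- by apply/measurable_EFinP; exact: measurable_snd.
- exact: measurableT_comp (mF q) measurable_fst.
Qed.

Let mE x : measurable (E x).
Proof.
rewrite EE bigcup_mkcond; apply: bigcupT_measurable_rat => q.
by case: ifP => _ //; exact: measurable_below.
Qed.

Lemma measurable_quantile : measurable_fun setT quantile.
Proof.
apply: (measurability _ (ErealGenInftyO.measurableE R)) => _ [_ [r ->] <-].
rewrite setTI; by have := mE r; congr measurable.
Qed.

Let mAT (A : set T1) : measurable A -> measurable (A `*` [set: measurableTypeR R]).
Proof. by move=> mA; exact: measurableX. Qed.

Let muE C : measurable C -> mu C = \int[alpha]_y lam (xsection C y).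
Proof. by []. Qed.

Let xsectionE x A y : xsection (A `*` setT `&` E x) y =
  if y \in A then \bigcup_(q in [set q : rat | ((ratr q : R) < x)%R])
    [set s : measurableTypeR R | s%:E <= F (ratr q : R) y] else set0.
Proof.
apply/seteqP; split => s; rewrite EE /xsection /= inE /=.
  by move=> [[Ay _] [q /= qx sq]]; rewrite mem_set//; exists q.
case: ifPn => //; rewrite inE => Ay [q /= qx sq].
by split => //; exists q.
Qed.

Let mu_int A x : measurable A ->
  mu (A `*` setT `&` E x) = \int[alpha]_(y in A)
    lam (\bigcup_(q in [set q : rat | ((ratr q : R) < x)%R])
    [set s : measurableTypeR R | s%:E <= F (ratr q : R) y]).
Proof.
move=> mA; rewrite muE; last by apply: measurableI => //; exact: mAT.
rewrite [RHS]integral_mkcond/=; apply: eq_integral => y _.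
by rewrite patchE xsectionE; case: ifP => //; rewrite measure0.
Qed.

Let mU y x : measurable (\bigcup_(q in [set q : rat | ((ratr q : R) < x)%R])
    [set s : measurableTypeR R | s%:E <= F (ratr q : R) y]).
Proof.
have := measurable_xsection y (mE x).
have -> // : xsection (E x) y = \bigcup_(q in [set q : rat | ((ratr q : R) < x)%R])
    [set s : measurableTypeR R | s%:E <= F (ratr q : R) y].
by apply/seteqP; split => s; rewrite /xsection EE /= inE.
Qed.

Let mlam A x : measurable A -> measurable_fun A (fun y =>
  lam (\bigcup_(q in [set q : rat | ((ratr q : R) < x)%R])
    [set s : measurableTypeR R | s%:E <= F (ratr q : R) y])).
Proof.
move=> mA; apply: measurable_funTS.
have := measurable_fun_xsection lam (mE x).
apply: eq_measurable_fun => y _; congr (lam _).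
by apply/seteqP; split => s; rewrite /xsection EE /= inE.
Qed.

(** For almost every [y], all rationals [q] below [x] satisfy [F q y <= F x y] at once, so the
    section of [E x] lies in the noise level set of [F x y]. *)
Let upper A x : measurable A ->
  mu (A `*` setT `&` E x) <= pi (A `*` `]-oo, x[%classic).
Proof.
move=> mA; rewrite mu_int// FE//; apply: ae_ge0_le_integral => //.
- exact: mlam.
- exact: measurable_funTS.
(* Numbering the rationals by their codes allows the exceptional null sets to be united. *)
have : {ae alpha, forall y, forall n,
    if unpickle n is Some q then ((ratr q : R) < x)%R -> F (ratr q : R) y <= F x y else True}.
  apply: ae_foralln => n; case: (unpickle n) => [q|]; last exact: nearW.
  have [qx|qx] := ltP (ratr q : R) x; last by apply: nearW => y.
  have := @slice_density_le _ _ _ _ _ alpha pi pi1 `]-oo, (ratr q : R)[%classic `]-oo, x[%classic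
    (F (ratr q : R)) (F x).
  move=> /(_ (measurable_itv _) (measurable_itv _)).
  have sub : (`]-oo, (ratr q : R)[%classic : set R) `<=` `]-oo, x[%classic.
    by move=> z /=; rewrite !in_itv/= => /lt_trans; exact.
  move=> /(_ sub (F0 _) (Fi _) (Fi _) (FE _) (FE _)).
  by apply: filterS => y.
apply: filterS => y yF _.
apply: le_trans (proj1 (uniform01_le (F0 x y))).
apply: le_measure; rewrite ?inE.
- exact: mU.
- have := measurable_xsection y (measurable_below x).
  by congr measurable; apply/seteqP; split => s; rewrite /xsection /= inE.
- move=> s [q /= qx sq]; apply: le_trans sq _.
  by have := yF (pickle q); rewrite pickleK; exact.
Qed.

(** A single rational [q] below [x] puts the level set of [F q y] into the section, and its noise
    measure is exactly [F q y] because [F q <= 1] almost everywhere. *)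
Let lower A x q : measurable A -> ((ratr q : R) < x)%R ->
  pi (A `*` `]-oo, (ratr q : R)[%classic) <= mu (A `*` setT `&` E x).
Proof.
move=> mA qx; rewrite mu_int// FE//; apply: ae_ge0_le_integral => //.
- exact: measurable_funTS.
- exact: mlam.
have : {ae alpha, forall y, F (ratr q : R) y <= 1}.
  apply: (@slice_density_le _ _ _ _ _ alpha pi pi1 `]-oo, (ratr q : R)[%classic setT) => //.
  - exact: finite_measure_integrable_cst.
  - exact: FE.
  - by move=> B mB; rewrite integral_cst// mul1e pi1.
apply: filterS => y y1 _.
rewrite -(proj2 (uniform01_le (F0 (ratr q : R) y)) y1).
apply: le_measure; rewrite ?inE; last by move=> s /= sq; exists q.
- have := measurable_xsection y (measurable_below (ratr q : R)).
  by congr measurable; apply/seteqP; split => s; rewrite /xsection /= inE.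
- exact: mU.
Qed.

(** The open ray is the increasing union of the rays that end at [x - 1/(n+1)], and a rational
    between this endpoint and [x] makes the lower bound applicable. *)
Let muEx A x : measurable A ->
  mu (A `*` setT `&` E x) = pi (A `*` `]-oo, x[%classic).
Proof.
move=> mA; apply/eqP; rewrite eq_le upper//=.
pose B n := A `*` `]-oo, (x - n.+1%:R^-1)%R[%classic.
have BE : A `*` `]-oo, x[%classic = \bigcup_n B n.
  rewrite /B -setX_bigcupr; congr (_ `*` _).
  apply/seteqP; split => [z|z [n _ /=]]; rewrite /= !in_itv/=.
    move=> zx; have xz : (0 < x - z)%R by rewrite subr_gt0.
    have [n _ /(_ n (leqnn n)) nE] := @near_infty_natSinv_lt R (PosNum xz).
    by exists n => //=; rewrite in_itv/= ltrBrDl -ltrBrDr.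
  by move=> zx; apply: lt_le_trans zx _; rewrite gerBl.
have mB n : measurable (B n) by exact: measurableX.
have : pi (B n) @[n --> \oo] --> pi (A `*` `]-oo, x[%classic).
  rewrite BE; apply: nondecreasing_cvg_mu => //.
    by apply: bigcupT_measurable.
  move=> m n mn; apply/subsetPset; move=> [y z] [/= Ay z_]; split => //=; move: z_; rewrite /=  !in_itv/=.
  move=> /lt_le_trans; apply; rewrite lerD2l lerN2 lef_pV2 ?posrE//.
  by rewrite ler_nat.
move/cvge_to_le; apply; near=> n.
have /rat_in_itvoo[q] : (x - n.+1%:R^-1 < x)%R by rewrite gtrBl.
rewrite in_itv/= => /andP[q1 q2].
apply: le_trans (lower mA q2); apply: le_measure; rewrite ?inE//.
  exact: measurableX.
move=> [y z] [/= Ay z_]; split => //=; move: z_; rewrite /=  !in_itv/= => /lt_trans; exact.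
Unshelve. all: by end_near. Qed.

(** The set where the quantile is finite, so that [fine] loses nothing there. Its complement is null
    because the rays exhaust the line at one end and shrink to nothing at the other. *)
Let G : set (T1 * measurableTypeR R) := (\bigcup_n E n%:R) `\` (\bigcap_n E (- n%:R)%R).

Let subE (x y : R) : (x <= y)%R -> E x `<=` E y.
Proof. by move=> xy z /= /lt_le_trans; apply; rewrite lee_fin. Qed.

Let mUE : measurable (\bigcup_n E n%:R). Proof. exact: bigcupT_measurable. Qed.
Let mIE : measurable (\bigcap_n E (- n%:R)%R).
Proof. by apply: bigcapT_measurable. Qed.

Let muEx1 x : mu (E x) = pi ([set: T1] `*` `]-oo, x[%classic).
Proof. by rewrite -(@muEx setT x measurableT) setXTT setTI. Qed.

Let mG0 : mu (~` G) = 0.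
Proof.
have U1 : mu (~` \bigcup_n E n%:R) = 0.
  rewrite probability_setC// [X in 1 - X](_ : _ = 1) ?subee//.
  have h1 : mu (E n%:R) @[n --> \oo] --> mu (\bigcup_n E n%:R).
    apply: nondecreasing_cvg_mu => // m n mn.
    by apply/subsetPset; apply: subE; rewrite ler_nat.
  have h2 : mu (E n%:R) @[n --> \oo] -->
      pi (\bigcup_n ([set: T1] `*` `]-oo, n%:R[%classic)).
    under eq_fun do rewrite muEx1.
    apply: nondecreasing_cvg_mu => //.
    - by move=> n; exact: measurableX.
    - by apply: bigcupT_measurable => n; exact: measurableX.
    - move=> m n mn; apply/subsetPset; apply: setSX => // z /=.
      by rewrite !in_itv/= => /lt_le_trans; apply; rewrite ler_nat.
  rewrite -(cvg_lim _ h1)// (cvg_lim _ h2)//.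
  rewrite [X in pi X](_ : _ = setT) ?probability_setT//.
  apply/seteqP; split => // -[y z] _.
  exists (Num.bound `|z|%R) => //; split => //=; rewrite in_itv/=.
  exact: le_lt_trans (ler_norm _) (archi_boundP (normr_ge0 z)).
have I0 : mu (\bigcap_n E (- n%:R)%R) = 0.
  have h1 : mu (E (- n%:R)%R) @[n --> \oo] --> mu (\bigcap_n E (- n%:R)%R).
    apply: nonincreasing_cvg_mu => //.
      by rewrite ltey_eq fin_num_measure.
    by move=> m n mn; apply/subsetPset; apply: subE; rewrite lerN2 ler_nat.
  have h2 : mu (E (- n%:R)%R) @[n --> \oo] -->
      pi (\bigcap_n ([set: T1] `*` `]-oo, (- n%:R)%R[%classic)).
    under eq_fun do rewrite muEx1.
    apply: nonincreasing_cvg_mu => //.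
    - by rewrite ltey_eq fin_num_measure//; exact: measurableX.
    - by move=> n; exact: measurableX.
    - by apply: bigcapT_measurable => n; exact: measurableX.
    - move=> m n mn; apply/subsetPset; apply: setSX => // z /=.
      by rewrite !in_itv/= => /lt_le_trans; apply; rewrite lerN2 ler_nat.
  rewrite -(cvg_lim _ h1)// (cvg_lim _ h2)//.
  rewrite [X in pi X](_ : _ = set0) ?measure0//.
  apply/seteqP; split => // -[y z] /(_ (Num.bound `|z|%R) Logic.I)/= [_] /=.
  rewrite in_itv/= ltrNr => /lt_le_trans.
  move=> /(_ _ (ler_norm _)); rewrite normrN.
  by move/lt_trans => /(_ _ (archi_boundP (normr_ge0 z))); rewrite ltxx.
rewrite /G setDE setCI setCK; apply/eqP; rewrite eq_le measure_ge0 andbT.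
apply: (@le_trans _ _ (mu (~` \bigcup_n E n%:R) + mu (\bigcap_n E (- n%:R)%R))).
  by apply: measureU2 => //; exact: measurableC.
by rewrite U1 I0 adde0.
Qed.

(** For fixed [A] both sides are finite measures in [B], so rays suffice, and on rays [muEx] applies
    once the complement of [G] is discarded. *)
Lemma quantile_law A B : measurable A -> measurable B ->
  pi (A `*` B) = mu [set z | A z.1 /\ B (fine (quantile z))].
Proof.
move=> mA mB.
have mq : measurable_fun setT (fine \o quantile).
  by apply: measurableT_comp measurable_quantile; exact: fine_measurable.
pose m1 := pushforward (mrestr pi (measurableX mA (@measurableT _ R))) snd.
pose m2 := pushforward (mrestr mu (mAT mA)) (fine \o quantile).
have m1E C : pi (A `*` C) = m1 C.
  by rewrite /m1 /= /pushforward /mrestr; congr (pi _); apply/seteqP; split => z /=; tauto.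
have m2E C : mu [set z | A z.1 /\ C (fine (quantile z))] = m2 C.
  by rewrite /m2 /= /pushforward /mrestr; congr (mu _); apply/seteqP; split => z /=; tauto.
rewrite m1E m2E; apply: finite_measure_rays => //.
- by rewrite -[X in X < _]/(m1 setT) -m1E ltey_eq fin_num_measure//; exact: measurableX.
- rewrite -[LHS]/(m1 setT) -[RHS]/(m2 setT) -m1E -m2E pi1// [X in mu X](_ : _ = A `*` setT); last by apply/seteqP; split => z /=; tauto.
  rewrite -[RHS]/((alpha \x lam) _) product_measure1E//.
  by rewrite [X in _ = _ * X](_ : _ = 1) ?mule1//; exact: (probability_setT lam).
move=> x; rewrite -[LHS]/(m1 _) -[RHS]/(m2 _) -m1E -m2E -(@muEx A x mA).
have mGG : measurable G by exact: measurableD.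
apply: (measure_eq_on_conull _ _ mGG mG0).
- by apply: measurableI => //; exact: mAT.
- rewrite [X in measurable X](_ : _ = (A `*` setT) `&` ((fine \o quantile) @^-1` `]-oo, x[%classic)).
    apply: measurableI; first exact: mAT.
    by rewrite -[X in measurable X]setTI; exact: mq.
  by apply/seteqP; split => z /=; tauto.
apply/seteqP; split => z [+ Gz].
all: have zf : quantile z \is a fin_num.
1,3: case: Gz => -[n _ /= zn] zI; rewrite fin_numE; apply/andP; split;
  [apply/eqP => zy; apply: zI => m _; rewrite /E /= zy ltNyr//|by apply/eqP => zy; move: zn; rewrite /E/= zy].
- move=> [[Az _] Ez]; split => //; split => //=.
  by rewrite in_itv/= -lte_fin fineK.
- move=> [Az /=]; rewrite in_itv/= -lte_fin fineK// => Ez; split => //.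
Qed.

End quantile.

(** * Cantor coding of bit sequences *)

Section ternary_code.
Context {R : realType}.
Implicit Types b : nat -> bool.

(* A bit sequence is sent to the point of the Cantor set with ternary digits 0
   and 2, from which the bits are recovered by iterating the shift: this gives
   a code of R^d in R whose inverse is Borel measurable. *)
Definition code_term b (n : nat) : R := (b n)%:R * 2 / 3 ^+ n.+1.

Definition code b : R := limn (series (code_term b)).

Lemma code_term_ge0 b n : 0 <= code_term b n.
Proof. by rewrite divr_ge0 ?exprn_ge0 ?mulr_ge0. Qed.

(** The bound is the partial sum for the sequence with all bits set. *)
Lemma series_code_le b n : series (code_term b) n <= 1 - (3 ^+ n)^-1.
Proof.
elim: n => [|n ih]; first by rewrite /series /= big_geq// expr0 invr1 subrr.
rewrite seriesSr; apply: le_trans (lerD ih (_ : _ <= 2 / 3 ^+ n.+1)) _.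
  rewrite /code_term ler_wpM2r ?invr_ge0 ?exprn_ge0//.
  by case: (b n); rewrite ?mul1r// mul0r.
by rewrite exprS invfM; lra.
Qed.

Lemma series_code_ge0 b n : 0 <= series (code_term b) n.
Proof. by apply: sumr_ge0 => i _; exact: code_term_ge0. Qed.

Lemma is_cvg_code b : cvgn (series (code_term b)).
Proof.
apply: nondecreasing_is_cvgn.
  apply: nondecreasing_series => n _ _; exact: code_term_ge0.
exists 1 => _ [n _ <-]; apply: le_trans (series_code_le b n) _.
by rewrite gerBl invr_ge0 exprn_ge0.
Qed.

Lemma code_ge0 b : 0 <= code b.
Proof. by apply: limr_ge; [exact: is_cvg_code|apply: nearW => n; exact: series_code_ge0]. Qed.

Lemma code_le1 b : code b <= 1.
Proof.
apply: limr_le; first exact: is_cvg_code.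
apply: nearW => n; apply: le_trans (series_code_le b n) _.
by rewrite gerBl invr_ge0 exprn_ge0.
Qed.

Lemma code_shift b : code b = ((b 0)%:R * 2 + code (b \o S)) / 3.
Proof.
apply/cvg_lim => //; rewrite -cvg_shiftS.
rewrite (_ : (fun _ => _) = (fun n =>
   ((b 0)%:R * 2 + series (code_term (b \o S)) n) / 3)).
  apply: (@cvgM _ _ _ _ _ (cst 3^-1)); last exact: cvg_cst.
  by apply: (@cvgD _ _ _ _ _ (cst _)); [exact: cvg_cst|exact: is_cvg_code].
apply/funext => n; rewrite /series /= big_nat_recl// mulrDl; congr (_ + _).
rewrite mulr_suml; apply: eq_bigr => i _.
by rewrite /code_term /= [in LHS]exprS invfM; ring.
Qed.

Definition ternary_shift (s : R) : R := 3 * s - (if 1 / 2 < s then 2 else 0).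

(** The code lies in [[0, 1/3]] or in [[2/3, 1]] according to the first bit, and [1 / 2] is in the
    gap. *)
Lemma code_bit b : (1 / 2 < code b) = b 0.
Proof.
have := code_ge0 (b \o S); have := code_le1 (b \o S).
rewrite (code_shift b); case: (b 0); rewrite /= => c1 c0.
  by apply/idP; lra.
by apply/negP/negP; rewrite -leNgt; lra.
Qed.

Lemma ternary_shift_code b : ternary_shift (code b) = code (b \o S).
Proof.
rewrite /ternary_shift code_bit code_shift; by case: (b 0) => /=; field.
Qed.

Lemma iter_ternary_shift_code b n : iter n ternary_shift (code b) = code (fun k => b (n + k)%N).
Proof.
elim: n => [//|n ih]; rewrite iterS ih ternary_shift_code; congr code.
by apply/funext => k /=; rewrite addnS.
Qed.

Definition digit (n : nat) (s : R) : bool := 1 / 2 < iter n ternary_shift s.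

Lemma digit_code b n : digit n (code b) = b n.
Proof. by rewrite /digit iter_ternary_shift_code code_bit addn0. Qed.

Lemma measurable_digit n : measurable [set s : R | digit n s].
Proof.
have mt : measurable_fun setT ternary_shift.
  apply: measurable_funB; first exact: measurable_funM.
  by apply: measurable_fun_ifT => //; apply: measurable_fun_ltr.
have mi : measurable_fun setT (iter n ternary_shift).
  elim: n => [|n ih]; first exact: measurable_id.
  exact: (measurableT_comp mt ih).
rewrite -[X in measurable X]setTI.
rewrite [X in measurable X](_ : _ = setT `&` iter n ternary_shift @^-1` `]1 / 2, +oo[%classic).
  exact: mi.
by apply/seteqP; split => s /= [_]; rewrite in_itv/= andbT.
Qed.

End ternary_code.

Section row_code.
Context {R : realType} {d : nat}.

(** The Dedekind cuts of all coordinates, interleaved into one bit sequence. *)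
Definition row_bits (x : 'rV[R]_d) (n : nat) : bool :=
  if unpickle n is Some (i, q) then ratr (q : rat) < x ord0 (i : 'I_d)
  else false.

Definition row_code (x : 'rV[R]_d) : R := code (row_bits x).

(** The supremum is extended real and then truncated by [fine], so the map is total and Borel on the
    line, not only on codes. *)
Definition row_decode (s : R) : 'rV[R]_d :=
  \row_i fine (ereal_sup
    [set (ratr q : R)%:E | q in [set q : rat | digit (pickle (i, q)) s]]).

Lemma row_codeK : cancel row_code row_decode.
Proof.
move=> x; apply/rowP => i; rewrite mxE.
rewrite [X in ereal_sup X](_ : _ = [set (ratr q : R)%:E | q in [set q : rat | (ratr q : R) < x ord0 i]]); last first.
  by congr image; apply/seteqP; split => q /=; rewrite digit_code /row_bits pickleK.
rewrite (_ : ereal_sup _ = (x ord0 i)%:E)//; apply/eqP; rewrite eq_le.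
apply/andP; split.
  by apply: ge_ereal_sup => _ [q /= qx <-]; rewrite lee_fin ltW.
apply/lee_subgt0Pr => e e0.
have /rat_in_itvoo[q] : x ord0 i - e < x ord0 i by rewrite gtrBl.
rewrite in_itv/= => /andP[q1 q2]; apply: (@le_trans _ _ (ratr q)%:E).
  by rewrite -EFinB lee_fin ltW.
by apply: ereal_sup_ubound; exists q.
Qed.

Lemma measurable_row_code : measurable_fun setT row_code.
Proof.
apply: (measurable_fun_cvg (h := fun n x => series (code_term (row_bits x)) n)).
  move=> n; apply: measurable_sum => k.
  apply: measurable_funM => //; apply: measurable_funM => //.
  rewrite /row_bits; case: unpickle => [[i q]|]; last exact: measurable_cst.
  apply: (measurableT_comp (f := fun b : bool => b%:R : R)) => //.
  by apply: measurable_fun_ltr => //; exact: measurable_coord.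
by move=> x _; exact: is_cvg_code.
Qed.

Lemma measurable_row_decode : measurable_fun setT row_decode.
Proof.
apply: measurable_fun_row => i; under eq_fun do rewrite mxE.
apply: measurableT_comp; first exact: fine_measurable.
apply: (measurability _ (ErealGenOInfty.measurableE R)) => _ [_ [r ->] <-].
rewrite setTI.
rewrite [X in measurable X](_ : _ = \bigcup_(q in [set q : rat | r < ratr q])
   [set s : R | digit (pickle (i, q)) s]).
  rewrite bigcup_mkcond; apply: bigcupT_measurable_rat => q.
  by case: ifP => // _; exact: measurable_digit.
apply/seteqP; split => [s /=|s [q /= rq sq]]; rewrite /= in_itv/= andbT.
  by move=> /ereal_sup_gt[_ [q /= sq <-]]; rewrite lte_fin => rq; exists q.
apply: (@lt_le_trans _ _ (ratr q)%:E); first by rewrite lte_fin.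
by apply: ereal_sup_ubound; exists q.
Qed.

End row_code.

Section noise_kernel.
Context {R : realType} {d1 d2 d3 : measure_display}.
Context {T1 : measurableType d1} {N : measurableType d2} {T2 : measurableType d3}.
Variables (lam : probability N R) (X : T1 * N -> T2).
Hypothesis mX : measurable_fun setT X.

Local Open Scope ereal_scope.

Let mXx x : measurable_fun setT (fun s => X (x, s)).
Proof. exact: (measurableT_comp mX (pair1_measurable x)). Qed.

Definition noise_kernel (x : T1) : {measure set T2 -> \bar R} :=
  measure_function_pushforward__canonical__measure_function_Measure lam (mXx x).

Let measurable_noise_kernel U : measurable U ->
  measurable_fun setT (noise_kernel ^~ U).
Proof.
move=> mU; have mXU : measurable (X @^-1` U).
  by rewrite -[X in measurable X]setTI; exact: mX.
apply: eq_measurable_fun (measurable_fun_xsection lam mXU) => x _.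
rewrite /noise_kernel /= /pushforward; congr (lam _).
by apply/seteqP; split => s; rewrite /xsection /= inE.
Qed.

HB.instance Definition _ := isKernel.Build _ _ _ _ _ noise_kernel
  measurable_noise_kernel.

Let noise_kernel_prob x : noise_kernel x setT = 1.
Proof. by rewrite /noise_kernel /= /pushforward preimage_setT probability_setT. Qed.

HB.instance Definition _ := Kernel_isProbability.Build _ _ _ _ _
  noise_kernel noise_kernel_prob.

Lemma noise_kernelE (alpha : probability T1 R) A B :
  measurable A -> measurable B ->
  (alpha \x lam) [set z | A z.1 /\ B (X z)] = \int[alpha]_(x in A) noise_kernel x B.
Proof.
move=> mA mB; rewrite [RHS]integral_mkcond/= /product_measure1.
apply: eq_integral => x _; rewrite patchE.
case: ifPn => [|/negP]; rewrite inE => Ax.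
  rewrite /noise_kernel /= /pushforward; congr (lam _).
  by apply/seteqP; split => s; rewrite /xsection /= inE/=; tauto.
rewrite /= [X in lam X](_ : _ = set0) ?measure0//.
by apply/seteqP; split => s//; rewrite /xsection /= inE/=; tauto.
Qed.

End noise_kernel.

Lemma disintegration_exists {R : realType} {d1 : measure_display}
    {T1 : measurableType d1} (d : nat) (alpha : probability T1 R)
    (pi : probability (T1 * 'rV[R]_d)%type R) :
  (forall A, measurable A -> pi (A `*` setT) = alpha A) ->
  exists k : R.-pker T1 ~> 'rV[R]_d, disintegration_fst alpha pi k.
Proof.
move=> pi1.
pose f (z : T1 * 'rV[R]_d) : T1 * R := (z.1, row_code z.2).
have mf : measurable_fun setT f.
  apply: measurable_fun_pair; first exact: measurable_fst.
  exact: (measurableT_comp measurable_row_code measurable_snd).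
pose f_mfun : {mfun (T1 * 'rV[R]_d)%type >-> (T1 * R)%type} :=
  HB.pack f (isMeasurableFun.Build _ _ _ _ f mf).
pose pi' : probability (T1 * R)%type R := distribution pi f_mfun.
have pi'E A B : pi' (A `*` B) = pi (A `*` (row_code @^-1` B)) by [].
have pi'1 A : measurable A -> pi' (A `*` setT) = alpha A.
  by move=> mA; rewrite pi'E preimage_setT pi1.
have /choice[F HF] (q : R) := slice_density pi'1 (measurable_itv `]-oo, q[).
have F0 q := (let: And3 a _ _ := HF q in a).
have Fi q := (let: And3 _ a _ := HF q in a).
have FE q := (let: And3 _ _ a := HF q in a).
pose X (z : T1 * measurableTypeR R) : 'rV[R]_d := row_decode (fine (quantile F z)).
have mq : measurable_fun setT (fine \o quantile F).
  by apply: measurableT_comp (measurable_quantile Fi); exact: fine_measurable.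
have mX : measurable_fun setT X by exact: (measurableT_comp measurable_row_decode mq).
exists (noise_kernel (uniform_prob (@ltr01 R)) mX) => A B mA mB.
rewrite -noise_kernelE//.
have mrB : measurable (row_decode @^-1` B : set R).
  by rewrite -[X in measurable X]setTI; exact: measurable_row_decode.
(* As decoding inverts coding, the preimage of [B] under decoding, pulled back by [row_code], is [B]
   again. *)
rewrite -(quantile_law pi'1 F0 Fi FE mA mrB) pi'E; congr (pi (_ `*` _)).
by apply/seteqP; split => z /=; rewrite row_codeK.
Qed.

(** * Convex functions and barycenters *)

Section dot_product.
Context {R : realType} {d : nat}.
Implicit Types (u v w : 'rV[R]_d) (a : R).

Definition dot u v : R := \sum_i u ord0 i * v ord0 i.

Lemma dotDr u v w : dot u (v + w) = dot u v + dot u w.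
Proof.
by rewrite /dot -big_split/=; apply: eq_bigr => i _; rewrite !mxE mulrDr.
Qed.

Lemma dotZr a u v : dot u (a *: v) = a * dot u v.
Proof.
by rewrite /dot mulr_sumr; apply: eq_bigr => i _; rewrite !mxE mulrCA.
Qed.

Lemma dotC u v : dot u v = dot v u.
Proof. by apply: eq_bigr => i _; rewrite mulrC. Qed.

Lemma dotDl u v w : dot (u + v) w = dot u w + dot v w.
Proof. by rewrite dotC dotDr !(dotC w). Qed.

Lemma dotZl a u v : dot (a *: u) v = a * dot u v.
Proof. by rewrite dotC dotZr (dotC v). Qed.

Lemma dotNr u v : dot u (- v) = - dot u v.
Proof. by rewrite -scaleN1r dotZr mulN1r. Qed.

Lemma dotBr u v w : dot u (v - w) = dot u v - dot u w.
Proof. by rewrite dotDr dotNr. Qed.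

Lemma dot0r u : dot u 0 = 0.
Proof. by rewrite /dot big1// => i _; rewrite mxE mulr0. Qed.

Lemma dot_deltar u i : dot u (delta_mx ord0 i) = u ord0 i.
Proof.
rewrite /dot (bigD1 i)//= mxE !eqxx mulr1 big1 ?addr0// => j ji.
by rewrite mxE (negbTE ji) andbF mulr0.
Qed.

Lemma dot_deltal i v : dot (delta_mx ord0 i) v = v ord0 i.
Proof. by rewrite dotC dot_deltar. Qed.

Lemma continuous_dot u : continuous (dot u).
Proof.
rewrite /dot; elim: (index_enum _) => [|i s ih] x.
  rewrite (_ : (fun v => _) = cst 0); first exact: cst_continuous.
  by apply/funext => v; rewrite big_nil.
rewrite (_ : (fun v => _) = (fun v : 'rV[R]_d => u ord0 i * v ord0 i +
    \sum_(j <- s) u ord0 j * v ord0 j)).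
  have h : {for x, continuous (fun v : 'rV[R]_d => u ord0 i * v ord0 i)}.
    apply: (@continuousM R _ (cst (u ord0 i)) (fun v : 'rV[R]_d => v ord0 i)).
      exact: cst_continuous.
    exact: coord_continuous.
  exact: (continuousD h (ih x)).
by apply/funext => v; rewrite big_cons.
Qed.

Lemma measurable_dot u : measurable_fun setT (dot u).
Proof. by apply: continuous_measurable_mx; exact: continuous_dot. Qed.

End dot_product.

(** * Subgradients of convex functions *)

Section subgradient.
Context {R : realType} {d : nat}.
Implicit Types (phi : 'rV[R]_d -> R).

(** This is all that is used of convexity: it yields measurability and Jensen's inequality and is
    stable under subtraction of an affine function. *)
Definition subdifferentiable phi : Prop :=
  forall x, exists g, forall y, phi x + dot g (y - x) <= phi y.

Section existence.
Variable psi : 'rV[R]_d -> R.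
Hypothesis psi_conv : forall (t : R) x y, 0 <= t <= 1 ->
  psi (t *: x + (1 - t) *: y) <= t * psi x + (1 - t) * psi y.
Hypothesis psi0 : psi 0 = 0.

(** The flag of coordinate subspaces along which a linear minorant is extended, one dimension at a
    time. *)
Definition low (k : nat) (v : 'rV[R]_d) := forall j : 'I_d, (k <= j)%N -> v ord0 j = 0.

(* The one-dimensional step of the Hahn-Banach theorem. *)
Let extend (k : 'I_d) g :
  (forall v, low k v -> dot g v <= psi v) ->
  exists g', forall v, low k.+1 v -> dot g' v <= psi v.
Proof.
move=> gP; pose e : 'rV[R]_d := delta_mx ord0 k.
pose L := [set a | exists w r, [/\ low k w, 0 < r &
  a = (dot g w - psi (w - r *: e)) / r]].
(* Lower slopes never exceed upper slopes: the weight [s / (r + s)] cancels [e] in the convex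
   combination of [w - r *: e] and [v + s *: e], which falls back into [low k], where [g] is already
   a minorant. *)
have key w v r s : low k w -> low k v -> 0 < r -> 0 < s ->
    (dot g w - psi (w - r *: e)) / r <= (psi (v + s *: e) - dot g v) / s.
  move=> lw lv r0 s0; have rs0 : 0 < r + s by rewrite addr_gt0.
  pose t := s / (r + s).
  have t01 : 0 <= t <= 1.
    apply/andP; split; first by rewrite divr_ge0 ?ltW.
    by rewrite ler_pdivrMr// mul1r lerDr ltW.
  have t1 : 1 - t = r / (r + s) by rewrite /t; field; rewrite gt_eqF.
  have := psi_conv (w - r *: e) (v + s *: e) t01.
  have -> : t *: (w - r *: e) + (1 - t) *: (v + s *: e) = t *: w + (1 - t) *: v.
    rewrite t1 /t; apply/rowP => j; rewrite !mxE; field; rewrite gt_eqF//.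
  have := gP (t *: w + (1 - t) *: v).
  rewrite dotDr !dotZr => /(_ _)/le_trans h /h {h}.
  have l : low k (t *: w + (1 - t) *: v).
    by move=> j kj; rewrite !mxE lw// lv// !mulr0 addr0.
  move=> /(_ l); rewrite t1 /t => h.
  rewrite ler_pdivrMr// mulrAC ler_pdivlMr//.
  rewrite -(ler_pM2r (x := (r + s)^-1)) ?invr_gt0//.
  rewrite -subr_ge0 in h; rewrite -subr_ge0; apply: le_trans h _.
  by rewrite le_eqVlt; apply/orP; left; apply/eqP; ring.
have low0 : low k 0 by move=> j _; rewrite mxE.
have L0 : L !=set0 by exists ((dot g 0 - psi (0 - 1 *: e)) / 1), 0, 1.
have Lub : has_ubound L.
  exists ((psi (0 + 1 *: e) - dot g 0) / 1) => _ [w [r [lw r0 ->]]].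
  exact: key.
pose al := sup L.
(* The correction replaces the coordinate [k] of [g], which is arbitrary so far, by the slope
   [al]. *)
exists (g + (al - g ord0 k) *: e) => v' lv'.
pose c := v' ord0 k; pose v := v' - c *: e.
have lv : low k v.
  move=> j; rewrite leq_eqVlt => /orP[/eqP kj|kj].
    have -> : j = k by apply/val_inj; rewrite /= kj.
    by rewrite !mxE !eqxx mulr1 subrr.
  by rewrite !mxE lv'// [j == k]gtn_eqF// mulr0 subr0.
have v'E : v' = v + c *: e by rewrite /v subrK.
have vk : v ord0 k = 0 by apply: lv.
have -> : dot (g + (al - g ord0 k) *: e) v' = dot g v + al * c.
  by rewrite dotDl dotZl dot_deltal -/c v'E dotDr dotZr dot_deltar; ring.
have [c0|c0|c0] := ltgtP c 0.
- have Nc0 : 0 < - c by rewrite oppr_gt0.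
  have : (dot g v - psi (v - (- c) *: e)) / (- c) <= al.
    by apply: ub_le_sup => //; exists v, (- c).
  by rewrite ler_pdivrMr// scaleNr opprK -v'E mulrN; lra.
- have : al <= (psi (v + c *: e) - dot g v) / c.
    by apply: ge_sup => // _ [w [r [lw r0 ->]]]; exact: key.
  by rewrite ler_pdivlMr// -v'E; lra.
- by rewrite c0 mulr0 addr0 v'E c0 scale0r addr0 gP.
Qed.

Let extends k : (k <= d)%N ->
  exists g, forall v, low k v -> dot g v <= psi v.
Proof.
elim: k => [_|k ih kd].
  exists 0 => v v0; have -> : v = 0 by apply/rowP => j; rewrite mxE v0.
  by rewrite dot0r psi0.
have [g gP] := ih (ltnW kd).
exact: (@extend (Ordinal kd) g gP).
Qed.

Lemma linear_minorant : exists g, forall v, dot g v <= psi v.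
Proof.
have [g gP] := extends (leqnn d); exists g => v; apply: gP => j.
by rewrite leqNgt ltn_ord.
Qed.

End existence.

Lemma convex_functionP phi : convex_function setT (phi : _ -> R^o) <->
  forall (t : R) x y, 0 <= t <= 1 ->
    phi (t *: x + (1 - t) *: y) <= t * phi x + (1 - t) * phi y.
Proof.
split => [cphi t x y /andP[t0 t1]|cphi t x y _ _].
  by have := cphi (Itv01 t0 t1) x y; rewrite !inE; apply.
have t01 : (0 <= t%:num :> R) && (t%:num <= 1 :> R) by apply/andP; split.
exact: (cphi t%:num x y t01).
Qed.

Lemma convex_subdifferentiable phi :
  convex_function setT (phi : _ -> R^o) -> subdifferentiable phi.
Proof.
move=> /convex_functionP cphi x.
have [t y z t01||g gP] := @linear_minorant (fun v => phi (x + v) - phi x).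
- have := cphi t (x + y) (x + z) t01.
  have -> : t *: (x + y) + (1 - t) *: (x + z) = x + (t *: y + (1 - t) *: z).
    by apply/rowP => j; rewrite !mxE; ring.
  by move=> h; rewrite lerBlDr; apply: le_trans h _; rewrite le_eqVlt; apply/orP; left; apply/eqP; ring.
- by rewrite addr0 subrr.
- by exists g => y; have := gP (y - x); rewrite addrCA subrr addr0 lerBrDl addrC.
Qed.

(** The function is the supremum of its supporting affine functions, so [a < phi] is a union of open
    half-spaces; openness makes the uncountable union harmless. *)
Lemma subdifferentiable_measurable phi :
  subdifferentiable phi -> measurable_fun setT phi.
Proof.
move=> /choice[g gP]; apply: lower_measurable_mx => a.
rewrite [X in open X](_ : _ = \bigcup_(x in [set x | a < phi x])
   [set y | a - phi x + dot (g x) x < dot (g x) y]).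
  apply: bigcup_open => x _.
  by apply: (@open_comp _ _ (dot (g x)) [set r | _ < r]) => // y _; exact: continuous_dot.
apply/seteqP; split => [y /= ay|y [x /= ax xy]].
  by exists y => //=; lra.
by apply: lt_le_trans (gP x y); rewrite dotBr; lra.
Qed.

End subgradient.

(** The minorant bounds the negative part, so only the positive part can diverge. In Jensen's
    inequality the divergent case is trivial and the other one has finite integrals throughout. *)
Lemma integrable_or_pinfty {R : realType} {dT : measure_display}
    {T : measurableType dT} (mu : {measure set T -> \bar R}) (f l : T -> R) :
  measurable_fun setT f -> mu.-integrable setT (EFin \o l) ->
  (forall x, l x <= f x) ->
  mu.-integrable setT (EFin \o f) \/ (\int[mu]_x (f x)%:E = +oo)%E.
Proof.
move=> mf li lf; have mfE : measurable_fun setT (EFin \o f) by exact/measurable_EFinP.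
have neg : (\int[mu]_x (EFin \o f)^\- x < +oo)%E.
  apply: le_lt_trans (integral_funeneg_lt_pinfty measurableT li).
  apply: ge0_le_integral => //.
  - exact: measurable_funeneg.
  - by apply: measurable_funeneg; exact: measurable_int li.
  - move=> x _; rewrite !funenegE /= ge_max !le_max lexx orbT andbT.
    by rewrite !lee_fin lerN2 lf.
case: (ltP (\int[mu]_x (EFin \o f)^\+ x)%E +oo%E) => [pos|pos].
  left; apply/integrableP; split => //.
  under eq_integral do rewrite -/((abse \o (EFin \o f)) _) fune_abse.
  rewrite ge0_integralD//; [exact: lte_add_pinfty|exact: measurable_funepos|exact: measurable_funeneg].
right; rewrite integralE; move: pos; rewrite leye_eq => /eqP ->.
have : (\int[mu]_x (EFin \o f)^\- x)%E \is a fin_num.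
  by rewrite ge0_fin_numE// integral_ge0.
by rewrite -fin_numN; case: (- _)%E.
Qed.

Section barycenter_jensen.
Context {R : realType} {d : nat} (m : {measure set 'rV[R]_d -> \bar R}).
Hypothesis m1 : m setT = 1%E.
Hypothesis mi : forall i, m.-integrable setT (fun z => (z ord0 i)%:E).

Lemma barycenterE i : ((barycenter m ord0 i)%:E = \int[m]_z (z ord0 i)%:E)%E.
Proof.
rewrite mxE /Rintegral fineK//; exact: integrable_fin_num.
Qed.

Lemma integrable_dot g : m.-integrable setT (fun z => (dot g z)%:E).
Proof.
apply: integrable_sumR => i; under eq_fun do rewrite EFinM.
exact: integrableZl.
Qed.

Lemma integral_dot g : (\int[m]_z (dot g z)%:E = (dot g (barycenter m))%:E)%E.
Proof.
rewrite integral_sumR; last first.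
  by move=> i; under eq_fun do rewrite EFinM; exact: integrableZl.
rewrite -sumEFin; apply: eq_bigr => i _.
by under eq_integral do rewrite EFinM; rewrite integralZl// -barycenterE -EFinM.
Qed.

(** Integrate the supporting affine function at the barycenter. *)
Lemma jensen phi : subdifferentiable phi -> (forall z, 0 <= phi z) ->
  ((phi (barycenter m))%:E <= \int[m]_z (phi z)%:E)%E.
Proof.
move=> sphi phi0; have mphi := subdifferentiable_measurable sphi.
set b := barycenter m; have [g gP] := sphi b.
pose c := phi b - dot g b.
have ci : m.-integrable setT (EFin \o cst c).
  apply/integrableP; split; first exact/measurable_EFinP.
  by under eq_integral do rewrite /=; rewrite integral_cst// m1 mule1 ltry.
have li : m.-integrable setT (EFin \o (fun z => c + dot g z)).
  by have := integrableD measurableT ci (integrable_dot g).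
have lphi z : c + dot g z <= phi z.
  by have := gP z; rewrite dotBr /c; lra.
have [phii|->] := integrable_or_pinfty mphi li lphi; last by rewrite leey.
have : (\int[m]_z (c + dot g z)%:E <= \int[m]_z (phi z)%:E)%E.
  by apply: le_integral => // z _; rewrite lee_fin.
apply: le_trans; under eq_integral do rewrite EFinD.
rewrite integralD//; last exact: integrable_dot.
rewrite integral_cst// m1 mule1 integral_dot -EFinD lee_fin.
by rewrite /c -/b; lra.
Qed.

End barycenter_jensen.

Lemma kernel_measurable_barycenter {R : realType} {d : nat} {d1 : measure_display}
    {T1 : measurableType d1} (k : R.-pker T1 ~> 'rV[R]_d) :
  measurable_fun setT (fun x => barycenter (k x)).
Proof.
apply: measurable_fun_row => i; under eq_fun do rewrite mxE.
apply: measurableT_comp; first exact: fine_measurable.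
have := @measurable_disintegration R _ _ T1 'rV[R]_d k (fun z => (z.2 ord0 i)%:E).
apply; apply/measurable_EFinP.
exact: (measurableT_comp (measurable_coord i) measurable_snd).
Qed.

Section barycentric_projection.
Context {R : realType} {d : nat} {d1 : measure_display} {T1 : measurableType d1}.
Variables (alpha : probability T1 R) (nu : probability 'rV[R]_d R).
Variable pi : probability (T1 * 'rV[R]_d)%type R.
Variable p : R.-pker T1 ~> 'rV[R]_d.
Hypothesis pi_coupling : coupling alpha nu pi.
Hypothesis pip : disintegration_fst alpha pi p.
Hypothesis nu_P2 : finite_second_moment nu.

Let b x := barycenter (p x).
Let mb : measurable_fun setT b. Proof. exact: kernel_measurable_barycenter. Qed.

Lemma sqint_coupling_snd i : sqint pi (fun z => z.2 ord0 i).
Proof.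
have /finite_second_momentP/(_ i) := nu_P2.
apply: (sqint_comp measurable_snd) => A mA.
by case: pi_coupling => _ /(_ A mA) <-.
Qed.

Lemma sqint_coupling_fst f : sqint alpha f -> sqint pi (f \o fst).
Proof.
apply: (sqint_comp measurable_fst) => A mA.
by case: pi_coupling => /(_ A mA) <-.
Qed.

Lemma ge0_integral_coupling_snd (f : 'rV[R]_d -> \bar R) :
  measurable_fun setT f -> (forall z, 0 <= f z)%E ->
  (\int[nu]_z f z = \int[alpha]_x \int[p x]_z f z)%E.
Proof.
move=> mf f0.
have <- := ge0_integral_disintegration pip (fun z => f0 z.2)
  (measurableT_comp mf measurable_snd).
have := ge0_integral_pushforward measurable_snd pi measurableT mf (fun z _ => f0 z).
rewrite preimage_setT => <-; apply: eq_measure_integral => A mA _.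
by case: pi_coupling => _ /(_ A mA) h; exact: esym h.
Qed.

Lemma ae_coord_integrable :
  {ae alpha, forall x i, (p x).-integrable setT (fun z => (z ord0 i)%:E)}.
Proof.
apply: filter_forall => i.
have := ae_integrable_disintegration pip (sqint_integrable (sqint_coupling_snd i)).
by [].
Qed.

Lemma barycenter_jensen_ge0 phi : subdifferentiable phi ->
  (forall z, 0 <= phi z) ->
  (\int[alpha]_x (phi (b x))%:E <= \int[nu]_z (phi z)%:E)%E.
Proof.
move=> sphi phi0; have mphi := subdifferentiable_measurable sphi.
have mphiE : measurable_fun setT (EFin \o phi) by exact/measurable_EFinP.
rewrite (ge0_integral_coupling_snd mphiE); last by move=> z; rewrite lee_fin.
apply: ae_ge0_le_integral => //.
- by move=> x _; rewrite lee_fin.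
- by apply/measurable_EFinP; exact: measurableT_comp.
- by move=> x _; apply: integral_ge0 => z _; rewrite lee_fin.
- have := @measurable_disintegration R _ _ T1 'rV[R]_d p (fun z => (phi z.2)%:E).
  by apply; exact: (measurableT_comp mphiE measurable_snd).
apply: filterS ae_coord_integrable => x xi _.
have := jensen (@prob_kernel _ _ _ _ _ p x) xi sphi phi0.
exact.
Qed.

Lemma sqint_barycenter i : sqint alpha (fun x => b x ord0 i).
Proof.
apply: measurable_sqr_lty_sqint; first exact: measurable_rowP.
have /finite_second_momentP/(_ i)/sqint_lty := nu_P2.
apply: le_lt_trans.
apply: (barycenter_jensen_ge0 (phi := fun z => z ord0 i ^+ 2)) => [x|z]; last exact: sqr_ge0.
exists (2 * x ord0 i *: delta_mx ord0 i) => y.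
rewrite dotZl dot_deltal !mxE.
by have := sqr_ge0 (y ord0 i - x ord0 i); nra.
Qed.

(** The barycenter is the conditional expectation of the second variable given the first. This
    identity is the only access to couplings in the later orthogonality arguments. *)
Lemma integral_barycenterM i f : sqint alpha f ->
  (\int[pi]_z (f z.1 * z.2 ord0 i)%:E = \int[alpha]_x (f x * b x ord0 i)%:E)%E.
Proof.
move=> sf.
have fi := sqintM_integrable (sqint_coupling_fst sf) (sqint_coupling_snd i).
rewrite (integral_disintegration pip fi)/=.
apply: ae_eq_integral => //.
- exact: (@measurable_disintegration R _ _ T1 'rV[R]_d p _ (measurable_int _ fi)).
- by apply/measurable_EFinP; apply: measurable_funM; [case: sf|exact: measurable_rowP].
apply: filterS ae_coord_integrable => x xi _.
under eq_integral do rewrite EFinM.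
rewrite integralZl// EFinM; congr (_ * _)%E.
by rewrite -(barycenterE xi).
Qed.

Lemma integral_barycenter i :
  (\int[alpha]_x (b x ord0 i)%:E = \int[nu]_z (z ord0 i)%:E)%E.
Proof.
have := integral_barycenterM i (sqint_cst alpha 1).
under [in X in _ = X -> _]eq_integral do rewrite mul1r.
move=> <-; under [LHS]eq_integral do rewrite /= mul1r.
rewrite [RHS](eq_measure_integral (pushforward pi snd)) => [|A mA _].
  rewrite integral_pushforward//.
  - by apply/measurable_EFinP; exact: measurable_coord.
  - exact: (sqint_integrable (sqint_coupling_snd i)).
by case: pi_coupling => _ /(_ A mA) h; exact: esym h.
Qed.

(** Subtracting the supporting affine function at 0 leaves a nonnegative convex function, for which
    the inequality is already known; the affine part has the same integral on both sides because
    barycenters preserve the mean. *)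
Lemma barycenter_convex phi : subdifferentiable phi ->
  (\int[alpha]_x (phi (b x))%:E <= \int[nu]_z (phi z)%:E)%E.
Proof.
move=> sphi; have mphi := subdifferentiable_measurable sphi.
have [g gP] := sphi 0.
have ni i : nu.-integrable setT (fun z => (z ord0 i)%:E).
  by have /finite_second_momentP h := nu_P2; exact: (sqint_integrable (h i)).
have bi i : alpha.-integrable setT (fun x => (b x ord0 i)%:E).
  by apply: sqint_integrable; exact: sqint_barycenter.
have dbi : alpha.-integrable setT (fun x => (dot g (b x))%:E).
  by apply: integrable_sumR => i; under eq_fun do rewrite EFinM; exact: integrableZl.
have lphi z : phi 0 + dot g z <= phi z by have := gP z; rewrite subr0.
have li : nu.-integrable setT (EFin \o (fun z => phi 0 + dot g z)).
  have := integrableD measurableT (finite_measure_integrable_cst nu (phi 0) measurableT) (integrable_dot ni g).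
  by [].
have [phii|->] := integrable_or_pinfty mphi li lphi; last by rewrite leey.
pose psi z := phi z - (phi 0 + dot g z).
have spsi : subdifferentiable psi.
  move=> x; have [h hP] := sphi x; exists (h - g) => y.
  have := hP y; rewrite /psi !dotBr; rewrite [dot (h - g) y]dotDl [dot (h - g) x]dotDl.
  have E z : dot (- g) z = - dot g z by rewrite dotC dotNr dotC.
  by rewrite !E; lra.
have psi0 z : 0 <= psi z by rewrite subr_ge0.
have psii : nu.-integrable setT (EFin \o psi).
  by have := integrableB measurableT phii li.
have /= psile := barycenter_jensen_ge0 spsi psi0.
have mpsi := subdifferentiable_measurable spsi.
have psibi : alpha.-integrable setT (fun x => (psi (b x))%:E).
  apply/integrableP; split; first by apply/measurable_EFinP; exact: measurableT_comp.
  under eq_integral do rewrite gee0_abs ?lee_fin//.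
  apply: le_lt_trans psile _.
  by rewrite ltey_eq integrable_fin_num.
have lbi : alpha.-integrable setT (fun x => (phi 0 + dot g (b x))%:E).
  have := integrableD measurableT (finite_measure_integrable_cst alpha (phi 0) measurableT) dbi.
  by [].
have EL : (\int[alpha]_x (phi (b x))%:E = \int[alpha]_x (psi (b x))%:E + \int[alpha]_x (phi 0 + dot g (b x))%:E)%E.
  by rewrite -integralD//; apply: eq_integral => x _; rewrite -EFinD /psi subrK.
have ER : (\int[nu]_x (phi x)%:E = \int[nu]_x (psi x)%:E + \int[nu]_x (phi 0 + dot g x)%:E)%E.
  by rewrite -integralD//; apply: eq_integral => x _; rewrite -EFinD /psi subrK.
rewrite EL ER; apply: leeD => //.
under eq_integral do rewrite EFinD.
under [leRHS]eq_integral do rewrite EFinD.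
rewrite (integralD measurableT (finite_measure_integrable_cst alpha (phi 0) measurableT) dbi).
rewrite (integralD measurableT (finite_measure_integrable_cst nu (phi 0) measurableT) (integrable_dot ni g)).
have -> : (\int[alpha]_x (EFin \o cst (phi 0%R)) x = (phi 0%R)%:E)%E.
  exact: probability_integral_cst.
have -> : (\int[nu]_x (EFin \o cst (phi 0%R)) x = (phi 0%R)%:E)%E.
  exact: probability_integral_cst.
apply: leeD => //.
rewrite integral_dot// integral_sumR; last first.
  by move=> i; under eq_fun do rewrite EFinM; exact: integrableZl.
rewrite -sumEFin; apply: lee_sum => i _.
under eq_integral do rewrite EFinM.
by rewrite integralZl// integral_barycenter -barycenterE// -EFinM.
Qed.

End barycentric_projection.

(** * Smoothed maxima and the approximate Strassen theorem *)

Section exponential_means.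
Context {R : realType} {n : nat}.
Implicit Types w x : 'I_n -> R.

(** From [1 - x <= expR (- x)], the left side is at most [(1 - x)^-1]; and [(1 - x) * (1 + x + 2 * x
    ^+ 2) = 1 + x ^+ 2 * (1 - 2 * x)] is at least 1 for [x <= 1 / 2]. *)
Lemma expR_le_quadratic (x : R) : x <= 1 / 2 -> expR x <= 1 + x + 2 * x ^+ 2.
Proof.
move=> x12; have x1 : 0 < 1 - x by lra.
have : expR x <= (1 - x)^-1.
  rewrite -[leLHS]invrK -expRN lef_pV2 ?posrE ?expR_gt0//.
  exact: expR_ge1Dx.
move/le_trans; apply; rewrite -[leLHS]mul1r ler_pdivrMr//.
by have := sqr_ge0 x; nra.
Qed.

Section weights.
Variable w : 'I_n -> R.
Hypothesis w0 : forall i, 0 <= w i.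
Hypothesis w1 : \sum_i w i = 1.

Lemma mean_cst (c : R) : \sum_i w i * c = c.
Proof. by rewrite -mulr_suml w1 mul1r. Qed.

Lemma mean_le x y : (forall i, x i <= y i) ->
  \sum_i w i * x i <= \sum_i w i * y i.
Proof. by move=> xy; apply: ler_sum => i _; exact: ler_wpM2l. Qed.

Lemma mean_exp_gt0 x : 0 < \sum_i w i * expR (x i).
Proof.
rewrite lt_neqAle sumr_ge0 ?andbT; last first.
  by move=> i _; rewrite mulr_ge0// expR_ge0.
apply/eqP => /esym/eqP; rewrite psumr_eq0; last first.
  by move=> i _; rewrite mulr_ge0// expR_ge0.
move=> /allP w_0; have := oner_neq0 R; rewrite -w1 big1 ?eqxx// => i _.
have := w_0 i (mem_index_enum _); rewrite mulf_eq0 => /orP[/eqP//|].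
by rewrite gt_eqF// expR_gt0.
Qed.

(** Jensen's inequality for the exponential, from its tangent at the mean [M]. *)
Lemma mean_le_ln_mean_exp x :
  \sum_i w i * x i <= ln (\sum_i w i * expR (x i)).
Proof.
set M := \sum_i _; rewrite -ler_expR lnK ?posrE ?mean_exp_gt0//.
have -> : \sum_i w i * expR (x i) = expR M * \sum_i w i * expR (x i - M).
  by rewrite mulr_sumr; apply: eq_bigr => i _; rewrite mulrCA -expRD addrC subrK.
rewrite -[leLHS]mulr1 ler_pM2l ?expR_gt0//.
apply: (@le_trans _ _ (\sum_i w i * (1 + (x i - M)))); last first.
  by apply: mean_le => i; exact: expR_ge1Dx.
under eq_bigr do rewrite mulrDr mulrBr mulr1.
rewrite big_split/= sumrB -mulr_suml w1 mul1r -/M; lra.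
Qed.

(** For [B <= 1 / 2] the quadratic bound gives the error [2 * B ^+ 2]. For larger [B] the left side
    is at most [B] and the mean at least [- B], and [2 * B <= 4 * B ^+ 2]; this case fixes the
    constant 4. *)
Lemma ln_mean_exp_le x (B : R) : (forall i, `|x i| <= B) ->
  ln (\sum_i w i * expR (x i)) <= \sum_i w i * x i + 4 * B ^+ 2.
Proof.
move=> xB; have B0 : 0 <= B.
  case: (pickP 'I_n) => [i _|I0]; first exact: le_trans (xB i).
  have := oner_neq0 R; rewrite -w1 big_pred0 ?eqxx//.
set M := \sum_i w i * x i.
have [B12|B12] := leP B (1 / 2).
  apply: (@le_trans _ _ (ln (1 + (M + 2 * B ^+ 2)))).
    rewrite ler_ln ?posrE ?mean_exp_gt0//; last first.
      apply: lt_le_trans (mean_exp_gt0 x) _.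
      apply: (@le_trans _ _ (\sum_i w i * (1 + x i + 2 * B ^+ 2))).
        apply: mean_le => i; apply: le_trans (expR_le_quadratic _) _.
          by apply: le_trans B12; apply: le_trans (xB i); exact: ler_norm.
        by rewrite lerD2l ler_pM2l// -[x i ^+ 2]real_normK ?num_real// ler_sqr ?nnegrE.
      by under eq_bigr do rewrite !mulrDr mulr1; rewrite !big_split/= w1 mean_cst -/M; lra.
    apply: (@le_trans _ _ (\sum_i w i * (1 + x i + 2 * B ^+ 2))).
      apply: mean_le => i; apply: le_trans (expR_le_quadratic _) _.
        by apply: le_trans B12; apply: le_trans (xB i); exact: ler_norm.
      by rewrite lerD2l ler_pM2l// -[x i ^+ 2]real_normK ?num_real// ler_sqr ?nnegrE.
    by under eq_bigr do rewrite !mulrDr mulr1; rewrite !big_split/= w1 mean_cst -/M; lra.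
  have MB : -1 < M + 2 * B ^+ 2.
    have : - B <= M.
      rewrite /M -[leLHS]mean_cst; apply: mean_le => i.
      by have := xB i; rewrite ler_norml => /andP[].
    by have := sqr_ge0 B; lra.
  apply: le_trans (le_ln1Dx MB) _.
  by have := sqr_ge0 B; lra.
apply: (@le_trans _ _ B).
  rewrite -ler_expR lnK ?posrE ?mean_exp_gt0// -[leRHS]mean_cst.
  apply: mean_le => i; rewrite ler_expR.
  by apply: le_trans (xB i); exact: ler_norm.
have : - B <= M.
  rewrite /M -[leLHS]mean_cst; apply: mean_le => i.
  by have := xB i; rewrite ler_norml => /andP[].
by nra.
Qed.

End weights.
End exponential_means.

(** * Log-sum-exp and softmax weights *)

Section log_sum_exp.
Context {R : realType} {d n : nat}.
Variable a : 'I_n -> R.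
Hypothesis a0 : forall i, 0 <= a i.
Hypothesis a1 : \sum_i a i = 1.
Implicit Types (h : 'I_n -> 'rV[R]_d) (c : 'I_n -> R) (z : 'rV[R]_d).

Definition aff h c i z : R := c i + dot (h i) z.

(** The masses [a] weight the exponentials, so that [lse] dominates the mean of the affine functions
    and, up to [ln (a i)], each one of them. *)
Definition lse h c z : R := ln (\sum_i a i * expR (aff h c i z)).

(** The derivative of [lse] in [c i]; multiplied by [z] it is the derivative in [h i]. *)
Definition softmax h c i z : R :=
  a i * expR (aff h c i z) / \sum_j a j * expR (aff h c j z).

Lemma sum_exp_gt0 h c z : 0 < \sum_j a j * expR (aff h c j z).
Proof. exact: mean_exp_gt0. Qed.

Lemma softmax_ge0 h c i z : 0 <= softmax h c i z.
Proof. by rewrite divr_ge0 ?mulr_ge0 ?expR_ge0// ltW// sum_exp_gt0. Qed.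

Lemma softmax_sum h c z : \sum_i softmax h c i z = 1.
Proof. by rewrite -mulr_suml divff// gt_eqF// sum_exp_gt0. Qed.

Lemma softmax_le1 h c i z : softmax h c i z <= 1.
Proof.
rewrite -(softmax_sum h c z) (bigD1 i)//= lerDl sumr_ge0// => j _.
exact: softmax_ge0.
Qed.

(** An exact exponential change of weights: the increment of [lse] is again the logarithm of an
    exponential mean, so the tangent and the quadratic bound both follow from the estimates for
    means. *)
Lemma lse_shift h c h' c' z :
  lse h' c' z = lse h c z +
    ln (\sum_i softmax h c i z * expR (aff h' c' i z - aff h c i z)).
Proof.
have S0 := sum_exp_gt0 h c z.
rewrite -lnM ?posrE//; last first.
  by apply: mean_exp_gt0; [move=> i; exact: softmax_ge0|exact: softmax_sum].
congr ln; rewrite mulr_sumr; apply: eq_bigr => i _.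
rewrite /softmax expRB; field.
by rewrite !gt_eqF ?expR_gt0.
Qed.

Lemma lse_tangent h c h' c' z :
  lse h c z + \sum_i softmax h c i z * (aff h' c' i z - aff h c i z) <= lse h' c' z.
Proof.
rewrite [leRHS](lse_shift h c) lerD2l; apply: mean_le_ln_mean_exp.
- by move=> i; exact: softmax_ge0.
- exact: softmax_sum.
Qed.

Lemma lse_quadratic h c h' c' z B :
  (forall i, `|aff h' c' i z - aff h c i z| <= B) ->
  lse h' c' z <= lse h c z +
    \sum_i softmax h c i z * (aff h' c' i z - aff h c i z) + 4 * B ^+ 2.
Proof.
move=> hB; rewrite (lse_shift h c) -addrA lerD2l; apply: ln_mean_exp_le => //.
- by move=> i; exact: softmax_ge0.
- exact: softmax_sum.
Qed.

Lemma lse_ge_mean h c z : \sum_i a i * aff h c i z <= lse h c z.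
Proof. exact: mean_le_ln_mean_exp. Qed.

Lemma lse_le_norm h c z : lse h c z <= \sum_i `|aff h c i z|.
Proof.
rewrite -ler_expR lnK ?posrE ?sum_exp_gt0// -[leRHS](mean_cst a1).
apply: mean_le => // i; rewrite ler_expR (bigD1 i)//=.
apply: le_trans (ler_norm _) _; rewrite lerDl; exact: sumr_ge0.
Qed.

(** The price [ln (a i)] of the smoothing becomes the constant in the lower bound of the dual. *)
Lemma lse_ge_coord h c i z : 0 < a i -> aff h c i z + ln (a i) <= lse h c z.
Proof.
move=> ai0; rewrite -ler_expR lnK ?posrE ?sum_exp_gt0// expRD lnK ?posrE//.
rewrite mulrC (bigD1 i)//= lerDl; apply: sumr_ge0 => j _.
by rewrite mulr_ge0 ?expR_ge0.
Qed.

(** Moving [z] to [v] changes the affine functions exactly as a change of their constants does, so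
    the tangent inequality in the parameters is also one in the variable. *)
Lemma lse_convex h c : convex_function setT (lse h c : _ -> R^o).
Proof.
apply/convex_functionP => t x y /andP[t0 t1].
set z := t *: x + (1 - t) *: y.
have tan v : lse h c z + \sum_i softmax h c i z * (aff h c i v - aff h c i z) <= lse h c v.
  pose c' i := c i + dot (h i) (v - z).
  have E i : aff h c' i z = aff h c i v by rewrite /aff /c' dotBr; ring.
  have -> : lse h c v = lse h c' z by congr ln; apply: eq_bigr => i _; rewrite E.
  by have := lse_tangent h c h c' z; under eq_bigr do rewrite E.
have := lerD (ler_wpM2l t0 (tan x)) (ler_wpM2l (_ : 0 <= 1 - t) (tan y)).
rewrite subr_ge0 => /(_ t1); apply: le_trans.
rewrite le_eqVlt; apply/orP; left; apply/eqP.
rewrite !mulrDr !mulr_sumr addrACA -big_split/= -mulrDl addrCA subrr addr0 mul1r.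
rewrite big1 ?addr0// => i _.
rewrite /aff /z dotDr !dotZr; ring.
Qed.

Lemma measurable_aff h c i : measurable_fun setT (aff h c i).
Proof. by apply: measurable_funD => //; exact: measurable_dot. Qed.

Lemma measurable_sum_exp h c :
  measurable_fun setT (fun z => \sum_j a j * expR (aff h c j z)).
Proof.
apply: measurable_sum => j; apply: measurable_funM => //.
by apply: measurableT_comp => //; exact: measurable_aff.
Qed.

Lemma measurable_lse h c : measurable_fun setT (lse h c).
Proof.
by apply: measurableT_comp; [exact: measurable_ln|exact: measurable_sum_exp].
Qed.

Lemma measurable_softmax h c i : measurable_fun setT (softmax h c i).
Proof.
(* The division is written as [expR] of [- ln], a composition of measurable functions. *)
have -> : softmax h c i = fun z => expR (ln (\sum_j a j * expR (aff h c j z)) * -1) * (a i * expR (aff h c i z)).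
  apply/funext => z; rewrite mulrN1 expRN lnK ?posrE ?sum_exp_gt0// /softmax; ring.
apply: measurable_funM.
  apply: measurableT_comp => //; apply: measurable_funM => //.
  exact: measurable_lse.
apply: measurable_funM => //; apply: measurableT_comp => //; exact: measurable_aff.
Qed.

Lemma integrable_lse {dO : measure_display} {O : measurableType dO}
    (P : probability O R) (X : O -> 'rV[R]_d) h c :
  (forall j, sqint P (fun w => X w ord0 j)) ->
  P.-integrable setT (fun w => (lse h c (X w))%:E).
Proof.
move=> sX; have mX : measurable_fun setT X.
  by apply: measurable_fun_row => j; case: (sX j).
have aX i : P.-integrable setT (fun w => (aff h c i (X w))%:E).
  apply: sqint_integrable; apply: sqintD; first exact: sqint_cst.
  by apply: sqint_sum => j; exact: sqintZ.
have naX : P.-integrable setT (fun w => (\sum_i `|aff h c i (X w)|)%:E).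
  by apply: integrable_sumR => i; have /integrable_norm := aX i.
apply: (le_integrable _ _ _ naX) => //.
  by apply/measurable_EFinP; exact: (measurableT_comp (measurable_lse h c) mX).
move=> w _; rewrite !abse_EFin lee_fin; apply: le_trans (ler_norm _).
rewrite ler_norml lse_le_norm andbT; apply: le_trans (lse_ge_mean h c (X w)).
rewrite lerNl -sumrN; apply: ler_sum => i _.
rewrite -mulrN; apply: le_trans (ler_norm _) _; rewrite normrM normrN.
by rewrite (ger0_norm (a0 i)) ler_piMl// -a1 (bigD1 i)//= lerDl sumr_ge0.
Qed.

End log_sum_exp.

(** A substitute for the minimum of the positive masses that stays meaningful when there are
    none. *)
Lemma positive_lower_bound {R : realType} (n : nat) (a : 'I_n -> R) :
  exists am, [/\ 0 < am, am <= 1 & forall i, 0 < a i -> am <= a i].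
Proof.
pose S := \sum_(i | 0 < a i) (a i)^-1.
have S0 : 0 <= S by apply: sumr_ge0 => i ai; rewrite invr_ge0 ltW.
exists (1 + S)^-1; split; first by rewrite invr_gt0 ltr_pwDl.
  by rewrite invf_le1 ?ltr_pwDl// lerDl.
move=> i ai; rewrite -[leRHS]invrK lef_pV2 ?posrE ?invr_gt0 ?ltr_pwDl//.
rewrite /S (bigD1 i)//= addrCA lerDl addr_ge0// sumr_ge0// => j /andP[aj _].
by rewrite invr_ge0 ltW.
Qed.

(** * Near minimizers of the dual problem *)

Section near_minimizer.
Context {R : realType} {d n : nat}.
Variables (nu : probability 'rV[R]_d R) (a : 'I_n -> R) (m : 'I_n -> 'rV[R]_d).
Hypothesis nu_P2 : finite_second_moment nu.
Hypothesis a0 : forall i, 0 <= a i.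
Hypothesis a1 : \sum_i a i = 1.

Local Notation integ f := (nu.-integrable setT (fun z => (f z)%:E)).

Let cint i : sqint nu (fun z => z ord0 i).
Proof. by have /finite_second_momentP := nu_P2; exact. Qed.

Let sqint_dot g : sqint nu (dot g).
Proof. by apply: sqint_sum => i; exact: sqintZ. Qed.

Let sqint_aff0 (c : R) g : sqint nu (fun z => c + dot g z).
Proof. by apply: sqintD => //; exact: sqint_cst. Qed.

Let integ_le (f g : 'rV[R]_d -> R) : measurable_fun setT f ->
  (forall z, `|f z| <= g z) -> integ g -> integ f.
Proof.
move=> mf fg gi; apply: (le_integrable _ _ _ gi) => //.
  exact/measurable_EFinP.
by move=> z _; rewrite !abse_EFin lee_fin; apply: le_trans (fg z) (ler_norm _).
Qed.

Let integ_norm (f : 'rV[R]_d -> R) : integ f -> integ (fun z => `|f z|).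
Proof. by move=> /integrable_norm. Qed.

Let a_le1 i : a i <= 1.
Proof. by rewrite -a1 (bigD1 i)//= lerDl sumr_ge0. Qed.

Let integ_lse h c : integ (lse a h c).
Proof. exact: (integrable_lse a0 a1 (X := id)). Qed.

Let integ_softmaxM h c i (x : 'rV[R]_d -> R) : measurable_fun setT x -> integ x ->
  integ (fun z => softmax a h c i z * x z).
Proof.
move=> mx xi; apply: (integ_le (g := fun z => `|x z|)).
- by apply: measurable_funM => //; exact: measurable_softmax.
- move=> z; rewrite normrM ler_piMl// ger0_norm ?softmax_ge0// softmax_le1//.
- exact: integ_norm.
Qed.

(** A common bound for the directions in which the gradient will be tested: the constant 1 and the
    coordinates. *)
Let B (z : 'rV[R]_d) : R := 1 + \sum_j `|z ord0 j|.

Let sqint_B : sqint nu B.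
Proof.
apply: sqintD; first exact: sqint_cst.
by apply: sqint_sum => j; exact: sqint_norm.
Qed.

Let M : R := \int[nu]_z (B z ^+ 2).

Let M0 : 0 <= M.
Proof. by apply: Rintegral_ge0 => z _; exact: sqr_ge0. Qed.

(* The dual of Strassen's problem for a step function with values [m i] on
   cells of mass [a i]. The maximum over [i] of the affine functions is smoothed
   by [lse], so that the derivative is an integral against [softmax]. *)
Definition obj (h : 'I_n -> 'rV[R]_d) (c : 'I_n -> R) : R :=
  \int[nu]_z (lse a h c z) - \sum_i a i * (c i + dot (h i) (m i)).

(** Its vanishing for constants says that the softmax weight [i] has mass [a i]; its vanishing for
    coordinates, that its first moment is [a i *: m i]. *)
Definition obj_gradient h c i (c0 : R) (h0 : 'rV[R]_d) : R :=
  \int[nu]_z (softmax a h c i z * (c0 + dot h0 z)) - a i * (c0 + dot h0 (m i)).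

(** The second-order bound on [lse], integrated for a perturbation of size at most [|s| * B z]; the
    second moment of [nu] makes the remainder finite. *)
Let step h c i0 (c0 : R) (h0 : 'rV[R]_d) (s : R) :
  (forall z, `|c0 + dot h0 z| <= B z) ->
  obj (fun i => h i + (if i == i0 then s *: h0 else 0))
      (fun i => c i + (if i == i0 then s * c0 else 0)) <=
  obj h c + s * obj_gradient h c i0 c0 h0 + 4 * s ^+ 2 * M.
Proof.
move=> xB; set h' := fun i => _; set c' := fun i => _.
pose x z := c0 + dot h0 z.
have E i z : aff h' c' i z - aff h c i z = if i == i0 then s * x z else 0.
  rewrite /aff /h' /c' dotDl; case: ifP => _.
    by rewrite dotZl /x; ring.
  by rewrite [dot 0 z]dotC dot0r; ring.
have mx : measurable_fun setT x by case: (sqint_aff0 c0 h0).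
have xi : integ x by exact: (sqint_integrable (sqint_aff0 c0 h0)).
have sxi := integ_softmaxM h c i0 mx xi.
have [_ B2i] := sqint_B.
have I1 : integ (fun z => lse a h c z + s * (softmax a h c i0 z * x z)).
  have := integrableD measurableT (integ_lse h c) (integrableZl measurableT s sxi).
  by [].
have I2 : integ (fun z => 4 * s ^+ 2 * B z ^+ 2) by exact: (integrableZl measurableT (4 * s ^+ 2) B2i).
have : \int[nu]_z (lse a h' c' z) <=
    \int[nu]_z (lse a h c z) + s * \int[nu]_z (softmax a h c i0 z * x z) + 4 * s ^+ 2 * M.
  rewrite /M -RintegralZl// -RintegralZl// -RintegralD//; last exact: (integrableZl measurableT s sxi).
  rewrite -RintegralD//; apply: le_Rintegral => //.
  - exact: integ_lse.
  - exact: (integrableD measurableT I1 I2).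
  move=> z _.
  have hB i : `|aff h' c' i z - aff h c i z| <= `|s| * B z.
    rewrite E; case: ifP => _; first by rewrite normrM ler_wpM2l//; exact: xB.
    by rewrite normr0 mulr_ge0// (le_trans _ (xB z)).
  have := lse_quadratic a0 a1 hB; rewrite exprMn real_normK ?num_real// mulrA.
  rewrite (bigD1 i0)//= E eqxx big1 ?addr0; last first.
    by move=> j /negbTE jE; rewrite E jE mulr0.
  move/le_trans; apply.
  by rewrite le_eqVlt; apply/orP; left; apply/eqP; ring.
  exact: integ_lse.
have SE : \sum_i a i * (c' i + dot (h' i) (m i)) =
    \sum_i a i * (c i + dot (h i) (m i)) + s * (a i0 * (c0 + dot h0 (m i0))).
  rewrite (bigD1 i0)//= [X in _ = X + _](bigD1 i0)//= /c' /h' eqxx dotDl dotZl.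
  rewrite [X in _ + X = _](eq_bigr (fun i => a i * (c i + dot (h i) (m i)))); last first.
    by move=> i /negbTE iE; rewrite iE !addr0.
  by ring.
rewrite /obj SE /obj_gradient.
rewrite -[X in s * (X - _)]/(\int[nu]_z (softmax a h c i0 z * x z)).
move: (\int[nu]_z (lse a h' c' z)) (\int[nu]_z (lse a h c z)) => A1 A2.
move: (\int[nu]_z (softmax a h c i0 z * x z)) (a i0 * _) => A3 A4.
move: (\sum_i _) (4 * s ^+ 2 * M) => A5 A6; lra.
Qed.

Hypothesis obj_bounded : exists C, forall h c, C <= obj h c.

(** At a point within [s * (e / 2)] of the infimum, neither of the steps [s] and [- s] can fall
    below the infimum, so the derivative is at most [e / 2 + 4 * s * M] in absolute value. *)
Lemma small_gradient (e : R) : 0 < e -> exists h c, forall i c0 h0,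
  (forall z, `|c0 + dot h0 z| <= B z) -> `|obj_gradient h c i c0 h0| <= e.
Proof.
(* This step size makes [4 * s * M] at most [e / 2]; the added 1 covers [M = 0]. *)
move=> e0; pose s := e / (8 * (M + 1)).
have M1 : 0 < 8 * (M + 1) by rewrite mulr_gt0// ltr_wpDl.
have s0 : 0 < s by rewrite divr_gt0.
pose O := [set obj hc.1 hc.2 | hc in [set: ('I_n -> 'rV[R]_d) * ('I_n -> R)]].
have Oinf : has_inf O.
  split; first by exists (obj (fun=> 0) (fun=> 0)), (fun=> 0, fun=> 0).
  by have [C CP] := obj_bounded; exists C => _ [hc _ <-]; exact: CP.
have k0 : 0 < s * (e / 2) by rewrite mulr_gt0// divr_gt0.
have [_ [[h c] _ <-] /= hc] := inf_adherent k0 Oinf.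
exists h, c => i c0 h0 xB.
have inf_le h' c' : inf O <= obj h' c' by apply: ge_inf; [case: Oinf|exists (h', c')].
have p1 := le_trans (inf_le _ _) (step h c i s xB).
have p2 := le_trans (inf_le _ _) (step h c i (- s) xB).
have sM : 4 * s * M <= e / 2.
  rewrite /s ler_pdivlMr// -[leRHS]mul1r.
  rewrite (_ : 4 * (e / (8 * (M + 1))) * M * 2 = e * (M / (M + 1))); last by field; rewrite gt_eqF// ltr_wpDl.
  rewrite mul1r ler_piMr ?(ltW e0)//.
  by rewrite ler_pdivrMr ?ltr_wpDl// mul1r lerDl.
set D := obj_gradient _ _ _ _ _ in p1 p2 *.
rewrite ler_norml; apply/andP; split; rewrite -(ler_pM2l s0).
  have := ler_wpM2l (ltW s0) sM; rewrite sqrrN in p2; lra.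
have := ler_wpM2l (ltW s0) sM; rewrite sqrrN in p2; lra.
Qed.

Lemma approximate_softmax (e : R) : 0 < e -> exists r : 'I_n -> 'rV[R]_d -> R,
  [/\ forall i, measurable_fun setT (r i), forall i z, 0 <= r i z,
      forall z, \sum_i r i z = 1, forall i, a i = 0 -> r i = cst 0 &
      forall i, `|\int[nu]_z (r i z) - a i| <= e /\
        forall j, `|\int[nu]_z (r i z * z ord0 j) - a i * m i ord0 j| <= e].
Proof.
move=> /small_gradient[h [c hc]]; exists (softmax a h c); split.
- by move=> i; exact: measurable_softmax.
- by move=> i z; exact: softmax_ge0.
- by move=> z; exact: softmax_sum.
- by move=> i ai; apply/funext => z; rewrite /softmax ai !mul0r.
move=> i; split => [|j].
  have := hc i 1 0; rewrite /obj_gradient.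
  have d0 z : dot 0 z = 0 :> R by rewrite dotC dot0r.
  under eq_Rintegral do rewrite d0 addr0 mulr1.
  rewrite d0 addr0 mulr1; apply => z.
  by rewrite d0 addr0 normr1 /B lerDl sumr_ge0.
have := hc i 0 (delta_mx ord0 j); rewrite /obj_gradient.
under eq_Rintegral do rewrite add0r dot_deltal.
rewrite add0r dot_deltal; apply => z.
by rewrite add0r dot_deltal /B (bigD1 j)//= addrCA lerDl addr_ge0// sumr_ge0.
Qed.

(* Mixing with constants repairs the masses of the cells exactly. *)
Lemma approximate_strassen (e : R) : 0 < e -> exists r : 'I_n -> 'rV[R]_d -> R,
  [/\ forall i, measurable_fun setT (r i), forall i z, 0 <= r i z <= 1,
      forall z, \sum_i r i z = 1, forall i, \int[nu]_z (r i z) = a i &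
      forall i j, `|\int[nu]_z (r i z * z ord0 j) - a i * m i ord0 j| <= e].
Proof.
move=> e0; have [am [am0 am1 amP]] := positive_lower_bound a.
pose mu j := \int[nu]_z (z ord0 j).
(* The final error is at most [dl + dl * |m| + 2 * dl * |mu|] in each coordinate, hence at most
   [2 * dl * T], which is [e]. *)
pose T := 1 + \sum_i \sum_j `|m i ord0 j| + \sum_j `|mu j|.
have T1 i j : 1 + `|m i ord0 j| + `|mu j| <= T.
  rewrite /T (bigD1 i)//= (bigD1 j)//= [X in _ <= _ + X](bigD1 j)//=.
  have p1 : 0 <= \sum_(k < d | k != j) `|m i ord0 k| by exact: sumr_ge0.
  have p2 : 0 <= \sum_(k < d | k != j) `|mu k| by exact: sumr_ge0.
  have p3 : 0 <= \sum_(k < n | k != i) \sum_j `|m k ord0 j|.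
    by apply: sumr_ge0 => k _; exact: sumr_ge0.
  lra.
have T0 : 0 < T.
  by rewrite /T -addrA ltr_pwDl// addr_ge0// sumr_ge0// => i _; exact: sumr_ge0.
pose dl := e / (2 * T).
have dl0 : 0 < dl by rewrite divr_gt0// mulr_gt0.
(* A tolerance relative to the least positive mass gives [b i <= (1 + dl) * a i], so the leftover
   [a i - k * b i] is nonnegative. *)
have [r [mr r0 r1 ra rE]] := approximate_softmax (mulr_gt0 dl0 am0).
pose k := (1 + dl)^-1.
have dl1 : 0 < 1 + dl by rewrite addr_gt0.
have k0 : 0 < k by rewrite invr_gt0.
have k1 : k <= 1 by rewrite invf_le1// lerDl ltW.
have kdl : 1 - k <= dl.
  rewrite -(ler_pM2r dl1) mulrBl mul1r mulVf ?gt_eqF//.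
  by have := sqr_ge0 dl; lra.
pose b i := \int[nu]_z (r i z).
have rle1 i z : r i z <= 1.
  by rewrite -(r1 z) (bigD1 i)//= lerDl sumr_ge0.
have ri i : integ (r i).
  apply: (integ_le (g := cst 1)) => //; first by move=> z; rewrite ger0_norm.
  exact: (sqint_integrable (sqint_cst nu 1)).
have rzi i j : integ (fun z => r i z * z ord0 j).
  apply: (integ_le (g := fun z => `|z ord0 j|)).
  - by apply: measurable_funM => //; exact: measurable_coord.
  - by move=> z; rewrite normrM ler_piMl// ger0_norm.
  - exact/integ_norm/(sqint_integrable (cint j)).
have bk i : 0 <= a i - k * b i.
  have [ai|ai] := ltP 0 (a i).
    rewrite subr_ge0 -(ler_pM2l dl1) mulrA mulfV ?gt_eqF// mul1r.
    have [+ _] := rE i; rewrite -/(b i) ler_norml => /andP[_ bi].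
    by have := ler_wpM2l (ltW dl0) (amP i ai); lra.
  have ai0 : a i = 0 by apply/eqP; rewrite eq_le ai a0.
  by rewrite /b ra// /= Rintegral_cst// mul0r mulr0 ai0 subrr.
(* The constants fill each mass up to [a i]; as [a] and [b] both have sum 1, they add up to [1 - k]
   and the total stays 1. *)
pose w i z := k * r i z + (a i - k * b i).
have w0 i z : 0 <= w i z by rewrite addr_ge0// mulr_ge0// ltW.
have b1 : \sum_i b i = 1.
  rewrite -[RHS](_ : \int[nu]_z 1 = 1); last first.
    rewrite Rintegral_cst// mul1r [X in fine X](_ : _ = 1%E)//.
    exact: probability_setT.
  apply: EFin_inj; rewrite -sumEFin.
  have fE f : integ f -> ((\int[nu]_z f z)%:E = \int[nu]_z (f z)%:E)%E.
    by move=> fi; rewrite /Rintegral fineK//; exact: integrable_fin_num.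
  under eq_bigr do rewrite fE//.
  rewrite -integral_sumR// fE; last exact: (sqint_integrable (sqint_cst nu 1)).
  by apply: eq_integral => z _; rewrite r1.
have w1 z : \sum_i w i z = 1.
  by rewrite big_split/= -mulr_sumr r1 sumrB -mulr_sumr b1 a1; ring.
have ci (c : R) : integ (fun=> c) by exact: (sqint_integrable (sqint_cst nu c)).
have c1 (c : R) : \int[nu]_z c = c.
  rewrite Rintegral_cst// [X in fine X](_ : _ = 1%E) ?mulr1//.
  exact: probability_setT.
exists w; split => //.
- by move=> i; apply: measurable_funD => //; exact: measurable_funM.
- move=> i z; rewrite w0/= -(w1 z) (bigD1 i)//= lerDl sumr_ge0//.
- move=> i; have kri : integ (fun z => k * r i z) by exact: (integrableZl measurableT k (ri i)).
  rewrite /w (RintegralD measurableT kri (ci (a i - k * b i))) RintegralZl//=; last exact: ri.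
  by rewrite c1 -/(b i); ring.
move=> i j.
have -> : \int[nu]_z (w i z * z ord0 j) =
    k * \int[nu]_z (r i z * z ord0 j) + (a i - k * b i) * mu j.
  have zi := sqint_integrable (cint j).
  have E1 : \int[nu]_z (k * (r i z * z ord0 j)) = k * \int[nu]_z (r i z * z ord0 j).
    by rewrite RintegralZl//; exact: rzi.
  have E2 : \int[nu]_z ((a i - k * b i) * z ord0 j) = (a i - k * b i) * mu j.
    by rewrite RintegralZl//; exact: zi.
  rewrite -E1 -E2 -RintegralD//.
  - by apply: eq_Rintegral => z _; rewrite /w; ring.
  - exact: (integrableZl measurableT k (rzi i j)).
  - exact: (integrableZl measurableT _ zi).
set X := \int[nu]_z _.
have [bi /(_ j)] := rE i; rewrite -/X -/(b i) in bi * => Xi.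
have dam : dl * am <= dl by rewrite ler_piMr// ltW.
have e1 : `|k * X - a i * m i ord0 j| <= dl + dl * `|m i ord0 j|.
  have -> : k * X - a i * m i ord0 j = k * (X - a i * m i ord0 j) - (1 - k) * (a i * m i ord0 j).
    ring.
  apply: le_trans (ler_normB _ _) _; apply: lerD.
    rewrite normrM (ger0_norm (ltW k0)) (le_trans _ (le_trans Xi dam))//.
    by rewrite ler_piMl.
  rewrite normrM ger0_norm ?subr_ge0//; apply: ler_pM => //.
    by rewrite subr_ge0.
  by rewrite normrM ger0_norm// ler_piMl.
have e2 : `|(a i - k * b i) * mu j| <= 2 * dl * `|mu j|.
  rewrite normrM ler_wpM2r// ger0_norm//.
  have -> : a i - k * b i = k * (a i - b i) + (1 - k) * a i by ring.
  rewrite mulr_natl mulr2n; apply: lerD.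
    apply: le_trans (ler_norm _) _; rewrite normrM (ger0_norm (ltW k0)) distrC.
    by rewrite (le_trans _ (le_trans bi dam))// ler_piMl.
  by apply: le_trans kdl; rewrite ler_piMr// subr_ge0.
rewrite addrAC; apply: le_trans (ler_normD _ _) _; apply: le_trans (lerD e1 e2) _.
have -> : e = 2 * dl * T by rewrite /dl; field; rewrite gt_eqF.
have := ler_wpM2l (ltW dl0) (T1 i j).
have : 0 <= dl * `|m i ord0 j| by rewrite mulr_ge0// ltW.
lra.
Qed.

End near_minimizer.

(** * Partitions into cells *)

Lemma measurable_fun_nat {dT : measure_display} {T : measurableType dT}
  (f : nat -> T) : measurable_fun setT f.
Proof. by []. Qed.

Section real_integrals.
Context {R : realType} {dO : measure_display} {O : measurableType dO}.
Variable P : probability O R.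

Local Notation integ f := (P.-integrable setT (fun w => (f w)%:E)).

Lemma RintegralE (f : O -> R) : integ f ->
  ((\int[P]_w (f w))%:E = \int[P]_w (f w)%:E)%E.
Proof. by move=> fi; rewrite /Rintegral fineK//; exact: integrable_fin_num. Qed.

Lemma Rintegral_sum (k : nat) (F : 'I_k -> O -> R) : (forall i, integ (F i)) ->
  \int[P]_w (\sum_i F i w) = \sum_i \int[P]_w (F i w).
Proof.
move=> Fi; apply: EFin_inj; rewrite RintegralE; last exact: integrable_sumR.
by rewrite integral_sumR// -sumEFin; apply: eq_bigr => i _; rewrite RintegralE.
Qed.

Lemma ae_eq_Rintegral (f g : O -> R) : integ f -> integ g ->
  {ae P, forall w, f w = g w} -> \int[P]_w (f w) = \int[P]_w (g w).
Proof.
move=> fi gi fg; apply: EFin_inj; rewrite !RintegralE//.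
apply: ae_eq_integral => //; first exact: measurable_int fi.
  exact: measurable_int gi.
by apply: filterS fg => w -> _.
Qed.

Lemma ae_le_Rintegral (f g : O -> R) : integ f -> integ g ->
  {ae P, forall w, f w <= g w} -> \int[P]_w (f w) <= \int[P]_w (g w).
Proof.
move=> fi gi fg; have gfi : integ (fun w => g w - f w).
  by have := integrableB measurableT gi fi.
rewrite -subr_ge0 -RintegralB//.
rewrite (ae_eq_Rintegral (g := fun w => `|g w - f w|))//.
- by apply: Rintegral_ge0.
- by have /integrable_norm := gfi.
- by apply: filterS fg => w fgw; rewrite ger0_norm// subr_ge0.
Qed.

End real_integrals.

Section cell_means.
Context {R : realType} {dO : measure_display} {O : measurableType dO}.
Variables (P : probability O R) (J : O -> nat) (n : nat).
Hypothesis mJ : measurable_fun setT J.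
Hypothesis Jn : forall w, (J w < n)%N.

Local Notation integ f := (P.-integrable setT (fun w => (f w)%:E)).

Let ind i w : R := (J w == i)%:R.

Definition cell_mass (i : 'I_n) : R := \int[P]_w (ind i w).

(** On a null cell the quotient is 0 by convention, harmlessly, since the numerator is 0 too. The
    index is a natural number so that the mean can be composed with [J]. *)
Definition cell_mean (X : O -> R) (i : nat) : R :=
  (\int[P]_w (ind i w * X w)) / (\int[P]_w (ind i w)).

Let indE (s : nat -> R) w : \sum_(i < n) ind i w * s i = s (J w).
Proof.
rewrite (bigD1 (Ordinal (Jn w)))//= /ind eqxx mul1r big1 ?addr0// => i iJ.
rewrite (_ : (J w == i) = false) ?mul0r//; apply/negbTE.
by apply: contra iJ => /eqP Ji; apply/eqP/val_inj.
Qed.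

Lemma sqint_step (s : nat -> R) : sqint P (fun w => s (J w)).
Proof.
apply: (le_sqint (f := cst (\sum_(i < n) `|s i|))); last exact: sqint_cst.
  exact: measurableT_comp (measurable_fun_nat s) mJ.
move=> w /=; rewrite -[s (J w) ^+ 2]real_normK ?num_real//.
rewrite ler_sqr ?nnegrE ?sumr_ge0// (bigD1 (Ordinal (Jn w)))//= lerDl.
exact: sumr_ge0.
Qed.

Let sqint_ind i : sqint P (ind i).
Proof. exact: (sqint_step (fun k => (k == i)%:R)). Qed.

Let integ_ind i : integ (ind i).
Proof. exact: sqint_integrable (sqint_ind i). Qed.

Let integ_indM i X : sqint P X -> integ (fun w => ind i w * X w).
Proof. by move=> sX; exact: sqintM_integrable. Qed.

Lemma cell_mass_ge0 i : 0 <= cell_mass i.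
Proof. by apply: Rintegral_ge0 => w _; exact: ler0n. Qed.

Lemma cell_mass_sum : \sum_i cell_mass i = 1.
Proof.
rewrite -Rintegral_sum//.
rewrite -[RHS](_ : \int[P]_w 1 = 1).
  by apply: eq_Rintegral => w _; have := indE (fun=> 1) w; under eq_bigr do rewrite mulr1.
rewrite Rintegral_cst// mul1r [X in fine X](_ : _ = 1%E)//.
exact: probability_setT.
Qed.

Lemma cell_massE (i : 'I_n) : ((cell_mass i)%:E = P (J @^-1` [set (i : nat)]))%E.
Proof.
have mJi : measurable (J @^-1` [set (i : nat)]).
  by rewrite -[X in measurable X]setTI; exact: mJ.
rewrite RintegralE//; transitivity (\int[P]_w (\1_(J @^-1` [set (i : nat)]) w)%:E)%E; last first.
  by rewrite integral_indic// setIT.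
apply: eq_integral => w _; rewrite /ind indicE; congr ((_ : bool)%:R%:E).
by apply/eqP/idP; rewrite inE.
Qed.

Lemma cell_mass0_ae (i : 'I_n) : cell_mass i = 0 -> {ae P, forall w, J w <> i}.
Proof.
move=> i0; exists (J @^-1` [set (i : nat)]); split.
- by rewrite -[X in measurable X]setTI; exact: mJ.
- by rewrite -cell_massE i0.
- by move=> w /= /contrapT.
Qed.

Lemma cell_meanE X (i : 'I_n) : sqint P X ->
  \int[P]_w (ind i w * X w) = cell_mass i * cell_mean X i.
Proof.
move=> sX; have [i0|i0] := eqVneq (cell_mass i) 0; last first.
  by rewrite /cell_mean -/(cell_mass i) mulrC divfK.
rewrite i0 mul0r; apply: EFin_inj; rewrite RintegralE//; last exact: integ_indM.
rewrite (ae_eq_integral (cst 0))//; first by rewrite integral0.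
- exact: measurable_int (integ_indM i sX).
- apply: filterS (cell_mass0_ae i0) => w /eqP Jw _.
  by rewrite /ind (negbTE Jw) mul0r.
Qed.

Lemma step_integral (s : nat -> R) :
  \int[P]_w (s (J w)) = \sum_(i < n) cell_mass i * s i.
Proof.
transitivity (\int[P]_w \sum_(i < n) s i * ind i w).
  apply: eq_Rintegral => w _; rewrite -[LHS]indE.
  by apply: eq_bigr => i _; rewrite mulrC.
rewrite Rintegral_sum; last first.
  by move=> i; have := integrableZl measurableT (s i) (integ_ind i).
apply: eq_bigr => i _; rewrite RintegralZl//; last exact: integ_ind.
by rewrite mulrC.
Qed.

(** The cell mean is the conditional expectation given [J]; finitely many cells reduce this to a
    sum. *)
Lemma step_orthogonal X (s : nat -> R) : sqint P X ->
  \int[P]_w (s (J w) * (X w - cell_mean X (J w))) = 0.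
Proof.
move=> sX.
have I1 (i : 'I_n) : integ (fun w => s i * (ind i w * X w)).
  by have := integrableZl measurableT (s i) (integ_indM i sX).
have I2 (i : 'I_n) : integ (fun w => s i * cell_mean X i * ind i w).
  by have := integrableZl measurableT (s i * cell_mean X i) (integ_ind i).
have I3 (i : 'I_n) : integ (fun w => s i * (ind i w * X w) - s i * cell_mean X i * ind i w).
  by have := integrableB measurableT (I1 i) (I2 i).
transitivity (\int[P]_w \sum_(i < n) (s i * (ind i w * X w) - s i * cell_mean X i * ind i w)).
  apply: eq_Rintegral => w _.
  rewrite -[LHS](indE (fun i => s i * (X w - cell_mean X i))).
  by apply: eq_bigr => i _; ring.
rewrite Rintegral_sum//; apply: big1 => i _.
rewrite (RintegralB measurableT (I1 i) (I2 i)).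
rewrite RintegralZl//; last exact: integ_indM.
rewrite RintegralZl//; last exact: integ_ind.
by rewrite cell_meanE// /cell_mass; ring.
Qed.

(** Weak duality, with [lse] itself as test function of the convex order. On cell [i], [lse] at [Z]
    is at least the affine function [i] plus [ln (cell_mass i)]; integration over the cells leaves
    the negative entropy of the masses as a bound independent of [h] and [c]. *)
Lemma convex_order_obj_bounded (d : nat) (nu : probability 'rV[R]_d R)
    (Z : {mfun O >-> 'rV[R]_d}) :
  finite_second_moment nu ->
  (forall j, sqint P (fun w => Z w ord0 j)) ->
  convex_order (distribution P Z) nu ->
  exists C, forall h c, C <= obj nu cell_mass
    (fun i => \row_j cell_mean (fun w => Z w ord0 j) i) h c.
Proof.
move=> nu_P2 sZ ZC; exists (\sum_i cell_mass i * ln (cell_mass i)) => h c.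
have m0 := cell_mass_ge0; have m1 := cell_mass_sum.
set m := fun i : 'I_n => _.
have saff i : sqint P (fun w => aff h c i (Z w)).
  apply: sqintD; first exact: sqint_cst.
  by apply: sqint_sum => j; exact: sqintZ.
have ilse : nu.-integrable setT (fun z => (lse cell_mass h c z)%:E).
  by have /finite_second_momentP := nu_P2; exact: (integrable_lse m0 m1 (X := id)).
pose T w := \sum_(i < n) (ind i w * (aff h c i (Z w) + ln (cell_mass i))).
have sT i : sqint P (fun w => aff h c i (Z w) + ln (cell_mass i)).
  by apply: sqintD => //; exact: sqint_cst.
have Ti : integ T by apply: integrable_sumR => i; exact: integ_indM.
have mZ : measurable_fun setT Z by [].
have TE : \int[P]_w T w = \sum_i cell_mass i * (c i + dot (h i) (m i)) +
    \sum_i cell_mass i * ln (cell_mass i).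
  rewrite Rintegral_sum; last by move=> i; exact: integ_indM.
  rewrite -big_split/=; apply: eq_bigr => i _.
  have indc (k : R) : \int[P]_w (k * ind i w) = k * cell_mass i.
    by rewrite RintegralZl//; exact: integ_ind.
  have ki (k : R) : integ (fun w => k * ind i w).
    by have := integrableZl measurableT k (integ_ind i).
  have zi j : integ (fun w => h i ord0 j * (ind i w * Z w ord0 j)).
    by have := integrableZl measurableT (h i ord0 j) (integ_indM i (sZ j)).
  transitivity (\int[P]_w ((c i + ln (cell_mass i)) * ind i w +
      \sum_j h i ord0 j * (ind i w * Z w ord0 j))).
    apply: eq_Rintegral => w _; rewrite /aff /dot mulrDr mulrDr mulr_sumr.
    rewrite [X in _ + X + _](eq_bigr (fun j => h i ord0 j * (ind i w * Z w ord0 j))); last first.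
      by move=> j _; ring.
    ring.
  rewrite (RintegralD measurableT (ki _) (integrable_sumR _ zi)) indc.
  rewrite Rintegral_sum// /dot mulrDr mulr_sumr.
  rewrite [X in _ + X = _](eq_bigr (fun j => cell_mass i * (h i ord0 j * m i ord0 j))); last first.
    move=> j _; rewrite RintegralZl//; last exact: integ_indM.
    by rewrite cell_meanE// mxE; ring.
  ring.
have mlse : measurable_fun setT (fun z => (lse cell_mass h c z)%:E).
  by apply/measurable_EFinP; exact: measurable_lse.
have lZi : integ (fun w => lse cell_mass h c (Z w)) by exact: (integrable_lse m0 m1 h c sZ).
(* A null cell has no usable logarithmic bound, but [J] avoids it almost surely. *)
have lZ : {ae P, forall w, T w <= lse cell_mass h c (Z w)}.
  have : {ae P, forall w i, 0 < cell_mass i \/ J w <> i}.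
    apply: filter_forall => i; have [i0|i0] := ltP 0 (cell_mass i).
      by apply: nearW; left.
    have : cell_mass i = 0 by apply/eqP; rewrite eq_le i0 m0.
    by move=> /cell_mass0_ae; apply: filterS => w; right.
  apply: filterS => w wP; rewrite /T.
  (* Extension by 0 from ordinals to all naturals, as [indE] evaluates a sequence at [J w]. *)
  pose s (i : nat) := if insub i is Some i' then
    aff h c i' (Z w) + ln (cell_mass i') else 0.
  have := indE s w; rewrite {2}/s insubT; first exact: Jn.
  move=> Jw E; rewrite (eq_bigr (fun i : 'I_n => ind i w * s i)).
    rewrite E; apply: lse_ge_coord => //.
    by case: (wP (Sub (J w) Jw)).
  by move=> i _; rewrite /s valK.
have : \int[P]_w T w <= \int[nu]_z (lse cell_mass h c z).
  apply: (le_trans (ae_le_Rintegral Ti lZi lZ)).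
  rewrite -lee_fin !RintegralE//.
  have := ZC _ (lse_convex m0 m1 h c); rewrite integral_pushforward//.
rewrite TE /obj; lra.
Qed.

End cell_means.

(** * Probability measures with a density *)

Section density.
Context {R : realType} {dT : measure_display} {T : measurableType dT}.
Variables (nu : probability T R) (f : T -> R).
Hypothesis mf : measurable_fun setT f.
Hypothesis f0 : forall x, 0 <= f x.
Hypothesis f1 : (\int[nu]_x (f x)%:E = 1)%E.

Local Open Scope ereal_scope.

(** The three hypotheses are arguments so that the probability structure can be attached to the
    term. *)
Definition density of measurable_fun setT f & (forall x, (0 <= f x)%R) &
    \int[nu]_x (f x)%:E = 1 := fun B : set T => \int[nu]_(x in B) (f x)%:E.

Let mu := density mf f0 f1.

Let density0 : mu set0 = 0.
Proof. by rewrite /mu /density integral_set0. Qed.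

Let density_ge0 B : 0 <= mu B.
Proof. by apply: integral_ge0 => x _; rewrite lee_fin. Qed.

Let density_sigma_additive : semi_sigma_additive mu.
Proof.
move=> F mF tF mUF; rewrite /mu /density.
rewrite [X in _ --> X](_ : _ = \sum_(n <oo) mu (F n)).
  by apply: is_cvg_ereal_nneg_natsum_cond => k _ _; exact: density_ge0.
rewrite ge0_integral_bigcup//.
  by apply/measurable_funTS/measurable_EFinP.
by move=> x _; rewrite lee_fin.
Qed.

HB.instance Definition _ := isMeasure.Build _ _ _ (density mf f0 f1)
  density0 density_ge0 density_sigma_additive.

HB.instance Definition _ := Measure_isProbability.Build _ _ _
  (density mf f0 f1) f1.

(** The abstract Radon-Nikodym derivative coincides with [f] almost everywhere, so its change of
    variables formula applies. *)
Lemma ge0_integral_density (g : T -> \bar R) :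
  measurable_fun setT g -> (forall x, 0 <= g x) ->
  \int[density mf f0 f1]_x g x = \int[nu]_x (g x * (f x)%:E).
Proof.
move=> mg g0.
have dom : density mf f0 f1 `<< nu.
  move=> N N0 A mA AN; rewrite /= /density.
  apply: null_set_integral => //; last exact: (N0 A mA AN).
  by apply/measurable_funTS/measurable_EFinP.
rewrite -(Radon_Nikodym_SigmaFinite.change_of_variables dom g0 measurableT mg).
have fi : nu.-integrable setT (EFin \o f).
  apply/integrableP; split; first exact/measurable_EFinP.
  under eq_integral do rewrite gee0_abs ?lee_fin//.
  by rewrite /= f1 ltry.
have RNi := Radon_Nikodym_SigmaFinite.f_integrable dom.
have RNE : ae_eq nu setT (EFin \o f) (Radon_Nikodym_SigmaFinite.f (density mf f0 f1) nu).
  apply: integral_ae_eq => //; first exact: measurable_int RNi.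
  by move=> A _ mA; rewrite -Radon_Nikodym_SigmaFinite.f_integral.
apply: ae_eq_integral => //.
- by apply: emeasurable_funM => //; exact: measurable_int RNi.
- by apply: emeasurable_funM => //; exact/measurable_EFinP.
- by apply: filterS RNE => x /(_ Logic.I) /= <-.
Qed.

Lemma Rintegral_density (g : T -> R) : measurable_fun setT g ->
  (\int[density mf f0 f1]_x g x = \int[nu]_x (f x * g x))%R.
Proof.
move=> mg; rewrite /Rintegral; congr fine.
have mgE : measurable_fun setT (EFin \o g) by exact/measurable_EFinP.
rewrite integralE [RHS]integralE ge0_integral_density//; last exact: measurable_funepos.
rewrite ge0_integral_density//; last exact: measurable_funeneg.
congr (_ - _); apply: eq_integral => x _.
- rewrite !funeposE /= -!EFin_max -EFinM; congr EFin.
  by rewrite maxr_pMl// mul0r mulrC.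
- rewrite !funenegE /= -!EFin_max -EFinM; congr EFin.
  by rewrite maxr_pMl// mul0r mulNr mulrC.
Qed.

End density.

Section cell_kernel.
Context {R : realType} {d1 d2 : measure_display}.
Context {T1 : measurableType d1} {T2 : measurableType d2}.
Variables (K : nat -> probability T2 R) (J : T1 -> nat).

Definition cell_kernel of measurable_fun setT J :=
  fun y : T1 => (K (J y) : {measure set T2 -> \bar R}).

Hypothesis mJ : measurable_fun setT J.

Let measurable_cell_kernel U : measurable U ->
  measurable_fun setT (cell_kernel mJ ^~ U).
Proof.
by move=> mU; exact: (measurableT_comp (measurable_fun_nat (fun i => K i U)) mJ).
Qed.

HB.instance Definition _ := isKernel.Build _ _ _ _ _ (cell_kernel mJ)
  measurable_cell_kernel.

Let cell_kernel_prob y : cell_kernel mJ y setT = 1%E.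
Proof. exact: probability_setT. Qed.

HB.instance Definition _ := Kernel_isProbability.Build _ _ _ _ _
  (cell_kernel mJ) cell_kernel_prob.

End cell_kernel.

Lemma coupling_disintegrated {R : realType} {d1 d2 : measure_display}
    {T1 : measurableType d1} {T2 : measurableType d2}
    (alpha : probability T1 R) (nu : probability T2 R) (k : R.-pker T1 ~> T2) :
  (forall B, measurable B -> \int[alpha]_x k x B = nu B)%E ->
  coupling alpha nu (disintegrated alpha k) /\
  disintegration_fst alpha (disintegrated alpha k) k.
Proof.
move=> kB; split; last by move=> A B mA mB; exact: disintegratedX.
split => [A mA|B mB].
- have -> : pushforward (disintegrated alpha k) fst A = disintegrated alpha k (A `*` setT).
    by rewrite /pushforward; congr disintegrated; apply/seteqP; split => z //= [].
  rewrite disintegratedX//; under eq_integral do rewrite prob_kernel.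
  by rewrite integral_cst// mul1e.
- have -> : pushforward (disintegrated alpha k) snd B = disintegrated alpha k (setT `*` B).
    by rewrite /pushforward; congr disintegrated; apply/seteqP; split => z //= [].
  by rewrite disintegratedX// kB.
Qed.

(** On cell [i] the kernel is [nu] with density [r i / a i]. The average over the cells is [nu]
    because the [r i] add up to 1, so the second marginal is exact; only the barycenters carry an
    error. *)
Lemma strassen_kernel {R : realType} {d1 : measure_display}
    {T1 : measurableType d1} {d n : nat} (alpha : probability T1 R)
    (J : T1 -> nat) (mJ : measurable_fun setT J) (Jn : forall y, (J y < n)%N)
    (nu : probability 'rV[R]_d R) (m : 'I_n -> 'rV[R]_d) :
  finite_second_moment nu ->
  (exists C, forall h c, C <= obj nu (cell_mass alpha J (n := n)) m h c) ->
  forall e : R, 0 < e ->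
  exists (pi : probability (T1 * 'rV[R]_d)%type R) (p : R.-pker T1 ~> 'rV[R]_d)
    (b : nat -> 'rV[R]_d),
    [/\ coupling alpha nu pi, disintegration_fst alpha pi p,
      forall y, barycenter (p y) = b (J y) &
      forall (i : 'I_n) j, 0 < cell_mass alpha J i ->
        `|b i ord0 j - m i ord0 j| <= e].
Proof.
move=> nu_P2 bnd e e0; set a := cell_mass alpha J (n := n) in bnd *.
have a0 i : 0 <= a i by exact: cell_mass_ge0.
have a1 : \sum_i a i = 1 by exact: cell_mass_sum.
have [am [am0 _ amP]] := positive_lower_bound a.
(* The factor [am] compensates for the later division by [a i]. *)
have [r [mr r01 r1 ra rE]] := approximate_strassen nu_P2 a0 a1 bnd (mulr_gt0 e0 am0).
have r0 i z : 0 <= r i z by have /andP[] := r01 i z.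
have ri i : nu.-integrable setT (fun z => (r i z)%:E).
  apply: (le_integrable _ _ _ (sqint_integrable (sqint_cst nu 1))) => //.
    exact/measurable_EFinP.
  move=> z _; rewrite !abse_EFin lee_fin normr1 ger0_norm//.
  by have /andP[] := r01 i z.
have raE i : (\int[nu]_z (r i z)%:E = (a i)%:E)%E by rewrite -ra RintegralE.
have zi j : measurable_fun setT (fun z : 'rV[R]_d => z ord0 j) by exact: measurable_coord.
(* Null cells and indices beyond [n] receive [nu], an arbitrary filler. *)
have /choice[K KP] : forall i : nat, exists K : probability 'rV[R]_d R,
    forall i' : 'I_n, i = i' -> 0 < a i' ->
      (forall B, measurable B -> ((a i')%:E * K B = \int[nu]_(z in B) (r i' z)%:E)%E) /\
      forall j, a i' * barycenter K ord0 j = \int[nu]_z (r i' z * z ord0 j).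
  move=> i; have [iN|iN] := ltnP i n; last first.
    by exists nu => i' ii'; move: iN; rewrite ii' leqNgt ltn_ord.
  pose i0 := Ordinal iN; have [ai|ai] := ltP 0 (a i0); last first.
    exists nu => i' ii'; have -> : i' = i0 by apply/val_inj.
    by rewrite ltNge ai.
  pose f z := (a i0)^-1 * r i0 z.
  have mf : measurable_fun setT f by exact: measurable_funM.
  have f0 z : 0 <= f z by rewrite mulr_ge0// invr_ge0 ltW.
  have f1 : (\int[nu]_z (f z)%:E = 1)%E.
    under eq_integral do rewrite EFinM.
    by rewrite integralZl// raE -EFinM mulVf// gt_eqF.
  exists (density mf f0 f1) => i' ii' _.
  have -> : i' = i0 by apply/val_inj.
  split => [B mB|j].
    rewrite /= /density -ge0_integralZl//; last 3 first.
    - by apply/measurable_funTS/measurable_EFinP.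
    - by move=> z _; rewrite lee_fin.
    - by rewrite lee_fin.
    by apply: eq_integral => z _; rewrite -EFinM /f mulrA mulfV ?gt_eqF// mul1r.
  rewrite mxE Rintegral_density//.
  rewrite -RintegralZl//.
    by apply: eq_Rintegral => z _; rewrite /f; field; rewrite gt_eqF.
  apply: sqintM_integrable; last by have /finite_second_momentP := nu_P2; exact.
  apply: sqintZ; apply: (le_sqint (f := cst 1)) => //; last exact: sqint_cst.
  by move=> z; rewrite /cst expr1n exprn_ile1//; have /andP[] := r01 i0 z.
have KB B : measurable B -> (\int[alpha]_y cell_kernel K mJ y B = nu B)%E.
  move=> mB; pose s i := fine (K i B).
  have KfE i : K i B = (s i)%:E by rewrite fineK// fin_num_measure.
  rewrite (eq_integral (fun y => (s (J y))%:E)); last by move=> y _; exact: KfE.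
  rewrite -(RintegralE (sqint_integrable (sqint_step alpha mJ Jn s))).
  rewrite (step_integral alpha mJ Jn) -sumEFin.
  rewrite (eq_bigr (fun i : 'I_n => \int[nu]_(z in B) (r i z)%:E)%E); last first.
    move=> i _; rewrite EFinM -KfE -/(a i).
    have [ai|ai] := ltP 0 (a i); first by have [->] := KP i i erefl ai.
    have ai0 : a i = 0 by apply/eqP; rewrite eq_le ai a0.
    rewrite ai0 mul0e; apply/esym/eqP; rewrite eq_le; apply/andP; split; last first.
      by apply: integral_ge0 => z _; rewrite lee_fin.
    rewrite -[leRHS]/(0%:E) -ai0 -raE; apply: ge0_subset_integral => //.
      exact/measurable_EFinP.
    by move=> z _; rewrite lee_fin.
  rewrite -ge0_integral_sum//; last 2 first.
  - by move=> i; apply/measurable_funTS/measurable_EFinP.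
  - by move=> i z _; rewrite lee_fin.
  under eq_integral do rewrite sumEFin r1.
  by rewrite integral_cst// mul1e.
have [cpl dis] := coupling_disintegrated KB.
exists (disintegrated alpha (cell_kernel K mJ)), (cell_kernel K mJ).
exists (fun i => barycenter (K i)); split => // i j ai.
have [_ /(_ j) Kj] := KP i i erefl ai.
rewrite -(ler_pM2l ai) -[X in X * `|_|](ger0_norm (a0 i)) -normrM mulrBr Kj.
by apply: le_trans (rE i j) _; rewrite mulrC ler_wpM2r ?(ltW e0)// amP.
Qed.

(** * Cells around rational points *)

Section rational_cells.
Context {R : realType} {d : nat}.
Variable rho : R.
Hypothesis rho0 : 0 < rho.

Definition cell_center (i : nat) : 'rV[R]_d :=
  if unpickle i is Some q then map_mx (@ratr R) (q : 'rV[rat]_d) else 0.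

(** The first of [N] balls that contains [y], with the value [N] for the remaining cell outside all
    of them. *)
Fixpoint cell_index (N : nat) (y : 'rV[R]_d) : nat :=
  if N is N'.+1 then
    if (cell_index N' y < N')%N then cell_index N' y
    else if `[< ball (cell_center N') rho y >] then N' else N
  else 0.

Lemma cell_index_le N y : (cell_index N y <= N)%N.
Proof.
by elim: N => [//|N ih] /=; case: ifP => [/ltnW/leq_trans ->//|_]; case: ifP.
Qed.

Lemma cell_index_ball N y : (cell_index N y < N)%N ->
  ball (cell_center (cell_index N y)) rho y.
Proof.
elim: N => [//|N ih] /=; case: ifP => [/ih//|_].
by case: ifP => [/asboolP//|_]; rewrite ltnn.
Qed.

Lemma cell_index_lt N k y : (k < N)%N -> ball (cell_center k) rho y ->
  (cell_index N y < N)%N.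
Proof.
elim: N => [//|N ih]; rewrite ltnS leq_eqVlt => /orP[/eqP->|kN] ky /=.
  by case: ifP => [/leqW//|_]; rewrite asboolT.
by rewrite (ih kN ky) leqW// ih.
Qed.

Lemma cell_index_eventually y : exists N0, forall N, (N0 <= N)%N ->
  (cell_index N y < N)%N.
Proof.
have [q qy] := rat_ball_near y rho0; exists (pickle q).+1 => N qN.
by apply: (cell_index_lt qN); rewrite /cell_center pickleK.
Qed.

Lemma measurable_cell_index N : measurable_fun setT (cell_index N).
Proof.
elim: N => [|N ih] /=; first exact: measurable_cst.
apply: measurable_fun_ifT => //.
  exact: (measurableT_comp (measurable_fun_nat (fun k => (k < N)%N)) ih).
apply: measurable_fun_ifT => //.
apply: (measurable_fun_bool true).
rewrite setTI [X in measurable X](_ : _ = ball (cell_center N) rho).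
  by apply: open_measurable_mx; exact: ball_open.
by apply/seteqP; split => y /=; [move/asboolP|move=> ?; apply/asboolP].
Qed.

(** The remaining cell is represented by 0, so that the squared error there is bounded by
    [enorm y ^+ 2]. *)
Definition cell_point N (i : nat) : 'rV[R]_d :=
  if (i < N)%N then cell_center i else 0.

Lemma cell_point_near N (y : 'rV[R]_d) j :
  (y ord0 j - cell_point N (cell_index N y) ord0 j) ^+ 2 <=
  rho ^+ 2 + (~~ (cell_index N y < N)%N)%:R * enorm y ^+ 2.
Proof.
rewrite /cell_point; case: ifPn => [iN|iN] /=.
  have [_ /(_ ord0 j)] := cell_index_ball iN.
  rewrite /ball /= distrC => /ltW h.
  by rewrite mul0r addr0 -[leLHS]real_normK ?num_real// ler_sqr ?nnegrE// ltW.
rewrite mxE subr0 mul1r enorm2E (bigD1 j)//= addrCA lerDl addr_ge0 ?sqr_ge0//.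
by apply: sumr_ge0 => k _; exact: sqr_ge0.
Qed.

(** Every point is eventually covered by the balls, so dominated convergence sends the second moment
    of the remaining cell to 0. *)
Lemma cell_approximation (nu : probability 'rV[R]_d R) (e : R) :
  finite_second_moment nu -> 0 < e -> exists N,
  (\int[nu]_y ((~~ (cell_index N y < N)%N)%:R * enorm y ^+ 2)%:E <= e%:E)%E.
Proof.
move=> nu_P2 e0.
pose g N (y : 'rV[R]_d) : \bar R := ((~~ (cell_index N y < N)%N)%:R * enorm y ^+ 2)%:E.
have mE : measurable_fun setT (fun y : 'rV[R]_d => enorm y ^+ 2).
  exact: (measurable_enorm2 (f := id)).
have mg N : measurable_fun setT (g N).
  apply/measurable_EFinP/measurable_funM => //.
  exact: (measurableT_comp (measurable_fun_nat (fun k => (~~ (k < N)%N)%:R : R)) (measurable_cell_index N)).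
have g_le N y : (`|g N y| <= (enorm y ^+ 2)%:E)%E.
  have h0 : 0 <= enorm y ^+ 2 by exact: sqr_ge0.
  rewrite abse_EFin lee_fin ger0_norm; last exact: mulr_ge0.
  by apply: ler_piMl => //; case: (cell_index N y < N)%N.
have Ei : nu.-integrable setT (fun y => (enorm y ^+ 2)%:E).
  apply/integrableP; split; first exact/measurable_EFinP.
  by under eq_integral do rewrite gee0_abs ?lee_fin ?sqr_ge0//.
have g_cvg y : g ^~ y @ \oo --> (0 : \bar R).
  have [N0 N0P] := cell_index_eventually y.
  apply: cvg_near_cst; exists N0 => // N /= N0N.
  by rewrite /g N0P// mul0r.
have [_ _] := dominated_convergence measurableT mg (measurable_cst (0 : \bar R))
  (aeW _ (fun y _ => g_cvg y)) Ei (aeW _ (fun y N _ => g_le N y)).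
rewrite integral0 => /fine_cvgP[gfin gc].
have [N1 _ N1P] : \forall N \near \oo, (\int[nu]_y g N y < e%:E)%E.
  near=> N.
  have gN : (\int[nu]_y g N y)%E \is a fin_num by near: N.
  rewrite -(fineK gN) lte_fin; near: N.
  have /cvgrPdist_lt/(_ e e0) := gc; apply: filterS => N.
  by rewrite sub0r normrN; apply: le_lt_trans; exact: ler_norm.
by exists N1; apply/ltW/N1P => /=.
Unshelve. all: by end_near. Qed.

End rational_cells.

(** * Comparison of the two values *)

Section scalar_estimates.
Context {R : realType} {dO : measure_display} {O : measurableType dO}.
Variable P : probability O R.

Lemma sqint_sqr (f : O -> R) : sqint P f ->
  P.-integrable setT (fun w => (f w ^+ 2)%:E).
Proof. by case. Qed.

(** Young's inequality: twice [V * u] is at most [s * V ^+ 2 + s^-1 * u ^+ 2]. *)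
Lemma perturbed_square (V V' : O -> R) (s r : R) : 0 < s ->
  sqint P V -> sqint P V' ->
  {ae P, forall w, `|V' w - V w| <= r} ->
  \int[P]_w (V' w ^+ 2) <= (1 + s) * \int[P]_w (V w ^+ 2) + (1 + s^-1) * r ^+ 2.
Proof.
move=> s0 sV sV' VV'.
have I1 : P.-integrable setT (fun w => ((1 + s) * V w ^+ 2)%:E).
  by have := integrableZl measurableT (1 + s) (sqint_sqr sV).
have I2 : P.-integrable setT (fun w => ((1 + s^-1) * r ^+ 2)%:E).
  exact: (sqint_integrable (sqint_cst P _)).
have -> : (1 + s) * \int[P]_w (V w ^+ 2) + (1 + s^-1) * r ^+ 2 =
    \int[P]_w ((1 + s) * V w ^+ 2 + (1 + s^-1) * r ^+ 2).
  rewrite (RintegralD measurableT I1 I2) RintegralZl//; last exact: sqint_sqr.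
  congr (_ + _); apply: EFin_inj; rewrite RintegralE//.
  by rewrite probability_integral_cst.
apply: ae_le_Rintegral => //.
- exact: sqint_sqr.
- by have := integrableD measurableT I1 I2.
apply: filterS VV' => w; set u := V' w - V w => ur.
have -> : V' w = V w + u by rewrite /u addrC subrK.
have r0 : 0 <= r by exact: le_trans (normr_ge0 u) ur.
have : u ^+ 2 <= r ^+ 2 by rewrite -[u ^+ 2]real_normK ?num_real// ler_sqr ?nnegrE.
have si : 0 < s^-1 by rewrite invr_gt0.
have := sqr_ge0 (s * V w - u).
have E : s * s^-1 = 1 by rewrite mulfV ?gt_eqF.
move=> h1 h2.
have h3 : 0 <= s^-1 * (s * V w - u) ^+ 2 := mulr_ge0 (ltW si) (sqr_ge0 _).
have h4 : s^-1 * (s * V w - u) ^+ 2 = s * V w ^+ 2 - 2 * V w * u + s^-1 * u ^+ 2.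
  by field; rewrite gt_eqF.
have h5 : s^-1 * u ^+ 2 <= s^-1 * r ^+ 2 by rewrite ler_pM2l.
rewrite h4 in h3; lra.
Qed.

Variables (J : O -> nat) (n : nat).
Hypothesis mJ : measurable_fun setT J.
Hypothesis Jn : forall w, (J w < n)%N.

Lemma charged_cells : {ae P, forall w (i : 'I_n), 0 < cell_mass P J i \/ J w <> i}.
Proof.
apply: filter_forall => i; have [i0|i0] := ltP 0 (cell_mass P J i).
  by apply: aeW => w; left.
have ai0 : cell_mass P J i = 0 by apply/eqP; rewrite eq_le i0 cell_mass_ge0.
have := cell_mass0_ae mJ Jn ai0; apply: filterS => w Jw; by right.
Qed.

(* With D := V - W, which is orthogonal to every function of J, and V equal to
   t (Y - q(J)) plus a function of J, this is
   W^2 + t^2 (Y - q(J))^2 - V^2 = (D - t (Y - q(J)))^2 in the mean. *)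
Lemma cell_pythagoras (K : nat) (Y : O -> R) (X : 'I_K -> O -> R)
    (lambda : 'I_K -> R) (t : R) (q : nat -> R) :
  sqint P Y -> (forall k, sqint P (X k)) ->
  \int[P]_w ((t * Y w - (t - 1) * \sum_k lambda k * cell_mean P J (X k) (J w)) ^+ 2) <=
  \int[P]_w ((t * Y w - (t - 1) * \sum_k lambda k * X k w) ^+ 2) +
  t ^+ 2 * \int[P]_w ((Y w - q (J w)) ^+ 2).
Proof.
move=> sY sX; pose m k := cell_mean P J (X k).
pose S i := t * q i - (t - 1) * \sum_k lambda k * m k i.
pose D w := (t - 1) * \sum_k lambda k * (X k w - m k (J w)).
pose V w := t * Y w - (t - 1) * \sum_k lambda k * m k (J w).
pose W w := t * Y w - (t - 1) * \sum_k lambda k * X k w.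
pose U w := Y w - q (J w).
have sm k : sqint P (fun w => m k (J w)) by exact: (sqint_step P mJ Jn (m k)).
have sq : sqint P (fun w => q (J w)) by exact: (sqint_step P mJ Jn q).
have sS : sqint P (fun w => S (J w)) by exact: (sqint_step P mJ Jn S).
have sXm k : sqint P (fun w => X k w - m k (J w)) by exact: sqintB.
have sV : sqint P V.
  by apply: sqintB; [exact: sqintZ|apply: sqintZ; apply: sqint_sum => k; exact: sqintZ].
have sW : sqint P W.
  by apply: sqintB; [exact: sqintZ|apply: sqintZ; apply: sqint_sum => k; exact: sqintZ].
have sU : sqint P U by exact: sqintB.
have sD : sqint P D by apply: sqintZ; apply: sqint_sum => k; exact: sqintZ.
have SD0 : \int[P]_w (S (J w) * D w) = 0.
  have Ik k : P.-integrable setT (fun w => (S (J w) * (X k w - m k (J w)))%:E).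
    exact: sqintM_integrable.
  transitivity (\int[P]_w (\sum_k ((t - 1) * lambda k) * (S (J w) * (X k w - m k (J w))))).
    apply: eq_Rintegral => w _; rewrite /D mulrCA mulr_sumr mulr_sumr.
    by apply: eq_bigr => k _; ring.
  rewrite Rintegral_sum; last first.
    by move=> k; have := integrableZl measurableT ((t - 1) * lambda k) (Ik k).
  apply: big1 => k _; rewrite RintegralZl//; last exact: Ik.
  by rewrite (step_orthogonal mJ Jn S (sX k)) mulr0.
have I1 := sqint_sqr sW.
have I2 : P.-integrable setT (fun w => (t ^+ 2 * U w ^+ 2)%:E).
  by have := integrableZl measurableT (t ^+ 2) (sqint_sqr sU).
have I3 : P.-integrable setT (fun w => (2 * (S (J w) * D w))%:E).
  by have := integrableZl measurableT 2 (sqintM_integrable sS sD).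
have I12 : P.-integrable setT (fun w => (W w ^+ 2 + t ^+ 2 * U w ^+ 2)%:E).
  by have := integrableD measurableT I1 I2.
have -> : \int[P]_w (W w ^+ 2) + t ^+ 2 * \int[P]_w (U w ^+ 2) =
    \int[P]_w (W w ^+ 2 + t ^+ 2 * U w ^+ 2 + 2 * (S (J w) * D w)).
  rewrite (RintegralD measurableT I12 I3) (RintegralD measurableT I1 I2).
  rewrite RintegralZl//; last exact: sqint_sqr.
  by rewrite RintegralZl ?SD0 ?mulr0 ?addr0//; exact: sqintM_integrable.
apply: le_Rintegral => //.
- exact: sqint_sqr.
- by have := integrableD measurableT I12 I3.
move=> w _; rewrite -/(V w).
have WE : W w = V w - D w.
  rewrite /W /V /D; under [X in _ = _ - (t - 1) * X]eq_bigr do rewrite mulrBr.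
  rewrite sumrB; ring.
have VE : V w = t * U w + S (J w) by rewrite /V /U /S; ring.
have := sqr_ge0 (D w - t * U w); rewrite WE VE; lra.
Qed.

End scalar_estimates.

(** * Costs in coordinates, and couplings built from maps *)

Section values_of_maps.
Context {R : realType} {dO : measure_display} {Omega : measurableType dO}.
Variables (P : probability Omega R) (d K : nat) (t : R).
Hypothesis t1 : 1 < t.
Variable lambda : 'I_K -> R.
Hypothesis lambda_gt0 : forall k, 0 < lambda k.
Hypothesis lambda_sum : \sum_(k < K) lambda k = 1.
Variables (nu1 : probability 'rV[R]_d R) (nu0 : 'I_K -> probability 'rV[R]_d R).
Hypothesis nu1_P2 : finite_second_moment nu1.
Hypothesis nu0_P2 : forall k, finite_second_moment (nu0 k).
Variable Y : {mfun Omega >-> 'rV[R]_d}.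
Hypothesis Y_L2 : in_L2 P Y.
Hypothesis Y_law : same_law (distribution P Y) nu1.

Lemma ge0_integral_law (f : 'rV[R]_d -> \bar R) : measurable_fun setT f ->
  (forall y, 0 <= f y)%E -> (\int[nu1]_y f y = \int[P]_w f (Y w))%E.
Proof.
move=> mf f0; rewrite -(ge0_integral_distribution Y mf f0).
by apply: eq_measure_integral => A mA _; exact: esym (Y_law mA).
Qed.

Lemma Q_costE (Z : 'I_K -> {mfun Omega >-> 'rV[R]_d}) :
  Q_cost P t lambda Y Z = ((2^-1)%:E * \sum_j \int[P]_w
    ((t * Y w ord0 j - (t - 1) * \sum_k lambda k * Z k w ord0 j) ^+ 2)%:E)%E.
Proof.
have m j : (fun w => (t *: Y w - (t - 1) *: \sum_(k < K) lambda k *: Z k w) ord0 j) =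
    (fun w => t * Y w ord0 j - (t - 1) * \sum_k lambda k * Z k w ord0 j).
  apply/funext => w; rewrite !mxE summxE.
  by congr (_ - _ * _); apply: eq_bigr => k _; rewrite mxE.
rewrite /Q_cost L2norm_sqrE integral_enorm2E; last first.
  apply: measurable_fun_row => j; rewrite m.
  apply: measurable_funB; first by apply: measurable_funM => //; exact: measurable_rowP.
  apply: measurable_funM => //; apply: measurable_sum => k.
  by apply: measurable_funM => //; exact: measurable_rowP.
congr (_ * _)%E; apply: eq_bigr => j _; apply: eq_integral => w _.
by rewrite -(congr1 (fun f => f w) (m j)).
Qed.

Lemma barycentric_costE (b : 'I_K -> 'rV[R]_d -> 'rV[R]_d) :
  (forall k, measurable_fun setT (b k)) ->
  (\int[nu1]_y ((enorm (t *: y - (t - 1) *: \sum_(k < K) lambda k *: b k y)) ^+ 2)%:E =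
  \sum_j \int[P]_w
    ((t * Y w ord0 j - (t - 1) * \sum_k lambda k * b k (Y w) ord0 j) ^+ 2)%:E)%E.
Proof.
move=> mb.
have m j : (fun y : 'rV[R]_d => (t *: y - (t - 1) *: \sum_(k < K) lambda k *: b k y) ord0 j) =
    (fun y : 'rV[R]_d => t * y ord0 j - (t - 1) * \sum_k lambda k * b k y ord0 j).
  apply/funext => w; rewrite !mxE summxE.
  by congr (_ - _ * _); apply: eq_bigr => k _; rewrite mxE.
have mm j : measurable_fun setT (fun y : 'rV[R]_d => t * y ord0 j - (t - 1) * \sum_k lambda k * b k y ord0 j).
  apply: measurable_funB; first by apply: measurable_funM => //; exact: measurable_coord.
  apply: measurable_funM => //; apply: measurable_sum => k.
  by apply: measurable_funM => //; exact: measurable_rowP.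
rewrite integral_enorm2E; last by apply: measurable_fun_row => j; rewrite m.
apply: eq_bigr => j _.
rewrite -(ge0_integral_law (f := fun y => ((t * y ord0 j - (t - 1) * \sum_k lambda k * b k y ord0 j) ^+ 2)%:E)).
- by apply: eq_integral => y _; rewrite -(congr1 (fun f => f y) (m j)).
- by apply/measurable_EFinP/measurable_funX.
- by move=> y; rewrite lee_fin sqr_ge0.
Qed.

(** In each coordinate, [W] is the residual of [Z], [V] that of the cell means and [V'] that of the
    barycenters of a true coupling. The passage from [W] to [V] is paid by [cell_pythagoras], that
    from [V] to [V'] by [perturbed_square]. *)
Lemma Q'_value_le_cost (Z : 'I_K -> {mfun Omega >-> 'rV[R]_d}) :
  Q_admissible P nu0 Z -> (Q'_value t lambda nu1 nu0 <= Q_cost P t lambda Y Z)%E.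
Proof.
move=> Zadm.
have sY j : sqint P (fun w => Y w ord0 j) by have /in_L2P := Y_L2; exact.
have sZ k j : sqint P (fun w => Z k w ord0 j) by have [/in_L2P+ _] := Zadm k; exact.
pose W j w := t * Y w ord0 j - (t - 1) * \sum_k lambda k * Z k w ord0 j.
have sW j : sqint P (W j).
  by apply: sqintB; [exact: sqintZ|apply: sqintZ; apply: sqint_sum => k; exact: sqintZ].
pose c := \sum_j \int[P]_w (W j w ^+ 2).
have c0 : 0 <= c by apply: sumr_ge0 => j _; apply: Rintegral_ge0 => w _; exact: sqr_ge0.
have -> : Q_cost P t lambda Y Z = (2^-1 * c)%:E.
  rewrite Q_costE EFinM -sumEFin; congr (_ * _)%E; apply: eq_bigr => j _.
  by rewrite RintegralE//; exact: (sqint_sqr (sW j)).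
apply/lee_addgt0Pr => e e0.
(* The sum over the coordinates exceeds [c] by at most [s * H]; with the factor one half in the
   cost, [s * H <= 2 * e] is what is needed. *)
pose H := c + 4 * d%:R * t ^+ 2 + 2 * d%:R * (t - 1) ^+ 2.
have H0 : 0 <= H.
  have [h1 h2] := (sqr_ge0 t, sqr_ge0 (t - 1)).
  by apply: addr_ge0; [apply: addr_ge0 => //|]; apply: mulr_ge0 => //; exact: mulr_ge0.
(* One parameter serves as cell radius, as second moment of the remaining cell and as weight in
   Young's inequality. Barycenters are needed up to [s * s], because Young's inequality divides
   their squared error by [s]. *)
pose s := Num.min 1 (2 * e / (H + 1)).
have s0 : 0 < s by rewrite lt_min ltr01 divr_gt0 ?mulr_gt0// ltr_wpDl.
have s1 : s <= 1 by rewrite ge_min lexx.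
have sH : s * H <= 2 * e.
  apply: (@le_trans _ _ (s * (H + 1))); first by rewrite ler_pM2l// lerDl.
  by rewrite -ler_pdivlMr ?ltr_wpDl// ge_min lexx orbT.
have [N NP] := cell_approximation s0 nu1_P2 s0.
pose J0 := cell_index s N : 'rV[R]_d -> nat.
have mJ0 : measurable_fun setT J0 by exact: measurable_cell_index.
(* One cell more than balls, for the remaining cell of index [N]. *)
have J0n y : (J0 y < N.+1)%N by rewrite ltnS cell_index_le.
pose J w := J0 (Y w).
have mJ : measurable_fun setT J by exact: (measurableT_comp mJ0).
have Jn w : (J w < N.+1)%N by exact: J0n.
pose a := cell_mass P J (n := N.+1).
(* The dual bound is proved with masses under [P], while the kernel lives over [nu1]; the law of [Y]
   identifies the two. *)
have aE : cell_mass nu1 J0 (n := N.+1) = a.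
  apply/funext => i; rewrite /a /cell_mass /Rintegral; congr fine.
  rewrite (ge0_integral_law (f := fun y => (J0 y == i)%:R%:E))//.
  apply/measurable_EFinP.
  exact: (measurableT_comp (measurable_fun_nat (fun k => (k == i)%:R : R)) mJ0).
pose m k (i : nat) : 'rV[R]_d := \row_j cell_mean P J (fun w => Z k w ord0 j) i.
have /choice[pi /choice[p /choice[b bP]]] (k : 'I_K) := strassen_kernel mJ0 J0n (nu0_P2 k)
  (let: conj _ Zk := Zadm k in
   eq_ind_r (fun u => exists C, forall h c, C <= obj (nu0 k) u (fun i : 'I_N.+1 => m k i) h c)
    (convex_order_obj_bounded mJ Jn (nu0_P2 k) (sZ k) Zk) aE) (mulr_gt0 s0 s0).
have cpl k : coupling nu1 (nu0 k) (pi k) by have [] := bP k.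
have dis k : disintegration_fst nu1 (pi k) (p k) by have [] := bP k.
have pb k y : barycenter (p k y) = b k (J0 y) by have [] := bP k.
pose V' j w := t * Y w ord0 j - (t - 1) * \sum_k lambda k * b k (J w) ord0 j.
pose V j w := t * Y w ord0 j - (t - 1) * \sum_k lambda k * cell_mean P J (fun w => Z k w ord0 j) (J w).
have sb k j : sqint P (fun w => b k (J w) ord0 j) by exact: (sqint_step P mJ Jn (fun i => b k i ord0 j)).
have sm k j : sqint P (fun w => cell_mean P J (fun w => Z k w ord0 j) (J w)).
  exact: (sqint_step P mJ Jn).
have sV' j : sqint P (V' j).
  by apply: sqintB; [exact: sqintZ|apply: sqintZ; apply: sqint_sum => k; exact: sqintZ].
have sV j : sqint P (V j).
  by apply: sqintB; [exact: sqintZ|apply: sqintZ; apply: sqint_sum => k; exact: sqintZ].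
have : (Q'_value t lambda nu1 nu0 <= (2^-1 * \sum_j \int[P]_w (V' j w ^+ 2))%:E)%E.
  apply: ereal_inf_lbound; exists pi; split => //; exists p; split => //.
  rewrite (barycentric_costE (b := fun k y => barycenter (p k y))); last first.
    by move=> k; exact: kernel_measurable_barycenter.
  rewrite EFinM -sumEFin; congr (_ * _)%E; apply: eq_bigr => j _.
  rewrite RintegralE; last exact: (sqint_sqr (sV' j)).
  apply: eq_integral => w _; congr (_ ^+ 2)%:E; rewrite /V'.
  by congr (_ - _ * _); apply: eq_bigr => k _; rewrite pb.
move/le_trans; apply; rewrite -EFinD lee_fin.
(* Almost surely [J w] is a cell of positive mass, where the barycenters are controlled; the weights
   [lambda] have sum 1 and only average the errors. *)
have V'V j : {ae P, forall w, `|V' j w - V j w| <= (t - 1) * s ^+ 2}.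
  have := charged_cells P mJ Jn.
  apply: filterS => w wP.
  have aJ : 0 < a (Ordinal (Jn w)) by case: (wP (Ordinal (Jn w))).
  have -> : V' j w - V j w = (t - 1) * \sum_k lambda k * (m k (J w) ord0 j - b k (J w) ord0 j).
    under [in RHS]eq_bigr do rewrite mxE mulrBr.
    by rewrite sumrB /V' /V; ring.
  have t10 : 0 <= t - 1 by rewrite subr_ge0 ltW.
  rewrite normrM (ger0_norm t10); apply: ler_wpM2l => //.
  apply: le_trans (ler_norm_sum _ _ _) _.
  rewrite -[leRHS]mul1r -lambda_sum mulr_suml; apply: ler_sum => k _.
  rewrite normrM (ger0_norm (ltW (lambda_gt0 k))) ler_pM2l// distrC expr2.
  have [_ _ _ /(_ (Ordinal (Jn w)) j)] := bP k.
  by rewrite aE; apply.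
have Vb j : \int[P]_w (V j w ^+ 2) <= \int[P]_w (W j w ^+ 2) + t ^+ 2 * (s + s).
  (* Inside the balls [Y] is within [s] of its cell point, and the remaining cell contributes at
     most [s], so the mean square is at most [s ^+ 2 + s]. *)
  pose q i := cell_point N i ord0 j : R.
  have /le_trans := cell_pythagoras mJ Jn lambda t q (sY j) (fun k => sZ k j).
  apply; rewrite lerD2l; apply: ler_wpM2l; first exact: sqr_ge0.
  rewrite -lee_fin RintegralE; last first.
    by apply: sqint_sqr; apply: sqintB => //; exact: (sqint_step P mJ Jn q).
  pose T (y : 'rV[R]_d) : R := (~~ (cell_index s N y < N)%N)%:R * enorm y ^+ 2.
  have T0 y : 0 <= T y by apply: mulr_ge0 => //; exact: sqr_ge0.
  have mT : measurable_fun setT T.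
    apply: measurable_funM.
      exact: (measurableT_comp (measurable_fun_nat (fun k => (~~ (k < N)%N)%:R : R)) mJ0).
    exact: (measurable_enorm2 (f := id)).
  apply: (@le_trans _ _ (\int[nu1]_y (s ^+ 2 + T y)%:E)%E).
    rewrite ge0_integral_law; last first.
    - by move=> y; rewrite lee_fin; apply: addr_ge0 => //; exact: sqr_ge0.
    - by apply/measurable_EFinP/measurable_funD.
    apply: ge0_le_integral => //.
    - by move=> w _; rewrite lee_fin sqr_ge0.
    - apply/measurable_EFinP/measurable_funX/measurable_funB; first by case: (sY j).
      by case: (sqint_step P mJ Jn q).
    - apply/measurable_EFinP/measurable_funD => //.
      exact: (measurableT_comp mT).
    - by move=> w _; rewrite lee_fin cell_point_near// ltW.
  under eq_integral do rewrite EFinD.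
  rewrite ge0_integralD//; last 3 first.
  - by move=> y _; rewrite lee_fin sqr_ge0.
  - by move=> y _; rewrite lee_fin.
  - exact/measurable_EFinP.
  rewrite probability_integral_cst EFinD; apply: leeD => //.
  by rewrite lee_fin expr2 ler_piMl// ltW.
have Wj j : \int[P]_w (V' j w ^+ 2) <=
    (1 + s) * \int[P]_w (W j w ^+ 2) + s * (4 * t ^+ 2 + 2 * (t - 1) ^+ 2).
  apply: le_trans (perturbed_square s0 (sV j) (sV' j) (V'V j)) _.
  have h1 : (1 + s) * \int[P]_w (V j w ^+ 2) <=
      (1 + s) * (\int[P]_w (W j w ^+ 2) + t ^+ 2 * (s + s)).
    by apply: ler_wpM2l => //; apply: addr_ge0 => //; exact: ltW.
  have h2 : (1 + s^-1) * ((t - 1) * s ^+ 2) ^+ 2 = (t - 1) ^+ 2 * s * (s * s ^+ 2 + s ^+ 2).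
    by field; rewrite gt_eqF.
  have ss : s ^+ 2 <= 1 by rewrite expr_le1// ltW.
  have sss : s * s ^+ 2 <= 1 by apply: mulr_ile1 => //; [exact: ltW|exact: sqr_ge0].
  have h3 : (t - 1) ^+ 2 * s * (s * s ^+ 2 + s ^+ 2) <= (t - 1) ^+ 2 * s * 2.
    apply: ler_wpM2l; first by apply: mulr_ge0; [exact: sqr_ge0|exact: ltW].
    by have := lerD sss ss.
  have h4 : t ^+ 2 * s * s <= t ^+ 2 * s * 1.
    by apply: ler_wpM2l => //; apply: mulr_ge0; [exact: sqr_ge0|exact: ltW].
  rewrite h2; lra.
have : \sum_j \int[P]_w (V' j w ^+ 2) <= c + s * H.
  apply: le_trans (ler_sum _ (fun j _ => Wj j)) _.
  rewrite big_split/= -mulr_sumr -/c sumr_const card_ord -mulr_natr le_eqVlt.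
  by apply/orP; left; apply/eqP; rewrite /H; ring.
lra.
Qed.

End values_of_maps.

(** * Continuous test functions and gluing *)

Section continuous_test_functions.
Context {R : realType} {d : nat}.
Local Notation V := 'rV[R]_d.

(** An open set of the product is a countable union of products of basic balls, hence lies in the
    product sigma-algebra. *)
Lemma continuous_measurable_prod (f : V * V -> R) :
  continuous f -> measurable_fun setT f.
Proof.
move=> cf; apply: (measurability _ (RGenOInfty.measurableE R)).
move=> _ [_ [a ->] <-]; rewrite setTI.
set U := f @^-1` _.
have oU : open U.
  have -> : U = f @^-1` [set x | a < x].
    by apply/seteqP; split => x; rewrite /U /= in_itv/= andbT.
  by apply: open_comp => // x _; exact: cf.
pose b n := @rat_ball R d n.
have mb n : measurable (b n).
  rewrite /b /rat_ball; case: unpickle => [[q k]|//].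
  by apply: open_measurable_mx; exact: ball_open.
have -> : U = \bigcup_i \bigcup_(j in [set j | b i `*` b j `<=` U]) (b i `*` b j).
  apply/seteqP; split => [z Uz|z [i _ [j /= ijU]]]; last exact: ijU.
  have /nbhs_ballP[e /= e0 eU] : nbhs z U by exact: open_nbhs_nbhs.
  have near (x : V) : exists2 n, b n `<=` ball x e & b n x.
    have : ball x e x by exact: ballxx.
    by rewrite [X in X x](open_rat_ballE (ball_open x e)) => -[n nx xn]; exists n.
  have [i iz zi] := near z.1; have [j jz zj] := near z.2.
  by exists i => //; exists j => // w [/iz w1 /jz w2]; exact: eU.
apply: bigcup_measurable => i _; apply: bigcup_measurable => j _.
exact: measurableX.
Qed.

(** The approximants are [n] times the distance to the complement, cut off at 1. *)
Lemma open_indicator_cvg (U : set V) : open U ->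
  exists phi : nat -> V -> R, [/\ forall n, continuous (phi n),
    forall n x, 0 <= phi n x <= 1 &
    forall x, phi ^~ x @ \oo --> (\1_U x : R)].
Proof.
(* An empty complement is set apart, as the distance to it is infinite and [fine] would send it to
   0. *)
move=> oU; have [UT|/set0P[a Ua]] := eqVneq (~` U) set0.
  exists (fun _ _ => 1); split => [n|n x|x]; first exact: cst_continuous.
    by rewrite ler01 lexx.
  rewrite indicE mem_set; first exact: cvg_cst.
  by apply: contrapT => Ux; have : (~` U) x by []; rewrite UT.
pose D x : R := fine (edist_inf (~` U) x).
have Dfin x : edist_inf (~` U) x \is a fin_num.
  rewrite ge0_fin_numE ?edist_inf_ge0//.
  apply: le_lt_trans (ereal_inf_lbound _) _; first by exists a.
  rewrite -ge0_fin_numE ?edist_ge0//; apply/edist_finP.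
  exists (`|x - a| + 1); first by rewrite ltr_wpDl.
  by rewrite -ball_normE /= ltrDl.
have cD : continuous D.
  move=> x; have : edist_inf (~` U) y @[y --> x] --> (D x)%:E.
    by rewrite /D fineK//; exact: edist_inf_continuous.
  by move=> /fine_cvg.
have D0 x : 0 <= D x by rewrite fine_ge0// edist_inf_ge0.
exists (fun n x => Num.min 1 (n%:R * D x)); split.
- move=> n x; have c1 : {for x, continuous (cst 1 : V -> R)} by exact: cst_continuous.
  have cn : {for x, continuous (fun x => n%:R * D x)}.
    by apply: continuousM; [exact: cst_continuous|exact: cD].
  exact: (continuous_min c1 cn).
- by move=> n x; rewrite le_min ler01 mulr_ge0//= ge_min lexx.
move=> x; rewrite indicE; have [Ux|Ux] := pselect (U x); last first.
  rewrite memNset//.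
  under eq_fun do rewrite /D edist_inf0// fine0 mulr0 min_r//.
  exact: cvg_cst.
rewrite mem_set//.
have /nbhs_ballP[e /= e0 eU] : nbhs x U by exact: open_nbhs_nbhs.
have De : e <= D x.
  rewrite -lee_fin fineK//; apply: le_ereal_inf_tmp => _ [y Uy <-].
  rewrite leNgt; apply/negP => /(@edist_lt_ball R _ _ (x, y)) /= /eU.
  exact: Uy.
apply: cvg_near_cst; have := @near_infty_natSinv_lt R (PosNum e0).
move=> [N _ NP]; exists N.+1 => // n /= Nn.
rewrite min_l//; case: n Nn => // n; rewrite ltnS => /NP /= h.
rewrite mulrC -ler_pdivrMr// mul1r.
by apply: le_trans De; exact: ltW.
Qed.

Lemma open_prod_eq (mu nu : probability (V * V)%type R) :
  (forall f : V * V -> R, continuous f -> bounded_fun f ->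
    (\int[mu]_z (f z)%:E = \int[nu]_z (f z)%:E)%E) ->
  forall A B : set V, open A -> open B -> mu (A `*` B) = nu (A `*` B).
Proof.
move=> munu A B oA oB.
have [f [cf f01 fA]] := open_indicator_cvg oA.
have [g [cg g01 gB]] := open_indicator_cvg oB.
pose h n (z : V * V) := f n z.1 * g n z.2.
have ch n : continuous (h n).
  move=> z; apply: continuousM.
    by apply: continuous_comp; [exact: cvg_fst|exact: cf].
  by apply: continuous_comp; [exact: cvg_snd|exact: cg].
have h01 n z : 0 <= h n z <= 1.
  have /andP[a0 a1] := f01 n z.1; have /andP[b0 b1] := g01 n z.2.
  by rewrite mulr_ge0//= mulr_ile1.
have bh n : bounded_fun (h n).
  exists 1; split; first exact: num_real.
  move=> M M1 z _; have /andP[h0 h1] := h01 n z.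
  by rewrite /= ger0_norm//; apply: le_trans h1 _; exact: ltW.
have mh n : measurable_fun setT (EFin \o h n).
  by apply/measurable_EFinP; exact: continuous_measurable_prod.
have mAB : measurable (A `*` B) by apply: measurableX; exact: open_measurable_mx.
have lim (m : probability (V * V)%type R) :
    (\int[m]_z (h n z)%:E @[n --> \oo] --> m (A `*` B))%E.
  have hc z : (EFin \o h n) z @[n --> \oo] --> (\1_(A `*` B) z)%:E.
    rewrite (_ : \1_(A `*` B) z = \1_A z.1 * \1_B z.2); last first.
      by rewrite !indicE in_setX -natrM mulnb.
    apply: cvg_EFin; first by apply: nearW.
    rewrite (_ : _ \o _ = fun n => h n z)//.
    by apply: cvgM.
  have i1 : m.-integrable setT (cst 1%E : V * V -> \bar R).
    exact: finite_measure_integrable_cst.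
  have hle n z : (`|(EFin \o h n) z| <= cst 1 z)%E.
    by have /andP[h0 h1] := h01 n z; rewrite /= lee_fin ger0_norm.
  have [_ _] := dominated_convergence measurableT mh
    (iffRL (measurable_EFinP _ _) (measurable_indic mAB)) (aeW _ (fun z _ => hc z)) i1
    (aeW _ (fun z n _ => hle n z)).
  by rewrite integral_indic// setIT.
have := lim mu; under eq_fun do rewrite munu//.
move=> /(cvg_lim (@ereal_hausdorff R)) <-.
exact: (cvg_lim (@ereal_hausdorff R) (lim nu)).
Qed.

(** Bounded continuous functions determine open rectangles; these extend to measurable rectangles
    one factor at a time, with the other factor frozen in [D]. *)
Lemma continuous_unique (mu nu : probability (V * V)%type R) :
  (forall f : V * V -> R, continuous f -> bounded_fun f ->
    (\int[mu]_z (f z)%:E = \int[nu]_z (f z)%:E)%E) ->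
  forall C, measurable C -> mu C = nu C.
Proof.
move=> /open_prod_eq munu.
have uniq (m1 m2 : {measure set V -> \bar R}) : (m1 setT < +oo)%E ->
    (forall A, open A -> m1 A = m2 A) -> forall A, measurable A -> m1 A = m2 A.
  move=> m1T m12 A mA.
  apply: (@measure_unique _ R V [set A : set V | open A] (fun=> setT)) => //.
  - exact: openI.
  - by move=> n; exact: openT.
  - by rewrite bigcup_const.
have step (f : V * V -> V) (mf : measurable_fun setT f) (D : set (V * V)) (mD : measurable D) :
    (forall A, open A -> mu (f @^-1` A `&` D) = nu (f @^-1` A `&` D)) ->
    forall A, measurable A -> mu (f @^-1` A `&` D) = nu (f @^-1` A `&` D).
  move=> AD A mA.
  pose S (m : probability (V * V)%type R) : {measure set V -> \bar R} :=
    measure_function_pushforward__canonical__measure_function_Measure (mrestr m mD) mf.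
  apply: (uniq (S mu) (S nu)) => //.
  apply: le_lt_trans (ltry 1%R); apply: probability_le1.
  by rewrite preimage_setT setTI.
have AsB (A B : set V) : A `*` B = fst @^-1` A `&` (setT `*` B).
  by apply/seteqP; split => z /= [] //= ? [].
have BsA (A B : set V) : A `*` B = snd @^-1` B `&` (A `*` setT).
  by apply/seteqP; split => z /= [] //= ? [].
apply: probability_prod_unique; first exact: le_lt_trans (probability_le1 mu measurableT) (ltry _).
move=> A B mA mB; rewrite BsA; apply: (step) => //; first exact: measurableX.
move=> {mB}B oB; rewrite -BsA AsB; apply: (step) => //.
  by apply: measurableX => //; exact: open_measurable_mx.
by move=> {mA}A oA; rewrite -AsB; exact: munu.
Qed.

End continuous_test_functions.

Section disintegration_snd.
Context {R : realType} {d1 d2 : measure_display}.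
Context {T1 : measurableType d1} {T2 : measurableType d2}.
Variables (beta : probability T2 R) (pi : probability (T1 * T2)%type R).
Variable k : R.-pker T2 ~> T1.
Hypothesis pik : disintegration_snd beta pi k.

Let swap (z : T1 * T2) : T2 * T1 := (z.2, z.1).

Let mswap : measurable_fun setT swap.
Proof. exact: measurable_fun_pair. Qed.

HB.instance Definition _ := isMeasurableFun.Build _ _ _ _ swap mswap.

Lemma integral_disintegration_snd (f : T1 * T2 -> \bar R) :
  pi.-integrable setT f ->
  (\int[pi]_z f z = \int[beta]_y \int[k y]_x f (x, y))%E.
Proof.
move=> fi; have mf := measurable_int _ fi.
pose pi' : probability (T2 * T1)%type R := distribution pi swap.
have dis : disintegration_fst beta pi' k.
  move=> A B mA mB; rewrite -(pik mB mA); congr (pi _).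
  by apply/seteqP; split => -[x y] /= [].
have mfs : measurable_fun setT (fun z => f (z.2, z.1)) by apply: (measurableT_comp mf); exact: measurable_fun_pair.
have fsK : (fun z => f (z.2, z.1)) \o swap = f by apply/funext => -[].
have pfi : pi.-integrable setT ((fun z => f (z.2, z.1)) \o swap) by rewrite fsK.
have := @integral_distribution _ _ _ _ _ pi swap (fun z => f (z.2, z.1)) mfs pfi.
rewrite fsK => <-.
rewrite (@integral_disintegration _ _ _ _ _ beta pi' k dis (fun z => f (z.2, z.1)))//.
exact: (integrable_pushforward mswap mfs).
Qed.

End disintegration_snd.

Section kernel_of_fst.
Context {R : realType} {d1 d2 d3 : measure_display}.
Context {T1 : measurableType d1} {T2 : measurableType d2} {T3 : measurableType d3}.
Variable k : R.-pker T1 ~> T2.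

(** An idle second variable, so that an integral against [k x] is measurable jointly in [x] and a
    parameter of the integrand. *)
Definition kernel_of_fst (x : T1 * T3) : {measure set T2 -> \bar R} := k x.1.

Let measurable_kernel_of_fst U : measurable U ->
  measurable_fun setT (kernel_of_fst ^~ U).
Proof. by move=> mU; apply: (measurableT_comp (measurable_kernel k U mU) measurable_fst). Qed.

HB.instance Definition _ := isKernel.Build _ _ _ _ _ kernel_of_fst
  measurable_kernel_of_fst.

Let kernel_of_fst_prob x : kernel_of_fst x setT = 1%E.
Proof. exact: prob_kernel. Qed.

HB.instance Definition _ := Kernel_isProbability.Build _ _ _ _ _ kernel_of_fst
  kernel_of_fst_prob.

End kernel_of_fst.

Lemma bounded_integrable {R : realType} {dT : measure_display}
    {T : measurableType dT} (P : probability T R) (f : T -> R) (M : R) :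
  measurable_fun setT f -> (forall x, `|f x| <= M) ->
  P.-integrable setT (EFin \o f).
Proof.
move=> mf fM; apply: (le_integrable _ _ _ (finite_measure_integrable_cst P M measurableT)) => //.
  exact/measurable_EFinP.
by move=> x _ /=; rewrite lee_fin; apply: le_trans (fM x) (ler_norm _).
Qed.

(** * Gluing along the map [Y] *)

Section gluing.
Context {R : realType} {dO : measure_display} {Omega : measurableType dO}.
Context {d : nat}.
Variables (P : probability Omega R) (nu1 : probability 'rV[R]_d R).
Variable Y : {mfun Omega >-> 'rV[R]_d}.
Variables (gamma : probability (Omega * 'rV[R]_d)%type R).
Variable g : R.-pker Omega ~> 'rV[R]_d.
Hypothesis gammag : disintegration_fst P gamma g.
Variable e : R.-pker 'rV[R]_d ~> Omega.
Hypothesis Ye : disintegration_snd nu1 (distribution P (id_pair Y)) e.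

(** With [F] the inner integral against [g], both sides are the integral of [F] under the law of
    [id_pair Y]: one through the graph of [Y], the other through its disintegration over [nu1]. *)
Lemma glued_coupling_distribution :
  glued_coupling nu1 e g (distribution gamma (map_fst Y)).
Proof.
move=> f cf bf; have mf := continuous_measurable_prod cf.
have [M fM] : exists M, forall z, `|f z| <= M.
  have [M0 [_ MP]] := bf; exists (M0 + 1) => z.
  by apply: (MP (M0 + 1)) => //; rewrite ltrDl.
have i1 : gamma.-integrable setT ((fun z => (f z)%:E) \o map_fst Y).
  apply: (@bounded_integrable _ _ _ gamma (f \o map_fst Y) M) => [|z]; last exact: fM.
  by apply: measurableT_comp.
rewrite integral_distribution//; last exact/measurable_EFinP.
rewrite (integral_disintegration gammag i1).
pose F (x : Omega * 'rV[R]_d) := (\int[g x.1]_z (f (x.2, z))%:E)%E.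
have mfh : measurable_fun setT (fun u : (Omega * 'rV[R]_d) * 'rV[R]_d => (f (u.1.2, u.2))%:E).
  apply/measurable_EFinP/(measurableT_comp mf).
  apply: measurable_fun_pair => //.
  exact: (measurableT_comp measurable_snd measurable_fst).
have mF : measurable_fun setT F.
  exact: (measurable_disintegration (kernel_of_fst g : R.-pker _ ~> _) mfh).
have FM x : (`|F x| <= M%:E)%E.
  apply: le_trans (le_abse_integral _ measurableT _) _.
    apply/measurable_EFinP/(measurableT_comp mf).
    by apply: measurable_fun_pair.
  have -> : (M%:E = \int[g x.1]_z M%:E)%E.
    by rewrite integral_cst//= prob_kernel mule1.
  apply: ge0_le_integral => //.
  - apply/measurable_EFinP/measurableT_comp => //; apply/(measurableT_comp mf).
    by apply: measurable_fun_pair.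
  - by move=> z _; rewrite lee_fin.
pose Q := distribution P (id_pair Y).
have QF (m : probability _ R) : m.-integrable setT F.
  apply: (le_integrable _ _ _ (finite_measure_integrable_cst m M measurableT)) => //.
  move=> x _ /=; apply: le_trans (FM x) _.
  by rewrite lee_fin ler_norm.
have -> : (\int[nu1]_y \int[e y]_w \int[g w]_z (f (y, z))%:E =
  \int[nu1]_y \int[e y]_w F (w, y))%E by [].
rewrite -(integral_disintegration_snd Ye (QF Q)) integral_distribution//.
have mFY : measurable_fun setT (F \o id_pair Y) by apply: measurableT_comp.
apply: (le_integrable _ _ _ (finite_measure_integrable_cst P M measurableT)) => //.
move=> x _ /=; apply: le_trans (FM _) _.
by rewrite lee_fin ler_norm.
Qed.

End gluing.

(** Stated without integrability, since convex test functions may have infinite integrals. *)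
Lemma integral_distribution_measurable {R : realType} {d1 d2 : measure_display}
    {T1 : measurableType d1} {T2 : measurableType d2} (P : probability T1 R)
    (X : {mfun T1 >-> T2}) (f : T2 -> \bar R) : measurable_fun setT f ->
  (\int[distribution P X]_y f y = \int[P]_x f (X x))%E.
Proof.
move=> mf; rewrite integralE [RHS]integralE.
rewrite (ge0_integral_distribution X (measurable_funepos mf))//.
rewrite (ge0_integral_distribution X (measurable_funeneg mf))//.
by rewrite -funepos_comp -funeneg_comp.
Qed.

Section projections.
Context {R : realType} {dO : measure_display} {O : measurableType dO}.
Variable P : probability O R.

(** The residual [V] is orthogonal to each [m k - X k], hence to the difference of the two
    residuals, so the other square exceeds [V ^+ 2] in the mean by that of the difference. *)
Lemma orthogonal_le (K : nat) (Y : O -> R) (m X : 'I_K -> O -> R)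
    (lambda : 'I_K -> R) (t : R) (V := fun w => t * Y w - (t - 1) * \sum_k lambda k * m k w) :
  sqint P Y -> (forall k, sqint P (m k)) -> (forall k, sqint P (X k)) ->
  (forall k, \int[P]_w (V w * m k w) = \int[P]_w (V w * X k w)) ->
  (\int[P]_w (V w ^+ 2)%:E <=
   \int[P]_w ((t * Y w - (t - 1) * \sum_k lambda k * X k w) ^+ 2)%:E)%E.
Proof.
move=> sY sm sX mX; pose W w := t * Y w - (t - 1) * \sum_k lambda k * X k w.
have sV : sqint P V.
  by apply: sqintB; [exact: sqintZ|apply: sqintZ; apply: sqint_sum => k; exact: sqintZ].
have sW : sqint P W.
  by apply: sqintB; [exact: sqintZ|apply: sqintZ; apply: sqint_sum => k; exact: sqintZ].
rewrite -(RintegralE (sqint_sqr sV)) -(RintegralE (sqint_sqr sW)) lee_fin.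
have sD k : sqint P (fun w => m k w - X k w) by exact: sqintB.
have VD k : \int[P]_w (V w * (m k w - X k w)) = 0.
  under eq_Rintegral do rewrite mulrBr.
  rewrite (RintegralB measurableT (sqintM_integrable sV (sm k)) (sqintM_integrable sV (sX k))).
  by rewrite mX subrr.
have Ik k : P.-integrable setT (fun w => ((2 * (t - 1) * lambda k) * (V w * (m k w - X k w)))%:E).
  by have := integrableZl measurableT (2 * (t - 1) * lambda k) (sqintM_integrable sV (sD k)).
have VW0 : \int[P]_w (\sum_k (2 * (t - 1) * lambda k) * (V w * (m k w - X k w))) = 0.
  rewrite Rintegral_sum//; apply: big1 => k _.
  by rewrite RintegralZl ?VD ?mulr0//; exact: sqintM_integrable.
have Is : P.-integrable setT (fun w => (\sum_k (2 * (t - 1) * lambda k) * (V w * (m k w - X k w)))%:E).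
  exact: integrable_sumR.
rewrite -[leLHS]addr0 -VW0 -(RintegralD measurableT (sqint_sqr sV) Is).
apply: le_Rintegral => //.
- by have := integrableD measurableT (sqint_sqr sV) Is.
- exact: sqint_sqr.
move=> w _.
have WV : W w = V w + (t - 1) * \sum_k lambda k * (m k w - X k w).
  rewrite /W /V; under [X in _ = _ + (t - 1) * X]eq_bigr do rewrite mulrBr.
  by rewrite sumrB; ring.
have -> : \sum_k (2 * (t - 1) * lambda k) * (V w * (m k w - X k w)) =
    2 * V w * ((t - 1) * \sum_k lambda k * (m k w - X k w)).
  by rewrite !mulr_sumr; apply: eq_bigr => k _; ring.
rewrite WV; set u := (t - 1) * _.
by have := sqr_ge0 u; nra.
Qed.

End projections.

(** * Proof of the proposition *)

Section equality_of_values.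
Context {R : realType} {dO : measure_display} {Omega : measurableType dO}.
Variables (P : probability Omega R) (d K : nat) (t : R).
Hypothesis t1 : 1 < t.
Variable lambda : 'I_K -> R.
Hypothesis lambda_gt0 : forall k, 0 < lambda k.
Hypothesis lambda_sum : \sum_(k < K) lambda k = 1.
Variables (nu1 : probability 'rV[R]_d R) (nu0 : 'I_K -> probability 'rV[R]_d R).
Hypothesis nu1_P2 : finite_second_moment nu1.
Hypothesis nu0_P2 : forall k, finite_second_moment (nu0 k).
Variable Y : {mfun Omega >-> 'rV[R]_d}.
Hypothesis Y_L2 : in_L2 P Y.
Hypothesis Y_law : same_law (distribution P Y) nu1.

Lemma integral_law (f : 'rV[R]_d -> \bar R) : measurable_fun setT f ->
  (\int[nu1]_y f y = \int[P]_w f (Y w))%E.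
Proof.
move=> mf; rewrite -(integral_distribution_measurable P Y mf).
by apply: eq_measure_integral => A mA _; exact: esym (Y_law mA).
Qed.

Lemma sqint_law (f : 'rV[R]_d -> R) : sqint nu1 f -> sqint P (f \o Y).
Proof.
by apply: (sqint_comp (measurable_funPT Y)) => A mA; exact: esym (Y_law mA).
Qed.

Lemma sqint_law_inv (f : 'rV[R]_d -> R) : measurable_fun setT f ->
  sqint P (f \o Y) -> sqint nu1 f.
Proof.
move=> mf sf; apply: measurable_sqr_lty_sqint => //.
rewrite integral_law; first exact: sqint_lty.
exact/measurable_EFinP/measurable_funX.
Qed.

Let sY j : sqint P (fun w => Y w ord0 j).
Proof. by have /in_L2P := Y_L2; exact. Qed.

Section admissible_couplings.
Variable pi : 'I_K -> probability ('rV[R]_d * 'rV[R]_d)%type R.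
Variable p : 'I_K -> R.-pker 'rV[R]_d ~> 'rV[R]_d.
Hypothesis pi_adm : Q'_admissible nu1 nu0 pi.
Hypothesis pip : forall k, disintegration_fst nu1 (pi k) (p k).

Let b k (y : 'rV[R]_d) := barycenter (p k y).
Let mb k : measurable_fun setT (b k). Proof. exact: kernel_measurable_barycenter. Qed.

Definition barycentric_cost : \bar R := ((2^-1)%:E *
  \int[nu1]_y ((enorm (t *: y -
     (t - 1) *: \sum_(k < K) lambda k *: barycenter (p k y))) ^+ 2)%:E)%E.

Lemma Q'_value_le_barycentric : (Q'_value t lambda nu1 nu0 <= barycentric_cost)%E.
Proof. by apply: ereal_inf_lbound; exists pi; split => //; exists p. Qed.

Lemma sqint_barycenter_law k j : sqint P (fun w => b k (Y w) ord0 j).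
Proof. exact: sqint_law (sqint_barycenter (pi_adm k) (pip k) (nu0_P2 k) j). Qed.

Lemma barycenter_map : exists Z : 'I_K -> {mfun Omega >-> 'rV[R]_d},
  forall k w, Z k w = b k (Y w).
Proof.
have mbY k : measurable_fun setT (b k \o Y) by exact: measurableT_comp.
by exists (fun k => HB.pack (b k \o Y) (isMeasurableFun.Build _ _ _ _ _ (mbY k))
  : {mfun Omega >-> 'rV[R]_d}).
Qed.

Lemma barycenter_map_admissible (Z : 'I_K -> {mfun Omega >-> 'rV[R]_d}) :
  (forall k, {ae P, forall w, Z k w = b k (Y w)}) -> Q_admissible P nu0 Z.
Proof.
move=> Zb k; split.
  apply/in_L2P => j; apply: ae_eq_sqint (sqint_barycenter_law k j).
    by apply: measurable_rowP.
  by apply: filterS (Zb k) => w ->.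
move=> phi /convex_subdifferentiable sphi.
have mphi := subdifferentiable_measurable sphi.
apply: le_trans (barycenter_convex (pi_adm k) (pip k) (nu0_P2 k) sphi).
rewrite integral_distribution_measurable; last exact/measurable_EFinP.
rewrite (integral_law (f := fun y => (phi (b k y))%:E)); last first.
  by apply/measurable_EFinP/(measurableT_comp mphi).
rewrite le_eqVlt; apply/orP; left; apply/eqP; apply: ae_eq_integral => //.
- by apply/measurable_EFinP/(measurableT_comp mphi).
- by apply/measurable_EFinP/(measurableT_comp mphi)/(measurableT_comp (mb k)).
- by apply: filterS (Zb k) => w ->.
Qed.

Lemma barycenter_map_cost (Z : 'I_K -> {mfun Omega >-> 'rV[R]_d}) :
  (forall k, {ae P, forall w, Z k w = b k (Y w)}) ->
  Q_cost P t lambda Y Z = barycentric_cost.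
Proof.
move=> Zb; rewrite Q_costE /barycentric_cost (barycentric_costE t lambda Y_law mb).
congr (_ * _)%E; apply: eq_bigr => j _.
have sZ k : sqint P (fun w => Z k w ord0 j).
  apply: ae_eq_sqint (sqint_barycenter_law k j); first exact: measurable_rowP.
  by apply: filterS (Zb k) => w ->.
apply: ae_eq_integral => //.
- apply/measurable_EFinP/measurable_funX/measurable_funB; first by apply: measurable_funM => //; case: (sY j).
  apply: measurable_funM => //; apply: measurable_sum => k.
  by apply: measurable_funM => //; case: (sZ k).
- apply/measurable_EFinP/measurable_funX/measurable_funB; first by apply: measurable_funM => //; case: (sY j).
  apply: measurable_funM => //; apply: measurable_sum => k.
  by apply: measurable_funM => //; case: (sqint_barycenter_law k j).
have : {ae P, forall w k, Z k w = b k (Y w)} by apply: filter_forall => k; exact: Zb.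
by apply: filterS => w ZbY _; under eq_bigr do rewrite ZbY.
Qed.

(* Only the moments of [pi k] against functions of the first variable enter,
   so this shows that the cost does not depend on the disintegration, and that
   conditioning on [Y] lowers the cost. *)
Lemma barycentric_cost_le (X : 'I_K -> 'I_d -> Omega -> R) :
  (forall k j, sqint P (X k j)) ->
  (forall k j v, sqint nu1 v ->
    \int[pi k]_z (v z.1 * z.2 ord0 j)%:E = \int[P]_w (v (Y w) * X k j w)%:E)%E ->
  (barycentric_cost <= (2^-1)%:E * \sum_j \int[P]_w
    ((t * Y w ord0 j - (t - 1) * \sum_k lambda k * X k j w) ^+ 2)%:E)%E.
Proof.
move=> sX piX; rewrite /barycentric_cost (barycentric_costE t lambda Y_law mb).
apply: lee_wpmul2l; first by rewrite lee_fin invr_ge0.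
apply: lee_sum => j _.
apply: (orthogonal_le (m := fun k w => b k (Y w) ord0 j)) => // [k|k].
  exact: sqint_barycenter_law.
pose v (y : 'rV[R]_d) := t * y ord0 j - (t - 1) * \sum_k lambda k * b k y ord0 j.
have mv : measurable_fun setT v.
  apply: measurable_funB; first by apply: measurable_funM => //; exact: measurable_coord.
  apply: measurable_funM => //; apply: measurable_sum => i.
  by apply: measurable_funM => //; exact: measurable_rowP.
have sv : sqint nu1 v.
  apply: sqint_law_inv => //.
  apply: sqintB; [exact: sqintZ|apply: sqintZ; apply: sqint_sum => i].
  by apply: sqintZ; exact: sqint_barycenter_law.
congr fine; rewrite -[RHS](piX k j v sv).
rewrite (integral_barycenterM (pi_adm k) (pip k) (nu0_P2 k) j sv).
rewrite (integral_law (f := fun y => (v y * b k y ord0 j)%:E))//.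
by apply/measurable_EFinP/measurable_funM => //; exact: measurable_rowP.
Qed.

End admissible_couplings.

(** The barycenters of [p'] have the same moments against functions of [y] as [pi], so they may play
    the competitor in the projection inequality; exchanging [p] and [p'] gives equality. *)
Lemma barycentric_cost_kernel_le pi p p' : Q'_admissible nu1 nu0 pi ->
  (forall k, disintegration_fst nu1 (pi k) (p k)) ->
  (forall k, disintegration_fst nu1 (pi k) (p' k)) ->
  (barycentric_cost p <= barycentric_cost p')%E.
Proof.
move=> pi_adm pip pip'.
have [Z Zb] := barycenter_map p'.
rewrite -(barycenter_map_cost pi_adm pip' (Z := Z)); last first.
  by move=> k; apply: aeW => w; exact: Zb.
rewrite Q_costE.
apply: (barycentric_cost_le pi_adm pip (X := fun k j w => Z k w ord0 j)).
  move=> k j; under eq_fun do rewrite Zb.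
  exact: (sqint_barycenter_law pi_adm pip').
move=> k j v sv.
rewrite (integral_barycenterM (pi_adm k) (pip' k) (nu0_P2 k) j sv).
rewrite integral_law; first by under [RHS]eq_integral do rewrite Zb.
apply/measurable_EFinP/measurable_funM; first by case: sv.
by apply: measurable_rowP; exact: kernel_measurable_barycenter.
Qed.

Lemma Q_value_Q'_value : Q_value P t lambda nu0 Y = Q'_value t lambda nu1 nu0.
Proof.
apply/eqP; rewrite eq_le; apply/andP; split; last first.
  apply: le_ereal_inf_tmp => _ [Z Zadm <-].
  exact: (Q'_value_le_cost t1 lambda_gt0 lambda_sum nu1_P2 nu0_P2 Y_L2 Y_law).
apply: le_ereal_inf_tmp => _ [pi [pi_adm [p [pip ->]]]].
have [Z Zb] := barycenter_map p.
have Zae k : {ae P, forall w, Z k w = barycenter (p k (Y w))}.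
  by apply: aeW => w; exact: Zb.
rewrite -[leRHS](barycenter_map_cost pi_adm pip Zae).
by apply: ereal_inf_lbound; exists Z => //; exact: (barycenter_map_admissible pi_adm pip).
Qed.

Lemma barycenter_map_solution pi p (Z : 'I_K -> {mfun Omega >-> 'rV[R]_d}) :
  Q'_solution t lambda nu1 nu0 pi ->
  (forall k, disintegration_fst nu1 (pi k) (p k)) ->
  (forall k, {ae P, forall w, Z k w = barycenter (p k (Y w))}) ->
  Q_solution P t lambda nu0 Y Z.
Proof.
move=> [pi_adm [p' [pip' vE]]] pip Zb; split.
  exact: (barycenter_map_admissible pi_adm pip).
rewrite Q_value_Q'_value vE (barycenter_map_cost pi_adm pip Zb).
rewrite -/(barycentric_cost p'); apply/eqP; rewrite eq_le; apply/andP; split.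
  exact: (barycentric_cost_kernel_le pi_adm pip pip').
exact: (barycentric_cost_kernel_le pi_adm pip' pip).
Qed.

(** The family [pi] is only required to agree with the push-forwards on measurable sets, so the
    result also covers couplings specified by test functions. *)
Lemma coupling_solution (Z : 'I_K -> {mfun Omega >-> 'rV[R]_d})
    (gamma : 'I_K -> probability (Omega * 'rV[R]_d)%type R)
    (g : 'I_K -> R.-pker Omega ~> 'rV[R]_d)
    (pi : 'I_K -> probability ('rV[R]_d * 'rV[R]_d)%type R) :
  Q_solution P t lambda nu0 Y Z ->
  (forall k, coupling P (nu0 k) (gamma k)) ->
  (forall k, disintegration_fst P (gamma k) (g k)) ->
  (forall k, {ae P, forall w, Z k w = barycenter (g k w)}) ->
  (forall k C, measurable C -> pi k C = distribution (gamma k) (map_fst Y) C) ->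
  Q'_solution t lambda nu1 nu0 pi.
Proof.
move=> [Zadm Zval] gcpl gdis Zb piE.
have pi_adm : Q'_admissible nu1 nu0 pi.
  move=> k; have [g1 g2] := gcpl k; split => A mA; rewrite /pushforward piE.
  - have mYA : measurable (Y @^-1` A) by exact: measurable_funPTI.
    exact: etrans (g1 _ mYA) (Y_law mA).
  - by rewrite -[X in measurable X]setTI; exact: measurable_fst.
  - exact: g2.
  - by rewrite -[X in measurable X]setTI; exact: measurable_snd.
have pi_fst k A : measurable A -> pi k (A `*` setT) = nu1 A.
  move=> mA; have [<- // _] := pi_adm k.
  by rewrite /pushforward; congr (pi k _); apply/seteqP; split => z //= [].
have /choice[p pip] k := disintegration_exists (pi_fst k).
split => //; exists p; split => //.
apply/eqP; rewrite eq_le -/(barycentric_cost p); apply/andP; split.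
  exact: (Q'_value_le_barycentric pi_adm pip).
rewrite -Q_value_Q'_value -Zval Q_costE.
have sZ k j : sqint P (fun w => Z k w ord0 j).
  by have [/in_L2P + _] := Zadm k; exact.
apply: (barycentric_cost_le pi_adm pip (X := fun k j w => Z k w ord0 j)) => //.
move=> k j v sv; have [mv _] := sv.
have svY := sqint_law sv.
rewrite (eq_measure_integral (distribution (gamma k) (map_fst Y))); last first.
  by move=> C mC _; exact: piE.
rewrite (integral_distribution_measurable (gamma k) (map_fst Y)
  (f := fun z => (v z.1 * z.2 ord0 j)%:E)); last first.
  apply/measurable_EFinP/measurable_funM.
    exact: (measurableT_comp mv measurable_fst).
  exact: (measurableT_comp (measurable_coord j) measurable_snd).
(* Under [gamma k] the test function depends on [w] through [Y w] alone, so integrating out [z]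
   leaves the barycenter of [g k w], which is [Z k w]. *)
rewrite [LHS](integral_barycenterM (gcpl k) (gdis k) (nu0_P2 k) j svY).
apply: ae_eq_integral => //.
- apply/measurable_EFinP/measurable_funM; first by case: svY.
  by apply: measurable_rowP; exact: kernel_measurable_barycenter.
- apply/measurable_EFinP/measurable_funM; first by case: svY.
  by case: (sZ k j).
- by apply: filterS (Zb k) => w ->.
Qed.

End equality_of_values.
Theorem proposition3p13 (R : realType) (dO : measure_display)
    (Omega : measurableType dO) (P : probability Omega R)
    (P_atomless : atomless P) (P_separable : separable_probability P)
    (d K : nat) (hK : (1 <= K)%N) (t : R) (ht : 1 < t)
    (lambda : 'I_K -> R) (lambda_gt0 : forall k, 0 < lambda k)
    (lambda_sum : \sum_(k < K) lambda k = 1)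
    (nu1 : probability 'rV[R]_d R) (nu0 : 'I_K -> probability 'rV[R]_d R)
    (nu1_P2 : finite_second_moment nu1)
    (nu0_P2 : forall k, finite_second_moment (nu0 k))
    (Y : {mfun Omega >-> 'rV[R]_d}) (Y_L2 : in_L2 P Y)
    (Y_law : same_law (distribution P Y) nu1) :
  [/\ Q_value P t lambda nu0 Y = Q'_value t lambda nu1 nu0,
      forall (pi : 'I_K -> probability ('rV[R]_d * 'rV[R]_d)%type R)
             (p : 'I_K -> R.-pker 'rV[R]_d ~> 'rV[R]_d),
        Q'_solution t lambda nu1 nu0 pi ->
        (forall k, disintegration_fst nu1 (pi k) (p k)) ->
        (exists Z : 'I_K -> {mfun Omega >-> 'rV[R]_d},
           forall k, {ae P, forall w, Z k w = barycenter (p k (Y w))}) /\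
        (forall Z : 'I_K -> {mfun Omega >-> 'rV[R]_d},
           (forall k, {ae P, forall w, Z k w = barycenter (p k (Y w))}) ->
           Q_solution P t lambda nu0 Y Z)
    & forall (Z : 'I_K -> {mfun Omega >-> 'rV[R]_d})
             (gamma : 'I_K -> probability (Omega * 'rV[R]_d)%type R)
             (g : 'I_K -> R.-pker Omega ~> 'rV[R]_d),
        Q_solution P t lambda nu0 Y Z ->
        (forall k, coupling P (nu0 k) (gamma k)) ->
        (forall k, disintegration_fst P (gamma k) (g k)) ->
        (forall k, {ae P, forall w, Z k w = barycenter (g k w)}) ->
        Q'_solution t lambda nu1 nu0
          (fun k => distribution (gamma k) (map_fst Y)) /\
        (forall e : R.-pker 'rV[R]_d ~> Omega,
           disintegration_snd nu1 (distribution P (id_pair Y)) e ->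
           (forall k, glued_coupling nu1 e (g k)
              (distribution (gamma k) (map_fst Y))) /\
           (forall pi : 'I_K -> probability ('rV[R]_d * 'rV[R]_d)%type R,
              (forall k, glued_coupling nu1 e (g k) (pi k)) ->
              Q'_solution t lambda nu1 nu0 pi))].
Proof.
split.
- exact: (Q_value_Q'_value ht lambda_gt0 lambda_sum nu1_P2 nu0_P2 Y_L2 Y_law).
- move=> pi p pi_sol pip; split.
    have [Z Zb] := barycenter_map Y p.
    by exists Z => k; apply: aeW => w; exact: Zb.
  move=> Z; exact: (barycenter_map_solution ht lambda_gt0 lambda_sum nu1_P2
    nu0_P2 Y_L2 Y_law pi_sol pip).
move=> Z gamma g Zsol gcpl gdis Zb; split.
  exact: (coupling_solution ht lambda_gt0 lambda_sum nu1_P2 nu0_P2 Y_L2 Y_law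
    Zsol gcpl gdis Zb).
move=> e Ye; have glued k := glued_coupling_distribution (gdis k) Ye.
split => // pi pi_glued.
apply: (coupling_solution ht lambda_gt0 lambda_sum nu1_P2 nu0_P2 Y_L2 Y_law
  Zsol gcpl gdis Zb) => k C mC.
(* The gluing formula tests only bounded continuous functions, and these determine [pi k] on all
   measurable sets. *)
apply: continuous_unique mC => f cf bf.
by rewrite (pi_glued k f cf bf); apply/esym; exact: glued.
Qed.
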